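(* There exist universal constants $c,C>0$ such that the following holds for every $\kappa\ge C$ and every $0<\delta\le c$. Let $T\ge1$ be an integer and consider any (possibly randomized) algorithm making $T$ queries to a first-order oracle. Suppose that for every dimension $n$ and every strongly convex quadratic function of the form $$f(x)=\tfrac12\|Ax-b\|^2,\qquad x\in\mathbb{R}^n,$$ with $b\in\mathbb{R}^n$ and $A\in\mathbb{R}^{n\times n}$ symmetric and nonsingular such that the Hessian $\nabla^2 f=A^2$ has condition number at most $\kappa$, the algorithm satisfies $$\mathbb{P}_{\mathrm{Alg}}\left(f(x_T)-f^\star\le\delta\,\bigl(f(0)-f^\star\bigr)\right)\ge\tfrac23,\qquad f^\star:=\inf_{x}f(x).$$ Then $$T\ \ge\ c\,\sqrt{\kappa}\,\log(1/\delta).$$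
   Context: $\|\cdot\|$ is the Euclidean norm. The condition number of a nonsingular matrix is the ratio of its largest to its smallest singular value. Oracle model: the algorithm knows $n$ and accesses the unknown function $f$ only through a first-order oracle. At each iteration $t=1,\ldots,T$ it chooses $x_t\in\mathbb{R}^n$ as an arbitrary (measurable) function of the previous queries and oracle responses and, if randomized, of its internal randomness (independent of the input), and receives the function value and gradient $(f(x_t),\nabla f(x_t))$. There is no restriction on computation. The output of the algorithm is its last query $x_T$. $\mathbb{P}_{\mathrm{Alg}}$ denotes probability over the algorithm's internal randomness, for a fixed input. *)

(* Defs.v *)
From HB Require Import structures.
From mathcomp Require Import all_boot all_order all_algebra.
From mathcomp Require Import all_classical all_reals all_analysis.

Set Implicit Arguments.
Unset Strict Implicit.
Unset Printing Implicit Defensive.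

Import Order.TTheory GRing.Theory Num.Theory.
Import numFieldNormedType.Exports.

Local Open Scope classical_set_scope.
Local Open Scope ring_scope.

(* The Borel structure of R^n: the product sigma-algebra, generated by the
   coordinates, as the library does for n.-tuple R. *)
Definition measure_cV_display : measure_display.
Proof. exact. Qed.

Section measurable_cV.
Context {R : realType} {n : nat}.

Let coors : 'I_n -> 'cV[R]_n -> R := fun i x => x i 0.

Let cV_set0 : g_sigma_preimage coors set0.
Proof. exact: sigma_algebra0. Qed.

Let cV_setC A : g_sigma_preimage coors A -> g_sigma_preimage coors (~` A).
Proof. exact: sigma_algebraC. Qed.

Let cV_bigcup (F : (set 'cV[R]_n)^nat) :
  (forall i, g_sigma_preimage coors (F i)) ->
  g_sigma_preimage coors (\bigcup_i (F i)).
Proof. exact: sigma_algebra_bigcup. Qed.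

HB.instance Definition _ := @isMeasurable.Build measure_cV_display
  'cV[R]_n (g_sigma_preimage coors) cV_set0 cV_setC cV_bigcup.

End measurable_cV.

Lemma measurable_fun_cVP (R : realType) n d (T : measurableType d)
    (f : T -> 'cV[R]_n) :
  measurable_fun [set: T] f <->
  forall i, measurable_fun [set: T] (fun x => f x i 0).
Proof.
apply: (@iff_trans _ (g_sigma_preimage
    (fun i => (fun x : 'cV[R]_n => x i 0) \o f) `<=` measurable)).
  rewrite (g_sigma_preimage_comp (fun i (x : 'cV[R]_n) => x i 0)).
  split=> [mf A [/= C preC <-]|prefS]; first exact: mf.
  by move=> _ A mA; apply: prefS; exists A.
split=> [fS i|mf].
- move=> _ A mA; apply: fS; apply: sub_sigma_algebra.
  case: n i => [[] []//|n i] in f *.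
  rewrite -bigcup_mkord_ord; exists i; first exact: ltn_ord.
  by exists A => //; rewrite inord_val.
- apply: smallest_sub; first exact: sigma_algebra_measurable.
  case: n => [|n] in f mf *; first by rewrite big_ord0.
  rewrite -bigcup_mkord_ord; apply: bigcup_sub => i Ii.
  by move=> A [B mB <-]; exact: mf.
Qed.

(* The library norm on matrices is the sup norm. *)
Definition enorm (R : realType) (n : nat) (x : 'cV[R]_n) : R :=
  Num.sqrt (\sum_i x i 0 ^+ 2).

Definition gradient (R : realType) (n : nat) (f : 'cV[R]_n -> R)
    (x : 'cV[R]_n) : 'cV[R]_n :=
  \col_i 'D_(delta_mx i 0) f x.

Definition hessian (R : realType) (n : nat) (f : 'cV[R]_n -> R)
    (x : 'cV[R]_n) : 'M[R]_n :=
  \matrix_(i, j) 'D_(delta_mx i 0) ('D_(delta_mx j 0) f) x.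

Definition singular_values (R : realType) (n : nat) (M : 'M[R]_n) : set R :=
  [set Num.sqrt a | a in [set a | eigenvalue (M^T *m M) a]].

(* For n > 0 the set of singular values is finite and nonempty, so that sup and
   inf are its maximum and minimum. *)
Definition cond_number (R : realType) (n : nat) (M : 'M[R]_n) : R :=
  sup (singular_values M) / inf (singular_values M).

Definition least_squares (R : realType) (n : nat) (A : 'M[R]_n)
    (b x : 'cV[R]_n) : R :=
  2^-1 * enorm (A *m x - b) ^+ 2.

(* One round of interaction: the query and the oracle's answer, that is the
   value and the gradient at the query. *)
Definition round (R : realType) (n : nat) : Type :=
  ('cV[R]_n * (R * 'cV[R]_n))%type.

(* A randomized first-order algorithm in dimension n. The seed carries the
   internal randomness; a deterministic algorithm is the case of a one-point
   seed space. The map alg_next of index t computes the (t+1)-st query from the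
   seed and the first t rounds (most recent first); only the maps with t < T
   matter for an algorithm making T queries. *)
Record algorithm (R : realType) (n : nat) := Algorithm {
  alg_disp : measure_display ;
  alg_seed : measurableType alg_disp ;
  alg_prob : probability alg_seed R ;
  alg_next : forall t : nat, alg_seed * t.-tuple (round R n) -> 'cV[R]_n ;
  alg_next_measurable : forall t : nat, measurable_fun setT (@alg_next t)
}.

Fixpoint transcript (R : realType) (n : nat) (a : algorithm R n)
    (f : 'cV[R]_n -> R) (w : alg_seed a) (t : nat) : t.-tuple (round R n) :=
  if t is s.+1 then
    let h := transcript f w s in
    let x := alg_next (w, h) in
    [tuple of (x, (f x, gradient f x)) :: h]
  else [tuple].

(* The t-th query x_t, for t >= 1. *)
Definition query (R : realType) (n : nat) (a : algorithm R n)
    (f : 'cV[R]_n -> R) (t : nat) (w : alg_seed a) : 'cV[R]_n :=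
  alg_next (w, transcript f w t.-1).

(* Main.v *)
(** The hard instance: split the coordinates into layers 0, ..., L with L = 2T,
    each much larger than the previous one, and let A = a S + U + U^T, where S is
    the diagonal of the signs (-1)^layer and U is a Gaussian matrix sending layer i
    to layer i + 1; b is the unit vector of the one-point layer 0. As S
    anticommutes with U + U^T, we have A^2 = a^2 + (U + U^T)^2, and U is nearly
    isometric on each layer (up to the factor sqrt a on layer 0) with probability
    at least 1/2, so that a = 4 / sqrt kappa gives condition number at most kappa.

    The oracle's answer at x is a function of A x, A (A x) and A b. Hence T queries
    amount to 2T adaptive matrix-vector products, and, by rotation invariance of
    the Gaussian measure and induction on i, the first i vectors are almost
    orthogonal to the hidden vector U^i b of layer i. So the last query x is almost
    orthogonal to U^L b. A combination q of the vectors U^i b, with coefficients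
    bounded by (1 + a)^i, satisfies <q, b> = 1 and makes A q almost parallel to
    U^L b. Then <q, b - A x> is almost 1, whereas |q| <= (1 + a)^(L + 1), and the
    residual |b - A x| <= sqrt delta is impossible unless T is of order
    sqrt kappa * log (1 / delta). Averaging over the instance at a fixed seed
    covers randomized algorithms. *)
Require Import Defs.
From HB Require Import structures.
From mathcomp Require Import all_boot all_order all_algebra.
From mathcomp Require Import all_classical all_reals all_analysis.
From mathcomp Require Import measurable_realfun ring lra.

Set Implicit Arguments.
Unset Strict Implicit.
Unset Printing Implicit Defensive.

Import Order.TTheory GRing.Theory Num.Theory.
Import numFieldNormedType.Exports.

Local Open Scope classical_set_scope.
Local Open Scope ring_scope.

(** The scaling by sqrt a at layer 0 is what makes the bound valid for all small [delta], however
    small [kappa] makes a. The terms of q are orthogonal, the i-th one having squared length at most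
    2 a (1 + a)^(2 i) for i > 0, and the factor 2 a lets their sum telescope to (1 + a)^(2 (L + 1)).
    With an unscaled first coupling the same estimate would lose a factor of order 1 / a, turning
    log (1 / delta) into log (a / delta).

    Adaptivity is handled without conditional laws. If a direction is computed from the answers to
    adaptive linear measurements of a Gaussian vector and is orthogonal to all of them, the
    projection of the vector on it has the second moment expected of an independent direction. This
    one identity yields the mixed and fourth moments, the concentration of U^T U and the secrecy of
    the hidden vectors, so that Markov's inequality is the only tail bound.

    The near isometry of U involves entries not yet measured, so it cannot enter such a direction; a
    bound on the length of the current hidden vector, which is already determined, takes its
    place. *)

(** * Integration against the standard normal law on the line *)

Section gaussian_line.
Context {R : realType}.
Local Notation lam := (@lebesgue_measure R).
Local Notation g1 := (@normal_prob R 0 1).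
Local Notation phi := (@normal_pdf R 0 1).
Implicit Types (f : measurableTypeR R -> \bar R).

Import HBNNSimple.

Let mphi : measurable_fun [set: measurableTypeR R] (fun x => (phi x)%:E).
Proof. by apply/measurable_EFinP; exact: measurable_normal_pdf. Qed.

Let phi_ge0 x : (0 <= (phi x)%:E)%E.
Proof. by rewrite lee_fin normal_pdf_ge0. Qed.

Let integral_normal_prob_nnsfun (h : {nnsfun measurableTypeR R >-> R}) :
  (\int[g1]_x (h x)%:E = \int[lam]_x ((h x)%:E * (phi x)%:E))%E.
Proof.
under [LHS]eq_integral do rewrite fimfunE -fsumEFin//.
rewrite [LHS]ge0_integral_fsum//; last 2 first.
  - by move=> r; apply/measurable_EFinP; apply: measurableT_comp => //; exact: measurable_indic.
  - by move=> r x _; rewrite EFinM nnfun_muleindic_ge0.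
under [RHS]eq_integral.
  move=> x _; rewrite fimfunE -fsumEFin// ge0_mule_fsuml; last first.
    by move=> r; rewrite EFinM nnfun_muleindic_ge0.
  over.
rewrite [RHS]ge0_integral_fsum//; last 2 first.
  - move=> r; apply: emeasurable_funM; last exact: mphi.
    by apply/measurable_EFinP; apply: measurableT_comp => //; exact: measurable_indic.
  - by move=> r x _; rewrite mule_ge0// EFinM nnfun_muleindic_ge0.
apply: eq_fsbigr => r _.
have [hr|hr] := eqVneq (h @^-1` [set r]) set0.
  rewrite hr; under eq_integral do rewrite indic0 mulr0.
  under [RHS]eq_integral do rewrite indic0 mulr0 mul0e.
  by rewrite !integral0.
have r0 : 0 <= r.
  by have /set0P[x /= <-] := hr.
under eq_integral do rewrite EFinM.
under [RHS]eq_integral do rewrite EFinM -muleA.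
rewrite !ge0_integralZl//; last 3 first.
  - apply: emeasurable_funM; last exact: mphi.
    exact/measurable_EFinP.
  - by move=> x _; rewrite mule_ge0// lee_fin.
  - exact/measurable_EFinP.
congr (_ * _)%E; rewrite integral_indic// setIT.
rewrite -[LHS]/(\int[lam]_(x in h @^-1` [set r]) (phi x)%:E)%E.
rewrite [LHS]integral_mkcond; apply: eq_integral => x _.
by rewrite patchE indicE; case: ifP => _; rewrite ?mul1e ?mul0e.
Qed.

Lemma ge0_integral_normal_prob f :
  measurable_fun setT f -> (forall x, 0 <= f x)%E ->
  (\int[g1]_x f x = \int[lam]_x (f x * (phi x)%:E))%E.
Proof.
move=> mf f0; pose f_ := nnsfun_approx measurableT mf.
transitivity (lim (\int[g1]_x (f_ n x)%:E @[n --> \oo])%E).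
  rewrite -monotone_convergence//=.
  - apply: eq_integral => ? _; apply/esym/cvg_lim => //=.
    exact: cvg_nnsfun_approx.
  - by move=> n; exact/measurable_EFinP.
  - by move=> n ? _; rewrite lee_fin.
  - by move=> ? _ ? ? mn; rewrite lee_fin; exact/lefP/nd_nnsfun_approx.
rewrite (_ : (fun _ => _) =
    (fun n => \int[lam]_x ((f_ n x)%:E * (phi x)%:E))%E); last first.
  by apply/funext => n; exact: integral_normal_prob_nnsfun.
rewrite -monotone_convergence//=.
- apply: eq_integral => x _; apply/cvg_lim => //=.
  under eq_fun do rewrite muleC.
  rewrite muleC; apply: cvgeZl => //.
  exact: cvg_nnsfun_approx.
- by move=> n; apply: emeasurable_funM => //; exact/measurable_EFinP.
- by move=> n x _; rewrite mule_ge0// lee_fin.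
- move=> x _ m n mn; apply: lee_wpmul2r => //.
  by rewrite lee_fin; exact/lefP/nd_nnsfun_approx.
Qed.

Lemma ge0_integral_lebesgue_shift f (t : R) :
  measurable_fun setT f -> (forall x, 0 <= f x)%E ->
  (\int[lam]_x f ((x : R) + t)%R = \int[lam]_x f x)%E.
Proof.
move=> mf f0.
have mshift : measurable_fun setT ((fun x : R => x + t) : measurableTypeR R -> measurableTypeR R).
  by apply: measurable_funD => //; exact: measurable_cst.
have /= <- := @ge0_integral_pushforward _ _ _ _ _ _ mshift lam setT f
   measurableT mf (fun _ _ => f0 _).
apply: eq_measure_integral => A mA _; apply/esym.
apply: lebesgue_measure_unique => //= _ [[a b]] _ <-.
rewrite /pushforward (_ : _ @^-1` _ = `]a - t, b - t]%classic); last first.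
  by apply/seteqP; split => x /=; rewrite !in_itv/= ltrBlDr lerBrDr.
rewrite !lebesgue_measure_itv/= !lte_fin ltrD2r.
by case: ifP => // _; congr EFin; ring.
Qed.

Lemma ge0_integral_lebesgueN f :
  measurable_fun setT f -> (forall x, 0 <= f x)%E ->
  (\int[lam]_x f (- (x : R))%R = \int[lam]_x f x)%E.
Proof.
move=> mf f0.
have mopp : measurable_fun setT (-%R : measurableTypeR R -> measurableTypeR R).
  exact: oppr_measurable.
have /= <- := @ge0_integral_pushforward _ _ _ _ _ _ mopp lam setT f
   measurableT mf (fun _ _ => f0 _).
by apply: eq_measure_integral => A mA _; exact: lebesgue_measureN.
Qed.

End gaussian_line.

(** * Rotation invariance of the standard normal law on the plane *)

Section gaussian_plane.
Context {R : realType}.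
Local Notation T := (measurableTypeR R).
Local Notation lam := (@lebesgue_measure R).
Local Notation g1 := (@normal_prob R 0 1).
Local Notation phi := (@normal_pdf R 0 1).
Implicit Types (F : T * T -> \bar R).
Local Open Scope ereal_scope.

Lemma measurable_plane_linear (a b c d : R) :
  measurable_fun [set: T * T]
    ((fun p : R * R => (a * p.1 + b * p.2, c * p.1 + d * p.2)%R)
      : T * T -> T * T).
Proof.
have m1 : measurable_fun [set: T * T] ((fun p => p.1 : R) : T * T -> R).
  exact: measurable_fst.
have m2 : measurable_fun [set: T * T] ((fun p => p.2 : R) : T * T -> R).
  exact: measurable_snd.
apply/measurable_fun_pairP; split => /=;
  apply: measurable_funD; apply: measurable_funM => //; exact: measurable_cst.
Qed.

Lemma ge0_integral_shear_left F (t : R) :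
  measurable_fun setT F -> (forall p, 0 <= F p) ->
  \int[lam]_x \int[lam]_y F ((x : R) + t * (y : R), y)%R =
  \int[lam]_x \int[lam]_y F (x, y).
Proof.
move=> mF F0.
pose G : T * T -> \bar R := F \o (fun p : R * R => (1 * p.1 + t * p.2, 0 * p.1 + 1 * p.2)%R).
have mG : measurable_fun setT G.
  by apply: measurableT_comp => //; exact: measurable_plane_linear.
have GE (x y : R) : F (x + t * y, y)%R = G (x, y).
  by rewrite /G/= !mul1r mul0r add0r.
under eq_integral do under eq_integral do rewrite GE.
have G0 p : 0 <= G p by exact: F0.
transitivity (\int[lam]_y \int[lam]_x G (x, y)).
  exact: (fubini_tonelli (m1 := lam) (m2 := lam) G mG G0).
transitivity (\int[lam]_y \int[lam]_x F (x, y)); last first.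
  exact/esym/(fubini_tonelli (m1 := lam) (m2 := lam) F mF F0).
apply: eq_integral => y _.
under eq_integral do rewrite -GE.
rewrite (ge0_integral_lebesgue_shift (f := fun x => F (x, y)))//.
exact: measurable_fun_pair1.
Qed.

Lemma ge0_integral_shear_right F (t : R) :
  measurable_fun setT F -> (forall p, 0 <= F p) ->
  \int[lam]_x \int[lam]_y F (x, (y : R) + t * (x : R))%R =
  \int[lam]_x \int[lam]_y F (x, y).
Proof.
move=> mF F0; apply: eq_integral => x _.
rewrite (ge0_integral_lebesgue_shift (f := fun y => F (x, y)))//.
exact: measurable_fun_pair2.
Qed.

(* A rotation by an angle other than pi is a product of three shears. *)
Lemma ge0_integral_lebesgue_rotation F (c s : R) : (c ^+ 2 + s ^+ 2 = 1)%R ->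
  measurable_fun setT F -> (forall p, 0 <= F p) ->
  \int[lam]_x \int[lam]_y F (c * (x : R) - s * (y : R), s * (x : R) + c * (y : R))%R =
  \int[lam]_x \int[lam]_y F (x, y).
Proof.
move=> cs mF F0.
have [c1|c1] := eqVneq c (-1)%R.
  have s0 : s = 0%R.
    by move: cs; rewrite c1 sqrrN expr1n -[RHS]addr0 => /addrI/eqP;
       rewrite sqrf_eq0 => /eqP.
  pose G (x : T) := \int[lam]_y F (x, y).
  have mG : measurable_fun setT G by exact: measurable_fun_fubini_tonelli_F.
  have G0 x : 0 <= G x by exact: integral_ge0.
  transitivity (\int[lam]_x G (- (x : R))%R); last exact: ge0_integral_lebesgueN.
  apply: eq_integral => x _.
  transitivity (\int[lam]_y F (- (x : R), - (y : R))%R).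
    by apply: eq_integral => y _; congr F; rewrite c1 s0; congr pair; ring.
  apply: (ge0_integral_lebesgueN (f := fun y => F (- (x : R), y)%R)) => //.
  exact: measurable_fun_pair2.
have c10 : (1 + c != 0)%R by rewrite addrC addr_eq0.
(* [u] is the tangent of half the rotation angle; the shears are by [-u], [s] and [-u]. For the
   angle pi, where [u] makes no sense, both coordinates were reflected above. *)
pose u : R := (s / (1 + c))%R.
have us : (1 - u * s = c)%R.
  apply: (mulfI c10); rewrite mulrBr mulr1 mulrA /u mulrCA divff// mulr1.
  by rewrite -expr2 -[X in (X + c - _)%R]cs; ring.
have uc : (u * (1 + c) = s)%R by rewrite /u divfK.
pose F1 : T * T -> \bar R := F \o (fun p : R * R => (1 * p.1 + (-u) * p.2, 0 * p.1 + 1 * p.2)%R).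
have mF1 : measurable_fun setT F1.
  by apply: measurableT_comp => //; exact: measurable_plane_linear.
pose F2 : T * T -> \bar R := F1 \o (fun p : R * R => (1 * p.1 + 0 * p.2, s * p.1 + 1 * p.2)%R).
have mF2 : measurable_fun setT F2.
  by apply: measurableT_comp => //; exact: measurable_plane_linear.
have F10 p : 0 <= F1 p by exact: F0.
have F20 p : 0 <= F2 p by exact: F0.
have F1E (x y : R) : F (x + - u * y, y)%R = F1 (x, y).
  by rewrite /F1/= mul1r mul0r add0r mul1r.
have F2E (x y : R) : F1 (x, y + s * x)%R = F2 (x, y).
  by rewrite /F2/= !mul1r mul0r addr0 addrC.
have F3E (x y : R) : F (c * x - s * y, s * x + c * y)%R = F2 (x + - u * y, y)%R.
  rewrite -F2E -F1E; congr F; congr pair.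
    transitivity ((1 - u * s) * (x - u * y) - u * y)%R; last by ring.
    by rewrite us -uc; ring.
  transitivity (s * x + (1 - u * s) * y)%R; last by ring.
  by rewrite us.
rewrite -(ge0_integral_shear_left (-u) mF F0).
under [RHS]eq_integral do under eq_integral do rewrite F1E.
rewrite -(ge0_integral_shear_right s mF1 F10).
under [RHS]eq_integral do under eq_integral do rewrite F2E.
rewrite -(ge0_integral_shear_left (-u) mF2 F20).
by under eq_integral do under eq_integral do rewrite F3E.
Qed.

Lemma normal_pdf_rotation (c s x y : R) : (c ^+ 2 + s ^+ 2 = 1)%R ->
  (phi (c * x - s * y) * phi (s * x + c * y) = phi x * phi y)%R.
Proof.
move=> cs; rewrite !normal_pdfE ?oner_neq0// /normal_fun !subr0.
rewrite mulrACA [RHS]mulrACA -!expRD; congr (_ * expR _)%R.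
rewrite -!mulrDl; congr (_ / _)%R.
by rewrite -[RHS]mul1r -cs; ring.
Qed.

Let mphi : measurable_fun setT (fun x : T => (phi x)%:E).
Proof. by apply/measurable_EFinP; exact: measurable_normal_pdf. Qed.

Lemma ge0_integral_normal_plane F :
  measurable_fun setT F -> (forall p, 0 <= F p) ->
  \int[g1]_x \int[g1]_y F (x, y) =
  \int[lam]_x \int[lam]_y (F (x, y) * (phi x * phi y)%:E).
Proof.
move=> mF F0; rewrite ge0_integral_normal_prob//; last 2 first.
  - exact: measurable_fun_fubini_tonelli_F.
  - by move=> x; exact: integral_ge0.
apply: eq_integral => x _.
have mFx : measurable_fun setT (fun y : T => F (x, y)) by exact: measurable_fun_pair2.
rewrite ge0_integral_normal_prob// -ge0_integralZr//; last 3 first.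
  - by apply: emeasurable_funM => //; exact: mphi.
  - by move=> y _; rewrite mule_ge0// lee_fin normal_pdf_ge0.
  - by rewrite lee_fin normal_pdf_ge0.
by apply: eq_integral => y _; rewrite -muleA -EFinM [(phi y * _)%R]mulrC.
Qed.

Lemma ge0_integral_normal_rotation F (c s : R) : (c ^+ 2 + s ^+ 2 = 1)%R ->
  measurable_fun setT F -> (forall p, 0 <= F p) ->
  \int[g1]_x \int[g1]_y F (c * (x : R) - s * (y : R), s * (x : R) + c * (y : R))%R =
  \int[g1]_x \int[g1]_y F (x, y).
Proof.
move=> cs mF F0.
pose H : T * T -> \bar R := fun p => F p * (phi p.1 * phi p.2)%:E.
have mH : measurable_fun setT H.
  apply: emeasurable_funM => //; apply/measurable_EFinP.
  by apply: measurable_funM; apply: measurableT_comp => //;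
    exact: measurable_normal_pdf.
have H0 p : 0 <= H p by rewrite mule_ge0// lee_fin mulr_ge0// normal_pdf_ge0.
pose G : T * T -> \bar R := F \o (fun p : R * R => (c * p.1 + (- s) * p.2, s * p.1 + c * p.2)%R).
have mG : measurable_fun setT G.
  by apply: measurableT_comp => //; exact: measurable_plane_linear.
have GE (x y : R) : F (c * x - s * y, s * x + c * y)%R = G (x, y).
  by rewrite /G/= mulNr.
under eq_integral do under eq_integral do rewrite GE.
have G0 p : 0 <= G p by exact: F0.
rewrite (ge0_integral_normal_plane mG G0) (ge0_integral_normal_plane mF F0).
rewrite -(ge0_integral_lebesgue_rotation cs mH H0).
apply: eq_integral => x _; apply: eq_integral => y _.
by rewrite /H/= normal_pdf_rotation// GE.
Qed.

End gaussian_plane.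

(** * The Euclidean inner product *)

Definition dot (R : realType) n (u v : 'cV[R]_n) : R := \sum_i u i 0 * v i 0.

Section dot_theory.
Context {R : realType}.
Implicit Types n : nat.

Lemma dotE n (u v : 'cV[R]_n) : dot u v = (u^T *m v) 0 0.
Proof. by rewrite mxE; apply: eq_bigr => i _; rewrite mxE. Qed.

Lemma dotC n (u v : 'cV[R]_n) : dot u v = dot v u.
Proof. by apply: eq_bigr => i _; rewrite mulrC. Qed.

Lemma dotDl n (u v w : 'cV[R]_n) : dot (u + v) w = dot u w + dot v w.
Proof. by rewrite -big_split; apply: eq_bigr => i _; rewrite mxE mulrDl. Qed.

Lemma dotDr n (u v w : 'cV[R]_n) : dot w (u + v) = dot w u + dot w v.
Proof. by rewrite !(dotC w) dotDl. Qed.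

Lemma dotZl n k (u v : 'cV[R]_n) : dot (k *: u) v = k * dot u v.
Proof. by rewrite mulr_sumr; apply: eq_bigr => i _; rewrite mxE mulrA. Qed.

Lemma dotZr n k (u v : 'cV[R]_n) : dot u (k *: v) = k * dot u v.
Proof. by rewrite dotC dotZl dotC. Qed.

Lemma dot0l n (v : 'cV[R]_n) : dot 0 v = 0.
Proof. by rewrite -(scale0r 0) dotZl mul0r. Qed.

Lemma dot0r n (v : 'cV[R]_n) : dot v 0 = 0.
Proof. by rewrite dotC dot0l. Qed.

Lemma dotNl n (u v : 'cV[R]_n) : dot (- u) v = - dot u v.
Proof. by rewrite -scaleN1r dotZl mulN1r. Qed.

Lemma dotNr n (u v : 'cV[R]_n) : dot u (- v) = - dot u v.
Proof. by rewrite dotC dotNl dotC. Qed.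

Lemma dotBl n (u v w : 'cV[R]_n) : dot (u - v) w = dot u w - dot v w.
Proof. by rewrite dotDl dotNl. Qed.

Lemma dotBr n (u v w : 'cV[R]_n) : dot w (u - v) = dot w u - dot w v.
Proof. by rewrite dotDr dotNr. Qed.

Lemma dot_suml n (I : Type) (r : seq I) (P : pred I) (F : I -> 'cV[R]_n) v :
  dot (\sum_(i <- r | P i) F i) v = \sum_(i <- r | P i) dot (F i) v.
Proof.
by elim/big_rec2: _ => [|i x y _ <-]; rewrite ?dot0l// dotDl.
Qed.

Lemma dot_sumr n (I : Type) (r : seq I) (P : pred I) (F : I -> 'cV[R]_n) v :
  dot v (\sum_(i <- r | P i) F i) = \sum_(i <- r | P i) dot v (F i).
Proof. by rewrite dotC dot_suml; apply: eq_bigr => i _; rewrite dotC. Qed.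

Lemma dot_mull m n (A : 'M[R]_(m, n)) u v : dot (A *m u) v = dot u (A^T *m v).
Proof. by rewrite !dotE trmx_mul mulmxA. Qed.

Lemma dot_mulr m n (A : 'M[R]_(m, n)) u v : dot v (A *m u) = dot (A^T *m v) u.
Proof. by rewrite dotC dot_mull dotC. Qed.

Lemma dotxx_ge0 n (u : 'cV[R]_n) : 0 <= dot u u.
Proof. by apply: sumr_ge0 => i _; rewrite -expr2 sqr_ge0. Qed.

Lemma dotxx_eq0 n (u : 'cV[R]_n) : (dot u u == 0) = (u == 0).
Proof.
apply/idP/eqP => [|->]; last by rewrite dot0l.
rewrite psumr_eq0 => [|i _]; last by rewrite -expr2 sqr_ge0.
move=> /allP u0; apply/colP => i; rewrite mxE.
by have := u0 i (mem_index_enum _); rewrite -expr2 sqrf_eq0 => /eqP.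
Qed.

Lemma dot_cauchy n (u v : 'cV[R]_n) : dot u v ^+ 2 <= dot u u * dot v v.
Proof.
have [->|v0] := eqVneq v 0; first by rewrite !dot0r expr0n mulr0.
have vv : 0 < dot v v by rewrite lt_def dotxx_eq0 v0 dotxx_ge0.
have := dotxx_ge0 (dot v v *: u - dot u v *: v).
rewrite dotBl !dotBr !dotZl !dotZr (dotC v u) => h.
rewrite -subr_ge0 -(pmulr_rge0 _ vv).
by apply: le_trans h _; rewrite le_eqVlt; apply/orP; left; apply/eqP; ring.
Qed.

Lemma enorm_sqr n (u : 'cV[R]_n) : enorm u ^+ 2 = dot u u.
Proof.
rewrite sqr_sqrtr; last by apply: sumr_ge0 => i _; rewrite sqr_ge0.
by apply: eq_bigr => i _; rewrite expr2.
Qed.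

Lemma dot_col_mx m n (x y : 'cV[R]_m) (u v : 'cV[R]_n) :
  dot (col_mx x u) (col_mx y v) = dot x y + dot u v.
Proof.
by rewrite !dotE tr_col_mx mul_row_col mxE.
Qed.

Lemma dot_scalar (x y : R) : dot x%:M y%:M = x * y.
Proof. by rewrite dotE tr_scalar_mx -scalar_mxM mxE eqxx mulr1n. Qed.

Lemma dot_delta n i (u : 'cV[R]_n) : dot (delta_mx i 0) u = u i 0.
Proof.
rewrite /dot (bigD1 i)//= mxE !eqxx mul1r big1 ?addr0// => j ji.
by rewrite mxE (negbTE ji) mul0r.
Qed.

End dot_theory.

(** * Measurability of vector operations *)

Section measurable_vectors.
Context {R : realType} d (T : measurableType d).

Lemma measurable_coord n (f : T -> 'cV[R]_n) i :
  measurable_fun setT f -> measurable_fun setT (fun x => f x i 0).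
Proof. by move=> /measurable_fun_cVP. Qed.

Lemma measurable_dot n (f g : T -> 'cV[R]_n) :
  measurable_fun setT f -> measurable_fun setT g ->
  measurable_fun setT (fun x => dot (f x) (g x)).
Proof.
move=> mf mg; apply: measurable_sum => i.
by apply: measurable_funM; exact: measurable_coord.
Qed.

Lemma measurable_mulmx m n (A : T -> 'M[R]_(m, n)) (f : T -> 'cV[R]_n) :
  (forall i j, measurable_fun setT (fun x => A x i j)) ->
  measurable_fun setT f -> measurable_fun setT (fun x => A x *m f x).
Proof.
move=> mA mf; apply/measurable_fun_cVP => i.
under eq_fun do rewrite mxE.
by apply: measurable_sum => j; apply: measurable_funM => //; exact: measurable_coord.
Qed.

Lemma measurable_addv n (f g : T -> 'cV[R]_n) :
  measurable_fun setT f -> measurable_fun setT g ->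
  measurable_fun setT (fun x => f x + g x).
Proof.
move=> mf mg; apply/measurable_fun_cVP => i.
under eq_fun do rewrite mxE.
by apply: measurable_funD; exact: measurable_coord.
Qed.

Lemma measurable_scalev n (k : T -> R) (f : T -> 'cV[R]_n) :
  measurable_fun setT k -> measurable_fun setT f ->
  measurable_fun setT (fun x => k x *: f x).
Proof.
move=> mk mf; apply/measurable_fun_cVP => i.
under eq_fun do rewrite mxE.
by apply: measurable_funM => //; exact: measurable_coord.
Qed.

Lemma measurable_oppv n (f : T -> 'cV[R]_n) :
  measurable_fun setT f -> measurable_fun setT (fun x => - f x).
Proof.
move=> mf; apply/measurable_fun_cVP => i.
under eq_fun do rewrite mxE.
by apply: measurableT_comp => //; exact: measurable_coord.
Qed.

Lemma measurable_subv n (f g : T -> 'cV[R]_n) :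
  measurable_fun setT f -> measurable_fun setT g ->
  measurable_fun setT (fun x => f x - g x).
Proof.
by move=> mf mg; apply: measurable_addv => //; exact: measurable_oppv.
Qed.

End measurable_vectors.

(** * Standard Gaussian vectors and their invariances *)

Section gaussian_space.
Context {R : realType}.
Local Notation T := (measurableTypeR R).
Local Notation g1 := (@normal_prob R 0 1).

Definition vcons n (p : T * 'cV[R]_n) : 'cV[R]_(1 + n) := col_mx (p.1)%:M p.2.

Lemma measurable_vcons n : measurable_fun setT (@vcons n).
Proof.
apply/measurable_fun_cVP => i; rewrite /vcons.
have [j|j] := split_ordP i => ->.
- under eq_fun do rewrite col_mxEu mxE ord1 eqxx mulr1n.
  exact: measurable_fst.
- under eq_fun do rewrite col_mxEd.
  by apply: measurable_coord; exact: measurable_snd.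
Qed.

HB.instance Definition _ n :=
  isMeasurableFun.Build _ _ _ _ (@vcons n) (@measurable_vcons n).

(** The recursion lets Tonelli's theorem split off the first coordinate, which is how dimensions are
    reduced below. *)
Fixpoint gauss n : probability 'cV[R]_n R :=
  match n with
  | 0 => [the probability _ R of dirac (0 : 'cV[R]_0)]
  | m.+1 => [the probability 'cV[R]_m.+1 R of
      distribution [the probability _ R of (g1 \x gauss m)%E] (@vcons m)]
  end.

Lemma ge0_integral_gaussS n (f : 'cV[R]_(1 + n) -> \bar R) :
  measurable_fun setT f -> (forall x, 0 <= f x)%E ->
  (\int[gauss (1 + n)]_g f g =
   \int[g1]_x \int[gauss n]_z f (col_mx (x : R)%:M z))%E.
Proof.
move=> mf f0; rewrite /= ge0_integral_distribution//.
rewrite fubini_tonelli1//=.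
by apply: measurableT_comp => //; exact: measurable_vcons.
Qed.

(** Invariance in the form in which it is applied, a change of variables under the integral; it is
    established for a few generators and their products. *)
Definition gauss_invariant n (Q : 'M[R]_n) := forall f : 'cV[R]_n -> \bar R,
  measurable_fun setT f -> (forall x, 0 <= f x)%E ->
  (\int[gauss n]_g f (Q *m g) = \int[gauss n]_g f g)%E.

Lemma measurable_mulmx_cst m n (A : 'M[R]_(m, n)) :
  measurable_fun setT (fun x : 'cV[R]_n => A *m x).
Proof. by apply: measurable_mulmx => // i j; exact: measurable_cst. Qed.

Lemma measurable_col_mxr m n (u : 'cV[R]_m) :
  measurable_fun setT (fun z : 'cV[R]_n => col_mx u z).
Proof.
apply/measurable_fun_cVP => i; have [j|j] := split_ordP i => ->.
- by under eq_fun do rewrite col_mxEu; exact: measurable_cst.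
- by under eq_fun do rewrite col_mxEd; exact: measurable_coord.
Qed.

Lemma gauss_invariantM n (P Q : 'M[R]_n) :
  gauss_invariant P -> gauss_invariant Q -> gauss_invariant (P *m Q).
Proof.
move=> iP iQ f mf f0.
under eq_integral do rewrite -mulmxA.
rewrite (iQ (fun g => f (P *m g)))//; first exact: iP.
by apply: measurableT_comp => //; exact: measurable_mulmx_cst.
Qed.

Lemma gauss_invariant_block n (Q : 'M[R]_n) : gauss_invariant Q ->
  gauss_invariant (block_mx 1%:M 0 0 Q : 'M[R]_(1 + n)).
Proof.
move=> iQ f mf f0.
transitivity (\int[g1]_x \int[gauss n]_z
    f (block_mx 1%:M 0 0 Q *m col_mx (x : R)%:M z))%E.
  apply: (ge0_integral_gaussS (f := fun g => f (block_mx 1%:M 0 0 Q *m g))).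
    by apply: measurableT_comp => //; exact: measurable_mulmx_cst.
  by move=> ?; exact: f0.
transitivity (\int[g1]_x \int[gauss n]_z f (col_mx (x : R)%:M z))%E; last first.
  exact/esym/ge0_integral_gaussS.
apply: eq_integral => x _.
under eq_integral do rewrite mul_block_col mul1mx !mul0mx addr0 add0r.
apply: (iQ (fun z => f (col_mx (x : R)%:M z))) => //.
by apply: measurableT_comp => //; exact: measurable_col_mxr.
Qed.

Definition rot_mx n (c s : R) : 'M[R]_(1 + (1 + n)) :=
  block_mx c%:M (row_mx (- s)%:M 0) (col_mx s%:M 0) (block_mx c%:M 0 0 1%:M).

Lemma rot_mx_col n (c s x y : R) (z : 'cV[R]_n) :
  rot_mx n c s *m col_mx x%:M (col_mx y%:M z) =
  col_mx (c * x - s * y)%:M (col_mx (s * x + c * y)%:M z).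
Proof.
rewrite mul_block_col mul_row_col mul_col_mx mul_block_col !mul0mx add_col_mx.
rewrite -!scalar_mxM !addr0 !add0r mul1mx -!raddfD/=.
by rewrite mulNr.
Qed.

Lemma measurable_col_mx2 n (z : 'cV[R]_n) :
  measurable_fun setT (fun p : T * T => col_mx (p.1 : R)%:M (col_mx (p.2 : R)%:M z)).
Proof.
apply/measurable_fun_cVP => i; have [j|j] := split_ordP i => ->.
  under eq_fun do rewrite col_mxEu mxE ord1 eqxx mulr1n.
  exact: measurable_fst.
have [k|k] := split_ordP j => ->.
  under eq_fun do rewrite col_mxEd col_mxEu mxE ord1 eqxx mulr1n.
  exact: measurable_snd.
by under eq_fun do rewrite !col_mxEd; exact: measurable_cst.
Qed.

Lemma gauss_invariant_rot n (c s : R) : c ^+ 2 + s ^+ 2 = 1 ->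
  gauss_invariant (rot_mx n c s).
Proof.
move=> cs f mf f0.
have mfQ : measurable_fun setT (fun g => f (rot_mx n c s *m g)).
  by apply: measurableT_comp => //; exact: measurable_mulmx_cst.
(* [E] makes the two rotated coordinates the innermost integrals, so that the planar case applies
   for each fixed [z]. *)
have E (h : 'cV[R]_(1 + (1 + n)) -> \bar R) : measurable_fun setT h ->
    (forall x, 0 <= h x)%E ->
    (\int[gauss (1 + (1 + n))]_g h g = \int[gauss n]_z \int[g1]_x \int[g1]_y
      h (col_mx (x : R)%:M (col_mx (y : R)%:M z)))%E.
  move=> mh h0; rewrite ge0_integral_gaussS//.
  pose H := fun p : T * (T * 'cV[R]_n) => h (col_mx (p.1 : R)%:M (col_mx (p.2.1 : R)%:M p.2.2)).
  have mH : measurable_fun setT H.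
    apply: measurableT_comp => //.
    apply: (measurableT_comp (measurable_vcons (n := 1 + n))
      (g := fun p : T * (T * 'cV[R]_n) => (p.1, vcons p.2))).
    apply/measurable_fun_pairP; split; first exact: measurable_fst.
    exact: (measurableT_comp (@measurable_vcons n) measurable_snd).
  transitivity (\int[g1]_x \int[gauss n]_z \int[g1]_y H (x, (y, z)))%E.
    apply: eq_integral => x _; rewrite ge0_integral_gaussS//; last first.
      by apply: measurableT_comp => //; exact: measurable_col_mxr.
    apply: (fubini_tonelli (m1 := g1) (m2 := gauss n)
      (fun q : T * 'cV[R]_n => H (x, q))) => //.
      exact: (measurable_fun_pair2 x mH).
    by move=> ?; exact: h0.
  pose K := fun q : T * 'cV[R]_n => (\int[g1]_y H (q.1, (y, q.2)))%E.
  have mK : measurable_fun setT K.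
    pose H' := fun p : (T * 'cV[R]_n) * T => H (p.1.1, (p.2, p.1.2)).
    rewrite -[K]/(fubini_F g1 H').
    apply: measurable_fun_fubini_tonelli_F => //; last by move=> ?; exact: h0.
    apply: (measurableT_comp mH).
    apply/measurable_fun_pairP; split => /=.
      exact: (measurableT_comp measurable_fst measurable_fst).
    apply/measurable_fun_pairP; split => /=; first exact: measurable_snd.
    exact: (measurableT_comp measurable_snd measurable_fst).
  have K0 q : (0 <= K q)%E by apply: integral_ge0 => y _; exact: h0.
  exact: (fubini_tonelli (m1 := g1) (m2 := gauss n) K mK K0).
transitivity (\int[gauss n]_z \int[g1]_x \int[g1]_y
    f (rot_mx n c s *m (col_mx (x : R)%:M (col_mx (y : R)%:M z))))%E.
  by apply: (E (fun g => f (rot_mx n c s *m g))) => // ?; exact: f0.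
transitivity (\int[gauss n]_z \int[g1]_x \int[g1]_y
    f (col_mx (x : R)%:M (col_mx (y : R)%:M z)))%E; last exact/esym/E.
apply: eq_integral => z _.
under eq_integral do under eq_integral do rewrite rot_mx_col.
apply: (ge0_integral_normal_rotation
  (F := fun p : T * T => f (col_mx (p.1 : R)%:M (col_mx (p.2 : R)%:M z))) cs) => //.
by apply: measurableT_comp => //; exact: measurable_col_mx2.
Qed.

(** In dimension 1 the unit vectors are 1 and -1, exchanged only by a reflection; this starts the
    induction of [gauss_direction]. *)
Lemma gauss_invariantN1 : gauss_invariant (- 1%:M : 'M[R]_1).
Proof.
move=> f mf f0; pose F (x : T) := (\int[gauss 0]_z f (col_mx (x : R)%:M z))%E.
have F0 x : (0 <= F x)%E by exact: integral_ge0.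
have mF : measurable_fun setT F.
  apply: (@measurable_fun_fubini_tonelli_F _ _ _ _ _ (gauss 0) (f \o @vcons 0)).
    by apply: measurableT_comp => //; exact: measurable_vcons.
  by move=> ?; exact: f0.
transitivity (\int[g1]_x F (- (x : R))%R)%E.
  transitivity (\int[g1]_x \int[gauss 0]_z
      f (- 1%:M *m (col_mx (x : R)%:M z : 'cV[R]_(1 + 0))))%E.
    apply: (ge0_integral_gaussS (f := fun g : 'cV[R]_(1 + 0) => f (- 1%:M *m g))).
      by apply: measurableT_comp => //; exact: measurable_mulmx_cst.
    by move=> ?; exact: f0.
  apply: eq_integral => x _; apply: eq_integral => z _; congr f.
  by rewrite mulNmx mul1mx opp_col_mx -raddfN [- z]flatmx0 [z]flatmx0.
transitivity (\int[g1]_x F x)%E; last exact/esym/ge0_integral_gaussS.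
have mFN : measurable_fun setT (fun x : T => F (- (x : R))%R).
  by apply: measurableT_comp => //; exact: oppr_measurable.
transitivity (\int[lebesgue_measure]_x (F (- (x : R))%R * (normal_pdf 0 1 (x : R))%:E))%E.
  by apply: ge0_integral_normal_prob => // ?; exact: F0.
transitivity (\int[lebesgue_measure]_x (F x * (normal_pdf 0 1 (x : R))%:E))%E; last first.
  exact/esym/ge0_integral_normal_prob.
pose H (x : T) := (F x * (normal_pdf 0 1 (x : R))%:E)%E.
transitivity (\int[lebesgue_measure]_x H (- (x : R))%R)%E.
  apply: eq_integral => x _; rewrite /H; congr (_ * _%:E)%E.
  by rewrite !normal_pdfE ?oner_neq0// /normal_fun !subr0 sqrrN.
apply: ge0_integral_lebesgueN => [|x].
  apply: emeasurable_funM => //; apply/measurable_EFinP.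
  exact: measurable_normal_pdf.
by rewrite mule_ge0// lee_fin normal_pdf_ge0.
Qed.

End gaussian_space.

(** * Second moments along adaptively chosen directions *)

Section gaussian_direction.
Context {R : realType}.
Local Notation T := (measurableTypeR R).
Local Notation g1 := (@normal_prob R 0 1).

Definition e0 n : 'cV[R]_(1 + n) := col_mx 1%:M 0.

Lemma orth_block n (Q : 'M[R]_n) : Q^T *m Q = 1%:M ->
  (block_mx 1%:M 0 0 Q : 'M[R]_(1 + n))^T *m block_mx 1%:M 0 0 Q = 1%:M.
Proof.
move=> QQ; rewrite tr_block_mx mulmx_block !trmx0 trmx1 !mul0mx !mulmx0 mul1mx.
by rewrite QQ !addr0 !add0r -scalar_mx_block.
Qed.

Lemma col_mx_hd n (v : 'cV[R]_(1 + n)) :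
  v = col_mx (usubmx v 0 0)%:M (dsubmx v).
Proof.
rewrite -[LHS]vsubmxK; congr col_mx.
by apply/colP => i; rewrite [in RHS]mxE ord1 eqxx.
Qed.

Lemma tr_rot_mx n (c s : R) : (rot_mx n c s)^T = rot_mx n c (- s).
Proof.
rewrite /rot_mx tr_block_mx tr_row_mx tr_col_mx tr_block_mx.
by rewrite !trmx0 !tr_scalar_mx opprK.
Qed.

Lemma orth_rot n (c s : R) : c ^+ 2 + s ^+ 2 = 1 ->
  (rot_mx n c s)^T *m rot_mx n c s = 1%:M.
Proof.
move=> cs; apply/matrixP => i j.
rewrite tr_rot_mx; set Q := _ *m _.
suff QE (v : 'cV[R]_(1 + (1 + n))) : Q *m v = v.
  have /colP/(_ i) := QE (delta_mx j 0).
  by rewrite -colE !mxE eqxx andbT.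
rewrite (col_mx_hd v) (col_mx_hd (dsubmx v)) /Q -mulmxA !rot_mx_col.
congr col_mx; [congr _%:M|congr col_mx; congr _%:M].
  by rewrite -[RHS]mul1r -cs; ring.
by rewrite -[RHS]mul1r -cs; ring.
Qed.

(** Write [a] as (al, be u) with u a unit vector. A plane rotation takes [e0] to (al, be, 0), and
    the matrix given by induction for u, acting on the remaining coordinates, takes (be, 0) to be u.
    One invariant matrix per direction replaces invariance under the whole orthogonal group. *)
Lemma gauss_direction n (a : 'cV[R]_(1 + n)) : dot a a = 1 ->
  exists Q : 'M[R]_(1 + n),
    [/\ Q^T *m Q = 1%:M, Q *m e0 n = a & gauss_invariant Q].
Proof.
elim: n a => [|n IH] a a1.
  have aE : a = (a 0 0)%:M by apply/colP => i; rewrite ord1 mxE eqxx.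
  move: a1; rewrite aE dot_scalar => /eqP; rewrite -expr2 sqrf_eq1 => /orP[]/eqP->.
    exists 1%:M; split.
    - by rewrite trmx1 mul1mx.
    - rewrite mul1mx; apply/colP => i.
      rewrite (_ : i = lshift 0 0) ?col_mxEu ?mxE ?eqxx//.
      by apply/val_inj; rewrite ord1.
    - by move=> f mf f0; under eq_integral do rewrite mul1mx.
  exists (- 1%:M); split.
  - have -> : (- 1%:M : 'M[R]_(1 + 0))^T = - 1%:M.
      by apply/matrixP => i j; rewrite !mxE eq_sym.
    by rewrite mulNmx mulmxN opprK mul1mx.
  - rewrite mulNmx mul1mx; apply/colP => i.
    rewrite (_ : i = lshift 0 0); last by apply/val_inj; rewrite ord1.
    by rewrite mxE col_mxEu !mxE.
  - exact: gauss_invariantN1.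
pose al := usubmx a 0 0; pose a' := dsubmx a : 'cV[R]_(1 + n).
have aE : a = col_mx al%:M a'.
  rewrite -[LHS]vsubmxK; congr col_mx.
  by apply/colP => i; rewrite [in RHS]mxE ord1 eqxx.
pose be := enorm a'.
have be2 : be ^+ 2 = dot a' a' by rewrite enorm_sqr.
have ab : al ^+ 2 + be ^+ 2 = 1.
  by rewrite be2 expr2 -dot_scalar -dot_col_mx -aE.
have [u [u1 ua]] : exists u : 'cV[R]_(1 + n), dot u u = 1 /\ be *: u = a'.
  have [b0|b0] := eqVneq be 0.
    exists (e0 n); split.
      by rewrite dot_col_mx dot_scalar dot0l mulr1 addr0.
    rewrite b0 scale0r; apply/esym/eqP.
    by rewrite -dotxx_eq0 -be2 b0 expr0n.
  exists (be^-1 *: a'); split.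
    by rewrite dotZl dotZr -be2 expr2 mulKf// mulVf.
  by rewrite scalerA divff// scale1r.
have [Q [QQ Qe iQ]] := IH u u1.
exists (block_mx 1%:M 0 0 Q *m rot_mx n al be); split.
- by rewrite trmx_mul mulmxA -(mulmxA _ _^T) orth_block// mulmx1 orth_rot.
- have -> : e0 n.+1 = col_mx 1%:M (col_mx 0%:M 0 : 'cV[R]_(1 + n)).
    by rewrite raddf0 col_mx0.
  rewrite -mulmxA rot_mx_col !mulr0 !mulr1 subr0 addr0.
  rewrite mul_block_col mul1mx !mul0mx addr0 add0r aE; congr col_mx.
  rewrite -ua -Qe scalemxAr; congr mulmx.
  by rewrite /e0 scale_col_mx scaler0 scale_scalar_mx mulr1.
- apply: gauss_invariantM; last exact: gauss_invariant_rot.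
  exact: gauss_invariant_block.
Qed.

(** The second moment is kept as an unknown constant: it is shown to be finite and positive, and
    [layer_weight] divides by it. *)
Definition m2 : \bar R := (\int[g1]_x ((x : R) ^+ 2)%:E)%E.

Lemma m2_ge0 : (0 <= m2)%E.
Proof. by apply: integral_ge0 => x _; rewrite lee_fin sqr_ge0. Qed.

Let measurable_sqr_dot n (b : 'cV[R]_n -> 'cV[R]_n) : measurable_fun setT b ->
  measurable_fun setT (fun g => (dot (b g) g ^+ 2)%:E).
Proof.
move=> mb; apply/measurable_EFinP; apply: measurable_funX.
by apply: measurable_dot => //; exact: measurable_id.
Qed.

Let measurable_dotxx n (b : 'cV[R]_n -> 'cV[R]_n) : measurable_fun setT b ->
  measurable_fun setT (fun g => (dot (b g) (b g))%:E).
Proof. by move=> mb; apply/measurable_EFinP; exact: measurable_dot. Qed.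

(** Rotating [b] onto the first coordinate leaves a one-dimensional second moment. *)
Lemma gauss_variance n (b : 'cV[R]_n) :
  (\int[gauss n]_g (dot b g ^+ 2)%:E = m2 * (dot b b)%:E)%E.
Proof.
have [->|b0] := eqVneq b 0.
  under eq_integral do rewrite dot0l expr0n.
  by rewrite dot0l mule0 integral0.
case: n b b0 => [b|n b b0]; first by rewrite [b]flatmx0 eqxx.
pose be := enorm b; have be2 : be ^+ 2 = dot b b by rewrite enorm_sqr.
have be0 : be != 0 by rewrite -sqrf_eq0 be2 dotxx_eq0.
have [Q [QQ Qe iQ]] : exists Q : 'M[R]_(1 + n),
    [/\ Q^T *m Q = 1%:M, Q *m e0 n = be^-1 *: b & gauss_invariant Q].
  apply: gauss_direction.
  by rewrite dotZl dotZr -be2 expr2 mulKf// mulVf.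
have mf (Q' : 'M[R]_(1 + n)) :
    measurable_fun setT (fun g : 'cV[R]_(1 + n) => (dot b (Q' *m g) ^+ 2)%:E).
  apply/measurable_EFinP; apply: measurable_funX; apply: measurable_dot.
    exact: measurable_cst.
  exact: measurable_mulmx_cst.
transitivity (\int[gauss (1 + n)]_g (dot b (Q *m g) ^+ 2)%:E)%E.
  apply/esym; apply: (iQ (fun g => (dot b g ^+ 2)%:E)) => [|g].
    by under eq_fun do rewrite -[X in dot b X]mul1mx; exact: mf.
  by rewrite lee_fin sqr_ge0.
transitivity (\int[g1]_x \int[gauss n]_z
    (dot b (Q *m col_mx (x : R)%:M z) ^+ 2)%:E)%E.
  apply: (ge0_integral_gaussS (f := fun g => (dot b (Q *m g) ^+ 2)%:E)) => // g.
  by rewrite lee_fin sqr_ge0.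
transitivity (\int[g1]_x ((be ^+ 2)%:E * ((x : R) ^+ 2)%:E))%E; last first.
  rewrite ge0_integralZl//; last 3 first.
  - by apply/measurable_EFinP; apply: measurable_funX.
  - by move=> x _; rewrite lee_fin sqr_ge0.
  - by rewrite lee_fin sqr_ge0.
  by rewrite be2 muleC.
apply: eq_integral => x _.
have E (z : 'cV[R]_n) : dot b (Q *m col_mx (x : R)%:M z) = be * (x : R).
  have -> : b = be *: (Q *m e0 n) by rewrite Qe scalerA divff// scale1r.
  rewrite dotZl dot_mull mulmxA QQ mul1mx.
  by rewrite dot_col_mx dot_scalar dot0l addr0 mul1r.
under eq_integral do rewrite E.
by rewrite integral_cst//= probability_setT mule1 exprMn EFinM.
Qed.

(* Adaptive linear measurements of a standard Gaussian vector reveal nothing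
   about the directions orthogonal to them: after rotating the first measured
   direction to the first coordinate and freezing that coordinate, the remaining
   measurements are adaptive measurements of a Gaussian vector in one dimension
   less. *)
Lemma gauss_predictable_variance D n (a : nat -> 'cV[R]_n -> 'cV[R]_n)
    (b : 'cV[R]_n -> 'cV[R]_n) :
  measurable_fun setT b ->
  (forall j g g', (j < D)%N ->
    (forall r, (r < j)%N -> dot (a r g) g = dot (a r g') g') -> a j g = a j g') ->
  (forall g g',
    (forall r, (r < D)%N -> dot (a r g) g = dot (a r g') g') -> b g = b g') ->
  (forall j g, (j < D)%N -> dot (a j g) (b g) = 0) ->
  (\int[gauss n]_g (dot (b g) g ^+ 2)%:E =
   m2 * \int[gauss n]_g (dot (b g) (b g))%:E)%E.
Proof.
elim: D n a b => [|D IH] n a b mb pa pb ab.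
  have bE g : b g = b 0 by exact: pb.
  under eq_integral do rewrite bE.
  rewrite gauss_variance; congr (_ * _)%E.
  under eq_integral do rewrite bE.
  by rewrite integral_cst//= probability_setT mule1.
have a0E g : a 0%N g = a 0%N 0 by exact: pa.
(* The first measurement is a fixed vector, as no answer precedes it. If it is zero, its answer
   carries no information and it is dropped. *)
have [a00|a00] := eqVneq (a 0%N 0) 0.
  apply: (IH _ (fun j => a j.+1)) => //.
  - move=> j g g' jD E; apply: pa => // -[|r]; rewrite ?ltnS; last exact: E.
    by move=> _; rewrite !a0E a00 !dot0l.
  - move=> g g' E; apply: pb => -[|r]; rewrite ?ltnS; last exact: E.
    by move=> _; rewrite !a0E a00 !dot0l.
  - by move=> j g jD; exact: ab.
case: n a b mb pa pb ab a0E a00 => [|n] a b mb pa pb ab a0E a00.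
  by rewrite [a 0%N 0]flatmx0 eqxx in a00.
pose al := enorm (a 0%N 0).
have al2 : al ^+ 2 = dot (a 0%N 0) (a 0%N 0) by rewrite enorm_sqr.
have al0 : al != 0 by rewrite -sqrf_eq0 al2 dotxx_eq0.
have [Q [QQ Qe iQ]] : exists Q : 'M[R]_(1 + n),
    [/\ Q^T *m Q = 1%:M, Q *m e0 n = al^-1 *: a 0%N 0 & gauss_invariant Q].
  apply: gauss_direction.
  by rewrite dotZl dotZr -al2 expr2 mulKf// mulVf.
have QQ' : Q *m Q^T = 1%:M by exact: mulmx1C.
have aQ : a 0%N 0 = al *: (Q *m e0 n) by rewrite Qe scalerA divff// scale1r.
pose G (x : R) (z : 'cV[R]_n) : 'cV[R]_(1 + n) := Q *m col_mx x%:M z.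
pose hd (v : 'cV[R]_(1 + n)) : R := usubmx (Q^T *m v) 0 0.
pose tl (v : 'cV[R]_(1 + n)) : 'cV[R]_n := dsubmx (Q^T *m v).
have htE v : Q^T *m v = col_mx (hd v)%:M (tl v).
  rewrite -[LHS]vsubmxK; congr col_mx.
  by apply/colP => i; rewrite [in RHS]mxE ord1 eqxx.
have dotG v x z : dot v (G x z) = hd v * x + dot (tl v) z.
  by rewrite dot_mulr htE dot_col_mx dot_scalar.
have dotQ u v : dot u v = hd u * hd v + dot (tl u) (tl v).
  rewrite -[u]mul1mx -QQ' -mulmxA dot_mull !htE dot_col_mx dot_scalar.
  by rewrite -htE mulmxA QQ' mul1mx.
have a0G g x z : dot (a 0%N g) (G x z) = al * x.
  rewrite a0E aQ dotZl dot_mull /G mulmxA QQ mul1mx.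
  by rewrite dot_col_mx dot_scalar dot0l addr0 mul1r.
have hdb g : hd (b g) = 0.
  have := ab 0%N g isT; rewrite a0E aQ dotZl dot_mull htE dot_col_mx dot_scalar.
  by rewrite dot0l addr0 mul1r => /eqP; rewrite mulf_eq0 (negbTE al0) => /eqP.
have mtl : measurable_fun setT (fun g => tl (b g)).
  apply/measurable_fun_cVP => i; under eq_fun do rewrite mxE.
  apply: measurable_coord.
  exact: (measurableT_comp (measurable_mulmx_cst Q^T) mb).
have mG x : measurable_fun setT (G x).
  exact: (measurableT_comp (measurable_mulmx_cst Q) (measurable_col_mxr _)).
have key x : (\int[gauss n]_z (dot (b (G x z)) (G x z) ^+ 2)%:E =
    m2 * \int[gauss n]_z (dot (b (G x z)) (b (G x z)))%:E)%E.
  have ans z z' : forall k, (k <= D)%N ->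
      (forall r, (r < k)%N -> dot (tl (a r.+1 (G x z))) z =
                           dot (tl (a r.+1 (G x z'))) z') ->
      forall r, (r < k.+1)%N ->
        dot (a r (G x z)) (G x z) = dot (a r (G x z')) (G x z').
    elim=> [|k IHk] kD E [|r] rk; rewrite ?a0G//.
    have {}IHk := IHk (ltnW kD) (fun r h => E r (ltnW h)).
    move: rk; rewrite ltnS leq_eqVlt => /predU1P[[->]|]; last exact: IHk.
    by rewrite !dotG E// (pa k.+1 _ (G x z')).
  transitivity (\int[gauss n]_z (dot (tl (b (G x z))) z ^+ 2)%:E)%E.
    by apply: eq_integral => z _; rewrite dotG hdb mul0r add0r.
  transitivity (m2 * \int[gauss n]_z (dot (tl (b (G x z))) (tl (b (G x z))))%:E)%E;
      last first.
    by congr (_ * _)%E; apply: eq_integral => z _; rewrite [in RHS]dotQ hdb mul0r add0r.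
  apply: (IH _ (fun j z => tl (a j.+1 (G x z))) (fun z => tl (b (G x z)))).
  - exact: (measurableT_comp mtl (mG x)).
  - by move=> j z z' jD E; congr tl; apply: pa => //; apply: ans => //; exact: ltnW.
  - by move=> z z' E; congr tl; apply: pb => r rD; exact: (ans z z' D).
  - move=> j z jD; have := ab j.+1 (G x z) jD.
    by rewrite dotQ hdb mulr0 add0r.
pose F1 g := (dot (b g) g ^+ 2)%:E; pose F2 g := (dot (b g) (b g))%:E.
have mF1 : measurable_fun setT F1 by exact: measurable_sqr_dot.
have mF2 : measurable_fun setT F2 by exact: measurable_dotxx.
have F10 g : (0 <= F1 g)%E by rewrite lee_fin sqr_ge0.
have F20 g : (0 <= F2 g)%E by rewrite lee_fin dotxx_ge0.
have slice F : measurable_fun setT F -> (forall g, (0 <= F g)%E) ->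
    (\int[gauss (1 + n)]_g F g = \int[g1]_x \int[gauss n]_z F (G x z))%E.
  move=> mF F0; rewrite -(iQ F mF F0).
  apply: (ge0_integral_gaussS (f := fun g => F (Q *m g))) => //.
  by apply: measurableT_comp => //; exact: measurable_mulmx_cst.
rewrite -[LHS]/(\int[gauss (1 + n)]_g F1 g)%E.
rewrite -[X in (_ = _ * X)%E]/(\int[gauss (1 + n)]_g F2 g)%E.
rewrite (slice F1)// (slice F2)//.
transitivity (\int[g1]_x (m2 * \int[gauss n]_z F2 (G x z)))%E.
  by apply: eq_integral => x _; exact: key.
apply: ge0_integralZl => //; last exact: m2_ge0.
- pose F3 : T * 'cV[R]_n -> \bar R := fun p => F2 (Q *m vcons p).
  apply: (@measurable_fun_fubini_tonelli_F _ _ _ _ _ (gauss n) F3) => //; last first.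
    by move=> ?; exact: F20.
  apply: (measurableT_comp mF2).
  exact: (measurableT_comp (measurable_mulmx_cst Q) (@measurable_vcons _ n)).
- by move=> x _; exact: integral_ge0.
Qed.

End gaussian_direction.

(** * Gaussian moments up to order four *)

Section gaussian_moments.
Context {R : realType}.
Local Notation T := (measurableTypeR R).
Local Notation g1 := (@normal_prob R 0 1).
Local Notation m2 := (@m2 R).

Lemma m2_lty : (m2 < +oo)%E.
Proof.
have s2 : Num.sqrt (2 : R) ^+ 2 = 2 by rewrite sqr_sqrtr.
have s0 : Num.sqrt (2 : R) != 0 by rewrite sqrtr_eq0 -ltNge.
(* Half of the exponent absorbs the square, as x^2 exp(- x^2 / 4) <= 4; the other half is the
   exponent of the normal density of variance 2. The ratio of peaks adjusts the normalization. *)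
pose C : R := 4 * normal_peak 1 / normal_peak (Num.sqrt 2).
have C0 : 0 <= C by rewrite !mulr_ge0 ?invr_ge0 ?normal_peak_ge0.
have mh : measurable_fun setT (fun x : T => ((x : R) ^+ 2)%:E).
  by apply/measurable_EFinP; apply: measurable_funX.
have mp s : measurable_fun setT (fun x : T => (normal_pdf 0 s (x : R))%:E).
  by apply/measurable_EFinP; exact: measurable_normal_pdf.
have -> : m2 = (\int[lebesgue_measure]_x (((x : R) ^+ 2)%:E * (normal_pdf 0 1 (x : R))%:E))%E.
  by apply: ge0_integral_normal_prob => // x; rewrite lee_fin sqr_ge0.
apply: (@le_lt_trans _ _ (\int[lebesgue_measure]_x
    (C%:E * (normal_pdf 0 (Num.sqrt 2) (x : R))%:E)))%E.
  apply: ge0_le_integral => //.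
  - by move=> x _; rewrite -EFinM lee_fin mulr_ge0 ?sqr_ge0 ?normal_pdf_ge0.
  - by apply: emeasurable_funM.
  - by apply: emeasurable_funM => //; exact: measurable_cst.
  move=> x _; rewrite -!EFinM lee_fin !normal_pdfE ?oner_neq0//.
  rewrite /C /normal_fun !subr0 s2 expr1n.
  set p1 := normal_peak 1; set p2 := normal_peak _.
  have p20 : p2 != 0 by rewrite gt_eqF// normal_peak_gt0.
  rewrite mulrA [X in _ <= X](_ : _ = p1 * (4 * expR (- x ^+ 2 / (2 *+ 2)))); last first.
    by field.
  rewrite -mulrA mulrCA ler_wpM2l ?normal_peak_ge0//.
  have -> : - x ^+ 2 / (1 *+ 2) = - x ^+ 2 / (2 *+ 2) + - (x ^+ 2 / 4) by field.
  have key : x ^+ 2 * expR (- (x ^+ 2 / 4)) <= 4.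
    rewrite expRN ler_pdivrMr ?expR_gt0//.
    by have := expR_ge1Dx (x ^+ 2 / 4); lra.
  rewrite expRD.
  by have := ler_wpM2l (expR_ge0 (- x ^+ 2 / (2 *+ 2))) key; lra.
rewrite ge0_integralZl//; last first.
  by move=> x _; rewrite lee_fin normal_pdf_ge0.
by rewrite integral_normal_pdf mule1 ltry.
Qed.

(** A vanishing second moment would put all the mass on {0}, which is Lebesgue null. *)
Lemma m2_gt0 : (0 < m2)%E.
Proof.
rewrite lt_def m2_ge0 andbT; apply/eqP => m20.
have mh : measurable_fun setT (fun x : T => ((x : R) ^+ 2)%:E).
  by apply/measurable_EFinP; apply: measurable_funX.
have : ae_eq g1 setT (fun x : T => ((x : R) ^+ 2)%:E) (cst 0%E).
  apply/(ae_eq_integral_abs g1 measurableT mh).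
  rewrite -[RHS]m20; apply: eq_integral => x _.
  by rewrite gee0_abs// lee_fin sqr_ge0.
move=> [N [mN N0 sN]].
pose Z : set T := [set (0 : R)].
have mZ : measurable Z by exact: measurable_set1.
have g10 : g1 Z = 0%E.
  have /null_content_dominatesP := normal_prob_dominates (0 : R) 1.
  by apply => //; exact: lebesgue_measure_set1.
have : (g1 setT <= g1 N + g1 Z)%E.
  apply: le_trans (measureU2 _ mN mZ) => //.
  apply: le_measure; rewrite ?inE//; first exact: measurableU.
  move=> x _; have [->|x0] := eqVneq (x : R) 0; first by right.
  left; apply: sN => /= /(_ I)/eqP; rewrite eqe sqrf_eq0.
  by rewrite (negbTE x0).
by rewrite N0 g10 adde0 probability_setT lee_fin ler10.
Qed.

Definition gauss_var : R := fine m2.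

Lemma gauss_varE : m2 = gauss_var%:E.
Proof. by rewrite fineK// ge0_fin_numE ?m2_lty// m2_ge0. Qed.

Lemma gauss_var_gt0 : 0 < gauss_var.
Proof. by rewrite -lte_fin -gauss_varE m2_gt0. Qed.

(** Each round may now make finitely many measurements at once. The batches are read as one sequence
    in which item [i] of round [r] has index [r * c + enum_rank i]. *)
Lemma gauss_predictable_variance_block (I : finType) D n
    (a : nat -> I -> 'cV[R]_n -> 'cV[R]_n) (b : 'cV[R]_n -> 'cV[R]_n) :
  measurable_fun setT b ->
  (forall j g g', (j < D)%N ->
    (forall r i, (r < j)%N -> dot (a r i g) g = dot (a r i g') g') ->
    forall i, a j i g = a j i g') ->
  (forall g g',
    (forall r i, (r < D)%N -> dot (a r i g) g = dot (a r i g') g') ->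
    b g = b g') ->
  (forall j i g, (j < D)%N -> dot (a j i g) (b g) = 0) ->
  (\int[gauss n]_g (dot (b g) g ^+ 2)%:E =
   gauss_var%:E * \int[gauss n]_g (dot (b g) (b g))%:E)%E.
Proof.
move=> mb pa pb ab; rewrite -gauss_varE.
pose c := #|I|.
(* The default 0 is reached only when [I] is empty; otherwise [m %% c] is always a valid index. *)
pose a' m g := if insub (m %% c)%N is Some o then a (m %/ c)%N (@enum_val I predT o) g
  else 0.
have a'E r (i : I) g : a' (r * c + enum_rank i)%N g = a r i g.
  have ic : (enum_rank i < c)%N by [].
  rewrite /a' modnMDl modn_small// divnMDl ?(leq_trans _ ic)// divn_small// addn0.
  by rewrite insubT; congr a; rewrite -[RHS]enum_rankK; congr enum_val; apply/val_inj.
have lt r (i : I) j : (r < j)%N -> (r * c + enum_rank i < j * c)%N.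
  move=> rj; apply: (@leq_trans (r.+1 * c)%N); last by rewrite leq_mul2r rj orbT.
  by rewrite mulSn [(c + _)%N]addnC ltn_add2l.
apply: (@gauss_predictable_variance _ (D * c) _ a') => //.
- move=> m g g' mD E; rewrite /a'; case: insubP => // o _ _.
  have c0 : (0 < c)%N.
    by rewrite lt0n; apply: contraTneq mD => c0; rewrite c0 muln0.
  apply: pa; first by rewrite ltn_divLR.
  move=> r i rm; rewrite -!a'E; apply: E.
  by apply: leq_trans (lt _ i _ rm) _; exact: leq_trunc_div.
- by move=> g g' E; apply: pb => r i rD; rewrite -!a'E; apply: E; exact: lt.
- move=> m g mD; rewrite /a'; case: insubP => [w _ _|_]; last by rewrite dot0l.
  apply: ab; rewrite ltn_divLR//.
  by rewrite lt0n; apply: contraTneq mD => c0; rewrite c0 muln0.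
Qed.

Local Notation ev i := (delta_mx i 0 : 'cV[R]__).

Lemma gauss_moment2 n (i : 'I_n) : (\int[gauss n]_g (g i 0 ^+ 2)%:E = gauss_var%:E)%E.
Proof.
transitivity (\int[gauss n]_g (dot (ev i) g ^+ 2)%:E)%E.
  by apply: eq_integral => g _; rewrite dot_delta.
by rewrite gauss_variance gauss_varE dot_delta mxE !eqxx mule1.
Qed.

Let measurable_entry n (i : 'I_n) :
  measurable_fun setT (fun g : 'cV[R]_n => g i 0).
Proof. exact: measurable_coord. Qed.

Let dot_deltaZ n (i : 'I_n) (k : R) (u : 'cV[R]_n) :
  dot (k *: ev i) u = k * u i 0.
Proof. by rewrite dotZl dot_delta. Qed.

(** Once coordinate [j] is measured, the direction [g j 0 *: ev i] is known and orthogonal to the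
    measurement, so the predictable variance applies. *)
Lemma gauss_moment22 n (i j : 'I_n) : i != j ->
  (\int[gauss n]_g (g i 0 ^+ 2 * g j 0 ^+ 2)%:E = (gauss_var ^+ 2)%:E)%E.
Proof.
move=> ij; pose b (g : 'cV[R]_n) : 'cV[R]_n := g j 0 *: ev i.
transitivity (\int[gauss n]_g (dot (b g) g ^+ 2)%:E)%E.
  by apply: eq_integral => g _; rewrite dot_deltaZ exprMn mulrC.
rewrite (@gauss_predictable_variance_block unit 1 n (fun _ _ _ => ev j)) //.
- rewrite expr2 EFinM -{3}(gauss_moment2 j); congr (_ * _)%E.
  apply: eq_integral => g _.
  by rewrite dot_deltaZ mxE mxE !eqxx mulr1 -expr2.
- by apply: measurable_scalev; [exact: measurable_entry|exact: measurable_cst].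
- by move=> g g' /(_ 0%N tt isT); rewrite !dot_delta /b => ->.
- by move=> _ _ g _; rewrite dot_delta !mxE eq_sym (negbTE ij) mulr0.
Qed.

(** No density is computed. The number (g_i^2 - g_j^2)^2 is the squared projection of g on (g_i +
    g_j)(e_i - e_j), a direction known once g_i + g_j is measured and orthogonal to e_i + e_j; its
    mean is 4 [gauss_var]^2. Adding 2 g_i^2 g_j^2 gives 6 [gauss_var]^2 for the sum of the two
    fourth moments. *)
Lemma gauss_moment4 n (i j : 'I_n) : i != j ->
  (\int[gauss n]_g (g i 0 ^+ 4)%:E <= (6 * gauss_var ^+ 2)%:E)%E.
Proof.
move=> ij; have ijF := negbTE ij.
have jiF : (j == i) = false by rewrite eq_sym.
pose b (g : 'cV[R]_n) : 'cV[R]_n := (g i 0 + g j 0) *: (ev i - ev j).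
have dd (u : 'cV[R]_n) : dot (ev i - ev j) u = u i 0 - u j 0.
  by rewrite dotBl !dot_delta.
have ds (u : 'cV[R]_n) : dot (ev i + ev j) u = u i 0 + u j 0.
  by rewrite dotDl !dot_delta.
have mp (k l : nat) : measurable_fun setT (fun g : 'cV[R]_n => (g i 0 ^+ k * g j 0 ^+ l)%:E).
  by apply/measurable_EFinP; apply: measurable_funM; apply: measurable_funX; exact: measurable_entry.
have I1 : (\int[gauss n]_g ((g i 0 ^+ 2 - g j 0 ^+ 2) ^+ 2)%:E = (4 * gauss_var ^+ 2)%:E)%E.
  transitivity (\int[gauss n]_g (dot (b g) g ^+ 2)%:E)%E.
    by apply: eq_integral => g _; rewrite dotZl dd subr_sqr mulrC.
  rewrite (@gauss_predictable_variance_block unit 1 n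
    (fun _ _ _ => ev i + ev j)) //.
  - transitivity (gauss_var%:E * \int[gauss n]_g ((2 : R)%:E * (dot (ev i + ev j) g ^+ 2)%:E))%E.
      congr (_ * _)%E; apply: eq_integral => g _.
      rewrite dotZl dotZr dd !mxE !eqxx ?ijF ?jiF ds -EFinM /=.
      by congr EFin; rewrite !mulr0n !mulr1n; ring.
    rewrite ge0_integralZl//; last 2 first.
    - apply/measurable_EFinP; apply: measurable_funX.
      by apply: measurable_dot; [exact: measurable_cst|exact: measurable_id].
    - by move=> g _; rewrite lee_fin sqr_ge0.
    rewrite gauss_variance gauss_varE ds !mxE !eqxx ?ijF ?jiF.
    by rewrite -!EFinM; congr EFin; rewrite !mulr0n !mulr1n; ring.
  - apply: measurable_scalev; last exact: measurable_cst.
    by apply: measurable_funD; exact: measurable_entry.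
  - by move=> g g' /(_ 0%N tt isT); rewrite !ds /b => ->.
  - move=> _ _ g _; rewrite dotZr ds !mxE !eqxx ?ijF ?jiF.
    by rewrite !mulr0n !mulr1n; ring.
have I2 : (\int[gauss n]_g (g i 0 ^+ 4 + g j 0 ^+ 4)%:E = (6 * gauss_var ^+ 2)%:E)%E.
  transitivity (\int[gauss n]_g (((g i 0 ^+ 2 - g j 0 ^+ 2) ^+ 2)%R%:E +
      (2 : R)%:E * (g i 0 ^+ 2 * g j 0 ^+ 2)%R%:E))%E.
    by apply: eq_integral => g _; rewrite -EFinM -EFinD; congr EFin; ring.
  rewrite ge0_integralD//; last 4 first.
  - by move=> g _; rewrite lee_fin sqr_ge0.
  - apply/measurable_EFinP; apply: measurable_funX.
    by apply: measurable_funB; apply: measurable_funX; exact: measurable_entry.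
  - by move=> g _; apply: mule_ge0; rewrite lee_fin ?ler0n//; apply: mulr_ge0; exact: sqr_ge0.
  - under eq_fun do rewrite -EFinM.
    apply/measurable_EFinP; apply: measurable_funM; first exact: measurable_cst.
    by apply: measurable_funM; apply: measurable_funX; exact: measurable_entry.
  rewrite I1 ge0_integralZl//; last first.
    by move=> g _; rewrite lee_fin; apply: mulr_ge0; exact: sqr_ge0.
  rewrite gauss_moment22// -EFinM -EFinD; congr EFin; ring.
rewrite -I2; apply: ge0_le_integral => //.
- by move=> g _; rewrite lee_fin exprn_even_ge0.
- by apply/measurable_EFinP; apply: measurable_funX; exact: measurable_entry.
- by apply/measurable_EFinP; apply: measurable_funD; apply: measurable_funX; exact: measurable_entry.
- by move=> g _; rewrite lee_fin lerDl exprn_even_ge0.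
Qed.

End gaussian_moments.

(** * Integrals of nonnegative real-valued functions *)

Section real_valued_integrals.
Context d (T : measurableType d) (R : realType) (mu : {measure set T -> \bar R}).
Implicit Types f g : T -> R.

Lemma ge0_integralZ_EFin k f : 0 <= k -> measurable_fun setT f ->
  (forall x, 0 <= f x) ->
  (\int[mu]_x (k * f x)%:E = k%:E * \int[mu]_x (f x)%:E)%E.
Proof.
move=> k0 mf f0; under eq_integral do rewrite EFinM.
apply: ge0_integralZl => //; first exact/measurable_EFinP.
by move=> x _; rewrite lee_fin.
Qed.

Lemma ge0_integralD_EFin f g : measurable_fun setT f -> measurable_fun setT g ->
  (forall x, 0 <= f x) -> (forall x, 0 <= g x) ->
  (\int[mu]_x (f x + g x)%:E = \int[mu]_x (f x)%:E + \int[mu]_x (g x)%:E)%E.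
Proof.
move=> mf mg f0 g0; under eq_integral do rewrite EFinD.
apply: ge0_integralD => //.
- by move=> x _; rewrite lee_fin.
- exact/measurable_EFinP.
- by move=> x _; rewrite lee_fin.
- exact/measurable_EFinP.
Qed.

Lemma ge0_integral_sum_EFin (I : Type) (r : seq I) (f : I -> T -> R) :
  (forall i, measurable_fun setT (f i)) -> (forall i x, 0 <= f i x) ->
  (\int[mu]_x (\sum_(i <- r) f i x)%:E = \sum_(i <- r) \int[mu]_x (f i x)%:E)%E.
Proof.
move=> mf f0; under eq_integral do rewrite -sumEFin.
apply: ge0_integral_sum => //.
- by move=> i; exact/measurable_EFinP.
- by move=> i x _; rewrite lee_fin.
Qed.

Lemma ge0_le_integral_EFin f g : measurable_fun setT f -> measurable_fun setT g ->
  (forall x, 0 <= f x) -> (forall x, f x <= g x) ->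
  (\int[mu]_x (f x)%:E <= \int[mu]_x (g x)%:E)%E.
Proof.
move=> mf mg f0 fg; apply: ge0_le_integral => //.
- by move=> x _; rewrite lee_fin.
- exact/measurable_EFinP.
- exact/measurable_EFinP.
- by move=> x _; rewrite lee_fin.
Qed.

End real_valued_integrals.

(** * Concentration of the Gram matrix of a weighted Gaussian matrix *)

Section gram_matrix.
Context {R : realType}.
Local Notation gauss_var := (@gauss_var R).

Let measurable_entry n (i : 'I_n) :
  measurable_fun setT (fun g : 'cV[R]_n => g i 0).
Proof. exact: measurable_coord. Qed.

(** In the double sum for the second moment, the diagonal terms have a fourth moment of at most 6
    [gauss_var]^2 in place of [gauss_var]^2, whence the factor 5. The auxiliary coordinate of
    [gauss_moment4] exists because [1 < N]. *)
Lemma gauss_chi_square n N (f : 'I_n -> 'I_N) (t : 'I_n -> R) : (1 < N)%N ->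
  injective f -> (forall k, 0 <= t k) ->
  (\int[gauss N]_g ((\sum_k t k * g (f k) 0 ^+ 2 - gauss_var * \sum_k t k) ^+ 2)%:E <=
   (5 * gauss_var ^+ 2 * \sum_k t k ^+ 2)%:E)%E.
Proof.
move=> N1 fI t0.
pose S (g : 'cV[R]_N) := \sum_k t k * g (f k) 0 ^+ 2.
pose m := gauss_var * \sum_k t k.
have S0 g : 0 <= S g by apply: sumr_ge0 => k _; rewrite mulr_ge0 ?sqr_ge0.
have m0 : 0 <= m by rewrite mulr_ge0 ?sumr_ge0// ltW// gauss_var_gt0.
have mS : measurable_fun setT S.
  apply: measurable_sum => k; apply: measurable_funM; first exact: measurable_cst.
  by apply: measurable_funX; exact: measurable_entry.
have mX i : measurable_fun setT (fun g : 'cV[R]_N => g i 0 ^+ 2).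
  by apply: measurable_funX; exact: measurable_entry.
have mm i j : measurable_fun setT (fun g : 'cV[R]_N => g i 0 ^+ 2 * g j 0 ^+ 2).
  exact: measurable_funM.
have mm0 i j (g : 'cV[R]_N) : 0 <= g i 0 ^+ 2 * g j 0 ^+ 2.
  by apply: mulr_ge0; exact: sqr_ge0.
have IS : (\int[gauss N]_g (S g)%:E = m%:E)%E.
  rewrite ge0_integral_sum_EFin; last 2 first.
  - by move=> k; apply: measurable_funM => //; exact: measurable_cst.
  - by move=> k g; rewrite mulr_ge0 ?sqr_ge0.
  rewrite /m mulr_sumr -sumEFin; apply: eq_bigr => k _.
  rewrite ge0_integralZ_EFin//; last by move=> g; exact: sqr_ge0.
  by rewrite gauss_moment2 -EFinM mulrC.
have IS2 : (\int[gauss N]_g (S g ^+ 2)%:E <=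
    (m ^+ 2 + 5 * gauss_var ^+ 2 * \sum_k t k ^+ 2)%:E)%E.
  have E g : S g ^+ 2 = \sum_k \sum_j (t k * t j) * (g (f k) 0 ^+ 2 * g (f j) 0 ^+ 2).
    rewrite expr2 {1}/S mulr_suml; apply: eq_bigr => k _.
    by rewrite /S mulr_sumr; apply: eq_bigr => j _; ring.
  under eq_integral do rewrite E.
  have mt k j : measurable_fun setT (fun g : 'cV[R]_N =>
      (t k * t j) * (g (f k) 0 ^+ 2 * g (f j) 0 ^+ 2)).
    by apply: measurable_funM => //; exact: measurable_cst.
  have t0' k j (g : 'cV[R]_N) : 0 <= (t k * t j) * (g (f k) 0 ^+ 2 * g (f j) 0 ^+ 2).
    by apply: mulr_ge0; [exact: mulr_ge0|exact: mm0].
  rewrite ge0_integral_sum_EFin; last 2 first.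
  - by move=> k; exact: measurable_sum.
  - by move=> k g; exact: sumr_ge0.
  have -> : m ^+ 2 + 5 * gauss_var ^+ 2 * \sum_k t k ^+ 2 =
      \sum_k \sum_j (t k * t j) * (gauss_var ^+ 2 + (k == j)%:R * (5 * gauss_var ^+ 2)).
    transitivity (\sum_k (gauss_var ^+ 2 * (\sum_j t j) * t k + 5 * gauss_var ^+ 2 * t k ^+ 2)).
      by rewrite big_split/= -!mulr_sumr /m; ring.
    apply: eq_bigr => k _.
    under [RHS]eq_bigr do rewrite mulrDr.
    rewrite big_split/=; congr (_ + _).
      by rewrite mulr_sumr mulr_suml; apply: eq_bigr => j _; ring.
    rewrite (bigD1 k)//= eqxx big1 => [|j jk]; first by by rewrite mul1r addr0 expr2 mulrC.
    by rewrite eq_sym (negbTE jk); rewrite mul0r mulr0.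
  rewrite -sumEFin; apply: lee_sum => k _.
  rewrite ge0_integral_sum_EFin// -sumEFin; apply: lee_sum => j _.
  rewrite ge0_integralZ_EFin ?mulr_ge0//.
  rewrite [leRHS]EFinM; apply: lee_wpmul2l; first by rewrite lee_fin mulr_ge0.
  have [->|kj] := eqVneq k j; last first.
    by rewrite mul0r addr0 gauss_moment22// (inj_eq fI).
  rewrite mul1r (_ : _ + _ = 6 * gauss_var ^+ 2); last by ring.
  have [i ij] : exists i, f j != i.
    have /card_gt1P[x [y [_ _ xy]]] : (1 < #|'I_N|)%N by rewrite card_ord.
    have [jx|jx] := eqVneq (f j) x; last by exists x.
    by exists y; rewrite jx.
  apply: le_trans (gauss_moment4 ij).
  by rewrite le_eqVlt; apply/orP; left; apply/eqP; apply: eq_integral => g _; rewrite -exprD.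
(* The variance identity, rearranged so that every integrand is nonnegative and no extended reals
   are subtracted. *)
have m2S : (\int[gauss N]_g ((S g - m) ^+ 2)%:E + (2 * m * m)%:E =
    \int[gauss N]_g (S g ^+ 2)%:E + (m ^+ 2)%:E)%E.
  have mSm : measurable_fun setT (fun g => (S g - m) ^+ 2).
    by apply: measurable_funX; apply: measurable_funB => //; exact: measurable_cst.
  transitivity (\int[gauss N]_g ((S g - m) ^+ 2 + 2 * m * S g)%R%:E)%E.
    rewrite (@ge0_integralD_EFin _ _ _ _ (fun g => (S g - m) ^+ 2) (fun g => 2 * m * S g))//.
    - congr (_ + _)%E; apply/esym; rewrite [RHS]EFinM -IS.
      by apply: ge0_integralZ_EFin => //; rewrite mulr_ge0.
    - by apply: measurable_funM => //; exact: measurable_cst.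
    - by move=> g; exact: sqr_ge0.
    - by move=> g; rewrite mulr_ge0// mulr_ge0.
  transitivity (\int[gauss N]_g (S g ^+ 2 + m ^+ 2)%R%:E)%E.
    by apply: eq_integral => g _; congr EFin; ring.
  rewrite (@ge0_integralD_EFin _ _ _ _ (fun g => S g ^+ 2) (fun g => m ^+ 2))//.
  - congr (_ + _)%E; rewrite integral_cst//= -[RHS]mule1; congr (_ * _)%E.
    exact: (probability_setT (gauss N)).
  - exact: measurable_funX.
  - by move=> g; exact: sqr_ge0.
  - by move=> g; exact: sqr_ge0.
rewrite -(@leeD2rE _ (2 * m * m)%:E)// m2S.
apply: le_trans (leeD2r _ IS2) _.
by rewrite -!EFinD lee_fin le_eqVlt; apply/orP; left; apply/eqP; ring.
Qed.

Definition mat n (g : 'cV[R]_(n * n)) : 'M[R]_n :=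
  \matrix_(k, l) g (mxvec_index k l) 0.

Definition vecm n (M : 'M[R]_n) : 'cV[R]_(n * n) := (mxvec M)^T.

Lemma vecmK n (M : 'M[R]_n) : mat (vecm M) = M.
Proof. by apply/matrixP => k l; rewrite !mxE mxvecE. Qed.

Lemma dot_vecm n (M : 'M[R]_n) g :
  dot (vecm M) g = \sum_k \sum_l M k l * mat g k l.
Proof.
rewrite /dot (reindex (uncurry (@mxvec_index n n))) /=; last first.
  exact/subon_bij/curry_mxvec_bij.
rewrite pair_big; apply: eq_bigr => -[k l] _ /=.
by rewrite !mxE mxvecE.
Qed.

Lemma dot_vecm2 n (M N : 'M[R]_n) :
  dot (vecm M) (vecm N) = \sum_k \sum_l M k l * N k l.
Proof. by rewrite dot_vecm vecmK. Qed.

Lemma mxvec_index_inj n : injective (fun p : 'I_n * 'I_n => mxvec_index p.1 p.2).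
Proof. by move=> [i j] [k l] /cast_ord_inj/enum_rank_inj. Qed.

Definition weighted n (w : 'M[R]_n) g : 'M[R]_n :=
  \matrix_(k, l) (w k l * mat g k l).

Lemma measurable_mat n k l : measurable_fun setT (fun g : 'cV[R]_(n * n) => mat g k l).
Proof. by under eq_fun do rewrite mxE; exact: measurable_entry. Qed.

Lemma measurable_weighted n (w : 'M[R]_n) k l :
  measurable_fun setT (fun g => weighted w g k l).
Proof.
under eq_fun do rewrite mxE.
by apply: measurable_funM; [exact: measurable_cst|exact: measurable_mat].
Qed.

Lemma measurable_vecm d (T : measurableType d) n (f : T -> 'M[R]_n) :
  (forall k l, measurable_fun setT (fun x => f x k l)) ->
  measurable_fun setT (fun x => vecm (f x)).
Proof.
move=> mf; apply/measurable_fun_cVP => i.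
have [k l] := mxvec_indexP i.
by under eq_fun do rewrite mxE mxvecE; exact: mf.
Qed.

(** The subtracted term is the expectation of the Gram entry. *)
Definition gram_error n (w : 'M[R]_n) g (l j : 'I_n) : R :=
  ((weighted w g)^T *m weighted w g) l j -
  (l == j)%:R * (gauss_var * \sum_k w k l ^+ 2).

Lemma measurable_gram_error n (w : 'M[R]_n) l j :
  measurable_fun setT (fun g => gram_error w g l j).
Proof.
apply: measurable_funB; last exact: measurable_cst.
under eq_fun do rewrite mxE; apply: measurable_sum => k.
apply: measurable_funM; last exact: measurable_weighted.
by under eq_fun do rewrite mxE; exact: measurable_weighted.
Qed.

(** A diagonal entry is a weighted chi-square sum. Off the diagonal, the entry is the inner product
    of two distinct columns: after column [j] is measured, it is the projection of the Gaussian
    vector on a known direction supported in column [l]. *)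
Lemma gram_error_entry n (w : 'M[R]_n) l j : (1 < n)%N ->
  (\int[gauss (n * n)]_g (gram_error w g l j ^+ 2)%:E <=
   (5 * gauss_var ^+ 2 * \sum_k w k l ^+ 2 * w k j ^+ 2)%:E)%E.
Proof.
move=> n1; have [<-|lj] := eqVneq l j.
  have -> : \sum_k w k l ^+ 2 * w k l ^+ 2 = \sum_k (w k l ^+ 2) ^+ 2.
    by apply: eq_bigr => k _; rewrite -expr2.
  apply: le_trans (gauss_chi_square (f := fun k => mxvec_index k l) _ _ _); last 3 first.
  - by rewrite (leq_trans n1)// leq_pmulr// ltnW.
  - by move=> k k' /(@mxvec_index_inj n (k, l) (k', l))[].
  - by move=> k; exact: sqr_ge0.
  rewrite le_eqVlt; apply/orP; left; apply/eqP; apply: eq_integral => g _.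
  rewrite /gram_error eqxx mul1r; congr ((_ - _) ^+ 2)%:E.
  by rewrite mxE; apply: eq_bigr => k _; rewrite !mxE; ring.
pose b (g : 'cV[R]_(n * n)) := vecm (\matrix_(k, i)
  ((i == l)%:R * (w k l * w k j * mat g k j))).
have bE g h : dot (b g) h = \sum_k (w k l * w k j * mat g k j) * mat h k l.
  rewrite dot_vecm; apply: eq_bigr => k _.
  rewrite (bigD1 l)//= mxE eqxx mul1r big1 ?addr0// => i il.
  by rewrite mxE (negbTE il) !mul0r.
have dE k g : dot (vecm (delta_mx k j)) g = mat g k j.
  rewrite dot_vecm (bigD1 k)//= (bigD1 j)//= mxE !eqxx mul1r.
  rewrite !big1 ?addr0// => [k' k'k|i ij].
    by rewrite big1// => i _; rewrite mxE (negbTE k'k) mul0r.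
  by rewrite mxE (negbTE ij) andbF mul0r.
have mb : measurable_fun setT b.
  apply: measurable_vecm => k i; under eq_fun do rewrite mxE.
  apply: measurable_funM; first exact: measurable_cst.
  by apply: measurable_funM; [exact: measurable_cst|exact: measurable_mat].
have -> : (\int[gauss (n * n)]_g (gram_error w g l j ^+ 2)%:E =
    \int[gauss (n * n)]_g (dot (b g) g ^+ 2)%:E)%E.
  apply: eq_integral => g _; congr (_ ^+ 2)%:E.
  rewrite /gram_error (negbTE lj) mul0r subr0 bE mxE.
  by apply: eq_bigr => k _; rewrite !mxE; ring.
rewrite (@gauss_predictable_variance_block _ 'I_n 1 _ (fun _ k _ => vecm (delta_mx k j)))//;
    last 2 first.
- move=> g g' E; congr vecm; apply/matrixP => k i; rewrite !mxE.
  by have := E 0%N k isT; rewrite !dE !mxE => ->.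
- move=> _ k g _; rewrite dot_vecm2 big1// => k' _; rewrite big1// => i _.
  rewrite !mxE; have [->|ij] := eqVneq i j; last by rewrite andbF mul0r.
  by rewrite [j == l]eq_sym (negbTE lj) mul0r mulr0.
have -> : (\int[gauss (n * n)]_g (dot (b g) (b g))%:E =
    \sum_k ((w k l ^+ 2 * w k j ^+ 2 * gauss_var)%:E))%E.
  transitivity (\int[gauss (n * n)]_g
      (\sum_k (w k l ^+ 2 * w k j ^+ 2) * mat g k j ^+ 2)%:E)%E.
    apply: eq_integral => g _; rewrite bE vecmK; congr EFin; apply: eq_bigr => k _.
    by rewrite [X in _ * X]mxE eqxx mul1r; ring.
  have m2k k : measurable_fun setT (fun g : 'cV[R]_(n * n) => mat g k j ^+ 2).
    by apply: measurable_funX; exact: measurable_mat.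
  rewrite ge0_integral_sum_EFin; last 2 first.
  - by move=> k; apply: measurable_funM => //; exact: measurable_cst.
  - by move=> k g; apply: mulr_ge0; [apply: mulr_ge0|]; exact: sqr_ge0.
  apply: eq_bigr => k _; rewrite ge0_integralZ_EFin//; last 2 first.
  - by rewrite mulr_ge0 ?sqr_ge0.
  - by move=> g; exact: sqr_ge0.
  under eq_integral do rewrite mxE.
  by rewrite gauss_moment2 -EFinM.
rewrite sumEFin -EFinM lee_fin -mulr_suml; set W := \sum_k _.
have W0 : 0 <= W by apply: sumr_ge0 => k _; rewrite mulr_ge0 ?sqr_ge0.
by have := mulr_ge0 (sqr_ge0 gauss_var) W0; lra.
Qed.

Lemma gram_concentration n (w : 'M[R]_n) : (1 < n)%N ->
  (\int[gauss (n * n)]_g (\sum_l \sum_j gram_error w g l j ^+ 2)%:E <=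
   (5 * gauss_var ^+ 2 * \sum_k (\sum_l w k l ^+ 2) ^+ 2)%:E)%E.
Proof.
move=> n1.
have me l j : measurable_fun setT (fun g => gram_error w g l j ^+ 2).
  by apply: measurable_funX; exact: measurable_gram_error.
rewrite ge0_integral_sum_EFin; last 2 first.
- by move=> l; exact: measurable_sum.
- by move=> l g; apply: sumr_ge0 => j _; exact: sqr_ge0.
have -> : \sum_k (\sum_l w k l ^+ 2) ^+ 2 =
    \sum_l \sum_j \sum_k w k l ^+ 2 * w k j ^+ 2.
  rewrite [RHS](eq_bigr (fun l => \sum_k \sum_j w k l ^+ 2 * w k j ^+ 2)); last first.
    by move=> l _; rewrite exchange_big.
  rewrite [RHS]exchange_big/=; apply: eq_bigr => k _.
  by rewrite expr2 mulr_suml; apply: eq_bigr => l _; rewrite mulr_sumr.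
rewrite mulr_sumr -sumEFin; apply: lee_sum => l _.
rewrite ge0_integral_sum_EFin//; last by move=> j g; exact: sqr_ge0.
by rewrite mulr_sumr -sumEFin; apply: lee_sum => j _; exact: gram_error_entry.
Qed.

End gram_matrix.

(** * Gradient, Hessian, infimum and condition number for least squares *)

Section least_squares_calculus.
Context {R : realType}.

Lemma derive_quadratic n (f : 'cV[R]_n -> R) (v x : 'cV[R]_n) (p q : R) :
  (forall h : R, f (h *: v + x) = f x + h * p + h ^+ 2 * q) -> 'D_v f x = p.
Proof.
move=> fE; rewrite /derive; apply: cvg_lim => //.
apply: (@cvg_trans _ ((fun h : R => p + h * q) @ 0^')).
  apply: near_eq_cvg; near=> h.
  have h0 : h != 0 by near: h; exact: nbhs_dnbhs_neq.
  rewrite /= fE (_ : _ - f x = h * (p + h * q)); last by ring.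
  by rewrite [RHS]mulKf.
have : (fun h : R => p + h * q) @ 0^' --> p + 0 * q.
  apply: cvgD; first exact: cvg_cst.
  by apply: cvgMr_tmp; exact: nbhs_dnbhs.
by rewrite mul0r addr0.
Unshelve. all: by end_near. Qed.

Lemma least_squaresE n (A : 'M[R]_n) b x :
  least_squares A b x = 2^-1 * dot (A *m x - b) (A *m x - b).
Proof. by rewrite /least_squares enorm_sqr. Qed.

Lemma derive_least_squares n (A : 'M[R]_n) b v x :
  'D_v (least_squares A b) x = dot (A *m v) (A *m x - b).
Proof.
apply: (@derive_quadratic _ _ _ _ _ (2^-1 * dot (A *m v) (A *m v))) => h.
rewrite !least_squaresE mulmxDr -scalemxAr -addrA.
move: (A *m x - b) (A *m v) => r s.
by rewrite !dotDl !dotDr !dotZl !dotZr (dotC r s); field.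
Qed.

Lemma gradient_least_squares n (A : 'M[R]_n) b x :
  gradient (least_squares A b) x = A^T *m (A *m x - b).
Proof.
apply/colP => i; rewrite mxE derive_least_squares.
by rewrite dot_mull dot_delta.
Qed.

Lemma hessian_least_squares n (A : 'M[R]_n) b x :
  hessian (least_squares A b) x = A^T *m A.
Proof.
apply/matrixP => i j; rewrite mxE.
have -> : 'D_(delta_mx j 0) (least_squares A b) =
    (fun y => dot (A *m delta_mx j 0) (A *m y - b)).
  by apply/funext => y; exact: derive_least_squares.
rewrite (@derive_quadratic _ _ _ _ (dot (A *m delta_mx j 0) (A *m delta_mx i 0)) 0).
  rewrite dotC dot_mull dot_delta mulmxA -colE.
  by rewrite mxE.
move=> h; rewrite mulmxDr -scalemxAr -addrA dotDr dotZr; ring.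
Qed.

Lemma inf_range_least_squares n (A : 'M[R]_n) b : A \in unitmx ->
  inf (range (least_squares A b)) = 0.
Proof.
move=> uA; set f := least_squares A b.
have f0 x : 0 <= f x by rewrite /f least_squaresE mulr_ge0 ?dotxx_ge0.
have fx : f (invmx A *m b) = 0.
  by rewrite /f least_squaresE mulKVmx// subrr dot0l mulr0.
have lb0 : lbound (range f) 0 by move=> _ [x _ <-].
apply/eqP; rewrite eq_le; apply/andP; split.
  by apply: ge_inf; [exists 0|exists (invmx A *m b)].
by apply: lb_le_inf => //; exists (f 0), 0.
Qed.

Lemma cond_number_le n (M : 'M[R]_n) (lo hi kappa : R) :
  0 < lo -> 0 <= hi -> 0 <= kappa -> hi <= kappa * lo ->
  (forall v : 'cV[R]_n, lo ^+ 2 * dot v v <= dot (M *m v) (M *m v)) ->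
  (forall v : 'cV[R]_n, dot (M *m v) (M *m v) <= hi ^+ 2 * dot v v) ->
  cond_number M <= kappa.
Proof.
move=> lo0 hi0 k0 hk loP hiP; rewrite /cond_number.
have svP s : singular_values M s -> lo <= s <= hi.
  move=> [a /eigenvalueP[v vM v0] <-].
  have u0 : 0 < dot v^T v^T.
    rewrite lt_def dotxx_ge0 dotxx_eq0 andbT.
    by apply: contraNneq v0 => /(congr1 trmx); rewrite trmxK trmx0 => ->.
  have E : dot (M *m v^T) (M *m v^T) = a * dot v^T v^T.
    rewrite dot_mull -dotZr; congr dot.
    by rewrite mulmxA -[RHS]linearZ/= -vM !trmx_mul trmxK.
  have la : lo ^+ 2 <= a by have := loP v^T; rewrite E ler_pM2r.
  have ah : a <= hi ^+ 2 by have := hiP v^T; rewrite E ler_pM2r.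
  have a0 : 0 <= a by apply: le_trans la; exact: sqr_ge0.
  have sa : Num.sqrt a ^+ 2 = a by exact: sqr_sqrtr.
  have sa0 := sqrtr_ge0 a.
  by apply/andP; split; rewrite -(@ler_pXn2r _ 2) ?nnegrE ?sa// ltW.
set S := singular_values M in svP *.
(* On the empty set [sup] is 0 by convention, so the existence of eigenvalues does not have to be
   discussed. *)
have [[s Ss]|S0] := pselect (S !=set0); last first.
  have -> : S = set0 by apply/eqP/negPn/negP => /set0P.
  by rewrite sup0 mul0r.
have supS : sup S <= hi by apply: ge_sup; [exists s|move=> y /svP/andP[]].
have infS : lo <= inf S by apply: lb_le_inf; [exists s|move=> y /svP/andP[]].
have inf0 : 0 < inf S by exact: lt_le_trans infS.
rewrite ler_pdivrMr//; apply: le_trans supS _; apply: le_trans hk _.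
by rewrite ler_wpM2l.
Qed.

End least_squares_calculus.

(** * Gram-Schmidt orthogonalization of possibly dependent vectors *)

Section gram_schmidt.
Context {R : realType}.
Context (n : nat).
Implicit Types (v : nat -> 'cV[R]_n) (w z : 'cV[R]_n).

(** The zero vector is sent to zero, so dependent families are allowed and Gram-Schmidt vectors have
    length 1 or 0. The real power inherits measurability from [measurable_powR]. *)
Definition normalize w : 'cV[R]_n := (dot w w `^ (- 2^-1)) *: w.

Let normalize_coef w : w != 0 ->
  dot w w `^ (- 2^-1) * dot w w `^ (- 2^-1) * dot w w = 1.
Proof.
move=> w0; have ww : 0 < dot w w by rewrite lt_def dotxx_eq0 w0 dotxx_ge0.
rewrite -powRD ?(gt_eqF ww) ?implybT//.
rewrite -opprD (_ : 2^-1 + 2^-1 = 1); last by field.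
by rewrite powR_inv1 ?ltW// mulVf ?gt_eqF.
Qed.

Lemma normalizeK w : dot (normalize w) w *: normalize w = w.
Proof.
have [->|w0] := eqVneq w 0; first by rewrite dot0r scale0r.
by rewrite /normalize dotZl scalerA mulrAC normalize_coef// scale1r.
Qed.

(** This encodes that a normalized vector has length 1 or is zero, sparing the case distinction
    later. *)
Lemma dot_normalize w : dot (normalize w) (normalize w) *: normalize w = normalize w.
Proof.
have [->|w0] := eqVneq w 0; first by rewrite /normalize !scaler0.
by rewrite {1 2}/normalize dotZl dotZr mulrA normalize_coef// scale1r.
Qed.

Lemma dot_normalize_le1 w : dot (normalize w) (normalize w) <= 1.
Proof.
have := congr1 (dot (normalize w)) (dot_normalize w); rewrite dotZr => /eqP.
rewrite -subr_eq0 -[X in _ - X]mul1r -mulrBl mulf_eq0 => /orP[|]/eqP.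
  by move/eqP; rewrite subr_eq0 => /eqP->.
by move=> ->; exact: ler01.
Qed.

(* [resid v k] is the orthogonal projection onto the complement of the span of
   [v 0, ..., v k.-1]. *)
Fixpoint resid v (k : nat) : 'M[R]_n :=
  if k is j.+1 then
    resid v j - normalize (resid v j *m v j) *m (normalize (resid v j *m v j))^T
  else 1%:M.

Definition gs v k := normalize (resid v k *m v k).

Lemma residS v k : resid v k.+1 = resid v k - gs v k *m (gs v k)^T.
Proof. by []. Qed.

Lemma outerE (u z : 'cV[R]_n) : u *m u^T *m z = dot u z *: u.
Proof.
rewrite -mulmxA; have -> : u^T *m z = (dot u z)%:M.
  by apply/matrixP => i j; rewrite !ord1 -dotE mxE eqxx.
by rewrite mul_mx_scalar.
Qed.

Lemma resid_tr v k : (resid v k)^T = resid v k.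
Proof.
elim: k => [|k IH]; first by rewrite trmx1.
by rewrite residS linearB/= IH trmx_mul trmxK.
Qed.

(** The two claims feed each other: idempotence at [k] makes [gs v k] a fixed vector of [resid v k],
    which in turn gives idempotence at [k.+1]. *)
Lemma resid_idem v k : resid v k *m resid v k = resid v k /\
  resid v k *m gs v k = gs v k.
Proof.
have fixg j : resid v j *m resid v j = resid v j -> resid v j *m gs v j = gs v j.
  by move=> idem; rewrite /gs /normalize -scalemxAr mulmxA idem.
elim: k => [|k [IH fixk]].
  by split; [rewrite mul1mx|apply: fixg; rewrite mul1mx].
suff idem : resid v k.+1 *m resid v k.+1 = resid v k.+1 by split => //; exact: fixg.
have fixl : (gs v k)^T *m resid v k = (gs v k)^T.
  by rewrite -[in LHS](resid_tr v k) -trmx_mul fixk.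
have uu : gs v k *m (gs v k)^T *m gs v k = gs v k.
  by rewrite outerE; exact: dot_normalize.
rewrite residS; move: (resid v k) (gs v k) IH fixk fixl uu => P u PP Pu uP uu.
rewrite mulmxBl !mulmxBr PP.
rewrite [P *m (u *m _)]mulmxA Pu -[u *m u^T *m P]mulmxA uP.
by rewrite [_ *m (u *m _)]mulmxA uu subrr subr0.
Qed.

Lemma resid_absorb v k j : (k <= j)%N -> resid v j *m resid v k = resid v j.
Proof.
elim: j => [|j IH]; first by rewrite leqn0 => /eqP->; rewrite mul1mx.
rewrite leq_eqVlt => /predU1P[->|kj]; first by have [] := resid_idem v j.+1.
rewrite residS mulmxBl IH//; congr (_ - _).
rewrite -mulmxA; congr (_ *m _).
have [_ <-] := resid_idem v j.
by rewrite trmx_mul resid_tr -mulmxA IH.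
Qed.

Lemma resid_vec v k r : (r < k)%N -> resid v k *m v r = 0.
Proof.
move=> rk; rewrite -(resid_absorb _ rk) -mulmxA.
suff -> : resid v r.+1 *m v r = 0 by rewrite mulmx0.
rewrite residS mulmxBl outerE; apply/eqP; rewrite subr_eq0; apply/eqP.
rewrite -{1}(proj2 (resid_idem v r)) dot_mull resid_tr.
by rewrite /gs normalizeK.
Qed.

Lemma resid_sum v k : 1%:M - resid v k = \sum_(r < k) gs v r *m (gs v r)^T.
Proof.
elim: k => [|k IH]; first by rewrite subrr big_ord0.
by rewrite big_ord_recr/= -IH opprD opprK addrA.
Qed.

Lemma sum_gs v k z :
  \sum_(r < k) dot (gs v r) z ^+ 2 = dot z (z - resid v k *m z).
Proof.
rewrite (_ : z - _ = (1%:M - resid v k) *m z); last by rewrite mulmxBl mul1mx.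
rewrite resid_sum mulmx_suml dot_sumr.
by apply: eq_bigr => r _; rewrite outerE dotZr dotC expr2 [dot z _]dotC.
Qed.

Lemma sum_gs_proj v k z : \sum_(r < k) dot (gs v r) z ^+ 2 =
  dot (z - resid v k *m z) (z - resid v k *m z).
Proof.
rewrite sum_gs [RHS]dotBl dot_mull resid_tr mulmxBr mulmxA.
by have [-> _] := resid_idem v k; rewrite subrr dot0r subr0.
Qed.

Lemma dot_resid_vec v k r z : (r < k)%N -> dot (v r) (resid v k *m z) = 0.
Proof. by move=> rk; rewrite dot_mulr resid_tr resid_vec// dot0l. Qed.

Lemma dot_gs_vec v k r : (r < k)%N -> dot (v r) (gs v k) = 0.
Proof. by move=> rk; have [_ <-] := resid_idem v k; exact: dot_resid_vec. Qed.

(** As [v r] lies in the span of the first [k] Gram-Schmidt vectors, [z] can be replaced by its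
    projection on that span before Cauchy-Schwarz. *)
Lemma dot_vec_gs v k r z : (r < k)%N ->
  dot (v r) z ^+ 2 <= dot (v r) (v r) * \sum_(s < k) dot (gs v s) z ^+ 2.
Proof.
move=> rk; rewrite sum_gs_proj.
rewrite (_ : dot (v r) z = dot (v r) (z - resid v k *m z)); first exact: dot_cauchy.
by rewrite dotBr dot_resid_vec// subr0.
Qed.

Lemma gs_prefix v v' k : (forall r, (r <= k)%N -> v r = v' r) -> gs v k = gs v' k.
Proof.
move=> E; rewrite /gs E//; suff -> : resid v k = resid v' k by [].
have {}E r : (r < k)%N -> v r = v' r by move=> /ltnW; exact: E.
elim: k E => [//|k IH] E.
by rewrite /= IH ?E// => r rk; apply: E; exact: ltnW.
Qed.

Lemma resid_prefix v v' k : (forall r, (r < k)%N -> v r = v' r) ->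
  resid v k = resid v' k.
Proof.
elim: k => [//|k IH] E.
by rewrite /= IH ?E// => r rk; apply: E; exact: ltnW.
Qed.

Lemma gs_support v (i : 'I_n) : (forall r, v r i 0 = 0) -> forall k, gs v k i 0 = 0.
Proof.
move=> vi k; suff H : forall z, z i 0 = 0 -> (resid v k *m z) i 0 = 0.
  by rewrite mxE H ?mulr0.
elim: k => [|k IH] z zi; first by rewrite mul1mx.
rewrite residS mulmxBl outerE mxE IH// mxE mxE.
by rewrite mxE IH ?vi// !mulr0 subr0.
Qed.

Lemma resid_support v (i : 'I_n) k z : (forall r, v r i 0 = 0) -> z i 0 = 0 ->
  (resid v k *m z) i 0 = 0.
Proof.
move=> vi zi; elim: k => [|k IH]; first by rewrite mul1mx.
by rewrite residS mulmxBl outerE mxE IH mxE mxE gs_support// mulr0 subr0.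
Qed.

End gram_schmidt.

Section measurable_gram_schmidt.
Context {R : realType} d (T : measurableType d) (n : nat).

Lemma measurable_normalize (f : T -> 'cV[R]_n) :
  measurable_fun setT f -> measurable_fun setT (fun x => normalize (f x)).
Proof.
move=> mf; apply: measurable_scalev => //.
exact: (measurableT_comp (@measurable_powR R (- 2^-1)) (measurable_dot mf mf)).
Qed.

Lemma measurable_resid (v : T -> nat -> 'cV[R]_n) k :
  (forall r, measurable_fun setT (v ^~ r)) ->
  forall i j, measurable_fun setT (fun x => resid (v x) k i j).
Proof.
move=> mv; elim: k => [|k IH] i j; first exact: measurable_cst.
have mg : measurable_fun setT (fun x => gs (v x) k).
  by apply: measurable_normalize; exact: measurable_mulmx.
under eq_fun do rewrite residS mxE mxE.
apply: measurable_funB => //.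
under eq_fun do rewrite mxE big_ord1 [X in _ * X]mxE.
by apply: measurable_funM; exact: measurable_coord.
Qed.

Lemma measurable_gs (v : T -> nat -> 'cV[R]_n) k :
  (forall r, measurable_fun setT (v ^~ r)) ->
  measurable_fun setT (fun x => gs (v x) k).
Proof.
move=> mv; apply: measurable_normalize; apply: measurable_mulmx => //.
exact: measurable_resid.
Qed.

End measurable_gram_schmidt.

(** * The hard matrix for a fixed, nearly isometric [U] *)

Section chain_matrix.
Context {R : realType} (n : nat) (lay : 'I_n -> nat) (L : nat) (a eps : R) (U : 'M[R]_n)
  (k0 : 'I_n).
Context (lay_le : forall k, (lay k <= L)%N).
Context (lay_k0 : lay k0 = 0%N).
Context (U_lay : forall k l, lay k != (lay l).+1 -> U k l = 0).
Context (a_gt0 : 0 < a) (a_le1 : a <= 1).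

(** The ideal diagonal of U^T U, that is the squared column lengths; the last layer has nothing
    above it. *)
Definition coupling (l : 'I_n) : R :=
  if (lay l < L)%N then (if lay l == 0%N then a else 1) else 0.

Definition defect : 'M[R]_n := U^T *m U - diag_mx (\row_l coupling l).

(** The square of the Frobenius norm: a polynomial in the entries, so that its mean is a sum of
    moments. *)
Definition frob (M : 'M[R]_n) : R := \sum_l \sum_j M l j ^+ 2.

Context (eps_ge0 : 0 <= eps).
Context (frob_defect : frob defect <= eps ^+ 2).

Definition alternating : 'M[R]_n := diag_mx (\row_k (-1) ^+ lay k).

Definition chain_mx : 'M[R]_n := a *: alternating + (U + U^T).

Lemma frob_bound (M : 'M[R]_n) v : dot (M *m v) (M *m v) <= frob M * dot v v.
Proof.
rewrite /frob mulr_suml; apply: ler_sum => i _.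
rewrite -expr2.
have -> : (M *m v) i 0 = dot (\col_j M i j) v.
  by rewrite mxE; apply: eq_bigr => j _; rewrite mxE.
apply: le_trans (dot_cauchy _ _) _; rewrite le_eqVlt; apply/orP; left; apply/eqP.
by congr (_ * _); apply: eq_bigr => j _; rewrite mxE expr2.
Qed.

Lemma dot_defect v : dot (defect *m v) (defect *m v) <= eps ^+ 2 * dot v v.
Proof.
by apply: le_trans (frob_bound _ _) _; rewrite ler_wpM2r ?dotxx_ge0.
Qed.

Lemma ler_sqr_norm (x y : R) : 0 <= y -> x ^+ 2 <= y ^+ 2 -> `|x| <= y.
Proof.
by move=> y0 h; rewrite -(@ler_pXn2r _ 2) ?nnegrE// real_normK// num_real.
Qed.

Lemma dot_defect_self v : `|dot v (defect *m v)| <= eps * dot v v.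
Proof.
apply: ler_sqr_norm; first by rewrite mulr_ge0 ?dotxx_ge0.
apply: le_trans (dot_cauchy _ _) _.
rewrite [leRHS](_ : _ = dot v v * (eps ^+ 2 * dot v v)); last by ring.
by rewrite ler_wpM2l ?dotxx_ge0 ?dot_defect.
Qed.

Lemma gramE : U^T *m U = diag_mx (\row_l coupling l) + defect.
Proof. by rewrite /defect addrC subrK. Qed.

Lemma coupling_le1 l : coupling l <= 1.
Proof. by rewrite /coupling; do 2 case: ifP => //; rewrite ?ler01. Qed.

Lemma dot_mulU v : dot (U *m v) (U *m v) <= (1 + eps) * dot v v.
Proof.
rewrite dot_mull mulmxA gramE mulmxDl dotDr mulrDl mul1r; apply: lerD.
  apply: ler_sum => i _; rewrite mul_diag_mx !mxE mulrCA -expr2.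
  by rewrite ler_piMl ?sqr_ge0 ?coupling_le1.
by apply: le_trans (ler_norm _) _; exact: dot_defect_self.
Qed.

(** A matrix and its transpose have the same operator norm: with y = U^T v, |y|^2 = <v, U y>, and
    Cauchy-Schwarz with [dot_mulU] leaves a factor |y|^2 to cancel. *)
Lemma dot_mulUT v : dot (U^T *m v) (U^T *m v) <= (1 + eps) * dot v v.
Proof.
set y := U^T *m v.
have [y0|y0] := eqVneq (dot y y) 0.
  by rewrite y0 mulr_ge0 ?dotxx_ge0 ?addr_ge0.
have yy : 0 < dot y y by rewrite lt_def y0 dotxx_ge0.
rewrite -(ler_pM2r yy) -expr2.
have -> : dot y y = dot v (U *m y) by rewrite [in LHS]/y dot_mull trmxK.
apply: le_trans (dot_cauchy _ _) _.
rewrite [leRHS](_ : _ = dot v v * ((1 + eps) * dot y y)); last first.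
  by rewrite (_ : dot y y = dot v (U *m y)) ?[in LHS]/y ?dot_mull ?trmxK//; ring.
by rewrite ler_wpM2l ?dotxx_ge0 ?dot_mulU.
Qed.

Lemma chain_mx_tr : chain_mx^T = chain_mx.
Proof.
rewrite /chain_mx linearD/= linearZ/= tr_diag_mx linearD/= trmxK.
by rewrite [U^T + U]addrC.
Qed.

Lemma alternatingK : alternating *m alternating = 1%:M.
Proof.
rewrite /alternating mulmx_diag; apply/matrixP => i j; rewrite !mxE.
by case: eqP => // ->; rewrite -expr2 sqrr_sign.
Qed.

Lemma alternating_anti :
  alternating *m (U + U^T) = - ((U + U^T) *m alternating).
Proof.
apply/matrixP => i j; rewrite /alternating mul_diag_mx mul_mx_diag !mxE.
have [ij|ij] := eqVneq (lay i) (lay j).+1.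
  by rewrite ij exprS; ring.
rewrite (U_lay ij) add0r.
have [ji|ji] := eqVneq (lay j) (lay i).+1.
  by rewrite ji exprS; ring.
by rewrite (U_lay ji) mulr0 mul0r oppr0.
Qed.

Lemma chain_mx_sqr : chain_mx *m chain_mx =
  (a ^+ 2)%:M + (U + U^T) *m (U + U^T).
Proof.
rewrite /chain_mx; move: (U + U^T) alternating_anti => J anti.
rewrite mulmxDl !mulmxDr -!scalemxAl -!scalemxAr scalerA alternatingK anti.
by rewrite scalerN addrA addrNK scalemx1 -expr2.
Qed.

Lemma dot_chain_mx v : dot (chain_mx *m v) (chain_mx *m v) =
  a ^+ 2 * dot v v + dot ((U + U^T) *m v) ((U + U^T) *m v).
Proof.
rewrite dot_mull chain_mx_tr mulmxA chain_mx_sqr mulmxDl dotDr mul_scalar_mx dotZr.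
congr (_ + _); rewrite [RHS]dot_mull mulmxA; congr dot; congr mulmx; congr mulmx.
by rewrite linearD/= trmxK addrC.
Qed.

Lemma dot_chain_mx_ge v :
  a ^+ 2 * dot v v <= dot (chain_mx *m v) (chain_mx *m v).
Proof. by rewrite dot_chain_mx lerDl dotxx_ge0. Qed.

Lemma chain_mx_unit : chain_mx \in unitmx.
Proof.
rewrite -row_free_unit -kermx_eq0; apply/eqP/row_matrixP => i; rewrite row0.
set r := row i _; have rA : r *m chain_mx = 0.
  by apply/sub_kermxP; exact: row_sub.
have := dot_chain_mx_ge r^T.
have -> : chain_mx *m r^T = 0 by rewrite -chain_mx_tr -trmx_mul rA trmx0.
rewrite dot0l pmulr_rle0 ?exprn_gt0// => h.
have : dot r^T r^T == 0 by rewrite eq_le h dotxx_ge0.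
by rewrite dotxx_eq0 => /eqP/(congr1 trmx); rewrite trmxK trmx0.
Qed.

Context (eps_le1 : eps <= 1).

(** The 8 comes from |U v + U^T v|^2 <= 2 |U v|^2 + 2 |U^T v|^2 <= 4 (1 + eps) |v|^2 with eps <=
    1. *)
Lemma dot_chain_mx_le v :
  dot (chain_mx *m v) (chain_mx *m v) <= (a ^+ 2 + 8) * dot v v.
Proof.
rewrite dot_chain_mx mulrDl lerD2l mulmxDl.
have := dot_mulU v; have := dot_mulUT v; have := dotxx_ge0 v.
have := dotxx_ge0 (U *m v - U^T *m v).
rewrite dotBl !dotBr dotDl !dotDr (dotC (U^T *m v) (U *m v)).
have : eps * dot v v <= dot v v by rewrite ler_piMl ?dotxx_ge0.
lra.
Qed.

Lemma cond_number_chain kappa : a ^+ 2 + 8 <= kappa * a ^+ 2 -> 0 <= kappa ->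
  cond_number (chain_mx^T *m chain_mx) <= kappa.
Proof.
move=> ka k0'; have a2 : 0 < a ^+ 2 by rewrite exprn_gt0.
apply: (@cond_number_le _ _ _ (a ^+ 2) (a ^+ 2 + 8)) => //.
- by rewrite addr_ge0// ltW.
- move=> v; rewrite chain_mx_tr -mulmxA; apply: le_trans (dot_chain_mx_ge _).
  by rewrite expr2 -mulrA ler_pM2l// dot_chain_mx_ge.
- move=> v; rewrite chain_mx_tr -mulmxA; apply: le_trans (dot_chain_mx_le _) _.
  by rewrite [X in _ <= X * _]expr2 -mulrA ler_wpM2l ?addr_ge0 ?dot_chain_mx_le// ltW.
Qed.

Definition chain_vec (i : nat) : 'cV[R]_n := iter i (mulmx U) (delta_mx k0 0).

Lemma chain_vecS i : chain_vec i.+1 = U *m chain_vec i. Proof. by []. Qed.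

Lemma chain_vec_supp i k : lay k != i -> chain_vec i k 0 = 0.
Proof.
elim: i k => [|i IH] k ki.
  rewrite mxE; case: eqP => // kk; by rewrite kk lay_k0 eqxx in ki.
rewrite chain_vecS mxE big1// => l _.
have [kl|kl] := eqVneq (lay k) (lay l).+1; last by rewrite U_lay// mul0r.
by rewrite IH ?mulr0//; rewrite kl eqSS in ki.
Qed.

Lemma dot_chain_vec_neq i j : i != j -> dot (chain_vec i) (chain_vec j) = 0.
Proof.
move=> ij; apply: big1 => k _.
have [ki|ki] := eqVneq (lay k) i; last by rewrite chain_vec_supp// mul0r.
by rewrite (@chain_vec_supp j) ?mulr0// ki.
Qed.

Lemma chain_vec_gt i : (L < i)%N -> chain_vec i = 0.
Proof.
move=> Li; apply/colP => k; rewrite mxE chain_vec_supp//.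
by apply: contraTneq Li => <-; rewrite -leqNgt.
Qed.

Lemma dot_chain_vec0 : dot (chain_vec 0) (chain_vec 0) = 1.
Proof. by rewrite dot_delta mxE !eqxx. Qed.

Lemma diag_chain_vec i : (i < L)%N ->
  diag_mx (\row_l coupling l) *m chain_vec i = (if i == 0%N then a else 1) *: chain_vec i.
Proof.
move=> iL; apply/colP => k; rewrite mul_diag_mx !mxE.
have [ki|ki] := eqVneq (lay k) i; last by rewrite chain_vec_supp// !mulr0.
by rewrite /coupling ki iL.
Qed.

Lemma tr_chain_vec0 : U^T *m chain_vec 0 = 0.
Proof.
apply/colP => l; rewrite mxE big1 ?mxE// => k _; rewrite mxE.
have [->|kk] := eqVneq k k0; first by rewrite U_lay ?mul0r// lay_k0.
by rewrite mxE (negbTE kk) mulr0.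
Qed.

Lemma tr_chain_vecS i : (i < L)%N ->
  U^T *m chain_vec i.+1 = (if i == 0%N then a else 1) *: chain_vec i + defect *m chain_vec i.
Proof. by move=> iL; rewrite chain_vecS mulmxA gramE mulmxDl diag_chain_vec. Qed.

Lemma alternating_chain_vec i : alternating *m chain_vec i = (-1) ^+ i *: chain_vec i.
Proof.
apply/colP => k; rewrite mul_diag_mx !mxE.
by have [->//|ki] := eqVneq (lay k) i; rewrite chain_vec_supp// !mulr0.
Qed.

Context (eps_small : 2 * L%:R * eps <= a).

(** The step out of layer 0 brings the factor a; each later step multiplies the squared length,
    which is at most 2, by at most 1 + eps. The accumulated error 2 (i + 1) eps stays below a by
    [eps_small]. *)
Lemma dot_chain_vecS i : (i < L)%N -> dot (chain_vec i.+1) (chain_vec i.+1) <= 2 * a.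
Proof.
move=> iL; suff h : dot (chain_vec i.+1) (chain_vec i.+1) <= a + 2 * i.+1%:R * eps.
  have : 2 * i.+1%:R * eps <= a.
    by apply: le_trans eps_small; rewrite ler_wpM2r// ler_wpM2l// ler_nat.
  lra.
elim: i iL => [|i IH] iL.
  rewrite chain_vecS dot_mull mulmxA gramE mulmxDl dotDr diag_chain_vec// eqxx dotZr dot_chain_vec0.
  have := dot_defect_self (chain_vec 0); rewrite dot_chain_vec0 ler_norml => /andP[_].
  by have := eps_ge0; rewrite !mulr1; lra.
have {}IH := IH (ltnW iL).
have h2 : dot (chain_vec i.+1) (chain_vec i.+1) <= 2.
  apply: le_trans IH _; have : 2 * i.+1%:R * eps <= a.
    apply: le_trans eps_small; rewrite ler_wpM2r// ler_wpM2l// ler_nat.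
    exact: ltnW.
  by have := a_le1; lra.
rewrite chain_vecS; apply: le_trans (dot_mulU _) _.
have : eps * dot (chain_vec i.+1) (chain_vec i.+1) <= eps * 2 by rewrite ler_wpM2l.
by have := eps_ge0; rewrite -[i.+2%:R]natr1; lra.
Qed.

Lemma dot_chain_vec_le2 i : (i <= L)%N -> dot (chain_vec i) (chain_vec i) <= 2.
Proof.
case: i => [_|i iL]; first by rewrite dot_chain_vec0 ler1n.
by apply: le_trans (dot_chain_vecS iL) _; have := a_le1; lra.
Qed.

(* The coefficients solve the recurrence making [chain_mx *m test L] vanish, up
   to the defect, on all layers but the last. *)
Fixpoint coef2 (i : nat) : R * R :=
  if i is j.+1 then
    let: (p, q) := coef2 j in (q, - ((-1) ^+ i * a * q) - p)
  else (1, -1).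

Definition coef i := (coef2 i).1.

Lemma coef0 : coef 0 = 1. Proof. by []. Qed.

Lemma coef1 : coef 1 = -1. Proof. by []. Qed.

Lemma coefSS i : coef i.+2 = - ((-1) ^+ i.+1 * a * coef i.+1) - coef i.
Proof. by rewrite /coef /=; case: (coef2 i). Qed.

Lemma coef_le i : `|coef i| <= (1 + a) ^+ i.
Proof.
have a1 : 1 <= 1 + a by rewrite lerDl ltW.
suff : `|coef i| <= (1 + a) ^+ i /\ `|coef i.+1| <= (1 + a) ^+ i.+1 by case.
elim: i => [|i [IH1 IH2]].
  by rewrite coef0 coef1 normrN normr1 expr0 expr1.
split=> //; rewrite coefSS; apply: le_trans (ler_normB _ _) _.
rewrite normrN !normrM normr_sign mul1r (gtr0_norm a_gt0).
apply: le_trans (lerD (ler_wpM2l (ltW a_gt0) IH2) IH1) _.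
have e0 : 0 <= (1 + a) ^+ i by rewrite exprn_ge0// addr_ge0// ltW.
rewrite !exprS.
have := mulr_ge0 (ltW a_gt0) e0; lra.
Qed.

Definition test m := \sum_(i < m.+1) coef i *: chain_vec i.

Lemma testS m : test m.+1 = test m + coef m.+1 *: chain_vec m.+1.
Proof. by rewrite /test big_ord_recr. Qed.

Lemma test0 : test 0 = chain_vec 0.
Proof. by rewrite /test big_ord1 coef0 scale1r. Qed.

Lemma chain_mx_chain_vec0 : chain_mx *m chain_vec 0 = a *: chain_vec 0 + chain_vec 1.
Proof.
by rewrite /chain_mx !mulmxDl -scalemxAl alternating_chain_vec expr0 scale1r tr_chain_vec0 addr0.
Qed.

Lemma chain_mx_chain_vecS m : (m < L)%N -> chain_mx *m chain_vec m.+1 =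
  (a * (-1) ^+ m.+1) *: chain_vec m.+1 + chain_vec m.+2 +
  (if m == 0%N then a else 1) *: chain_vec m + defect *m chain_vec m.
Proof.
move=> mL; rewrite /chain_mx mulmxDl [(U + U^T) *m _]mulmxDl -scalemxAl alternating_chain_vec scalerA.
by rewrite tr_chain_vecS// -[U *m chain_vec m.+1]chain_vecS !addrA.
Qed.

(** The term [m.+1] cancels the component along [chain_vec m], and [coefSS] turns what is left along
    [chain_vec m.+1] into the next residue. At m = L only a multiple of [chain_vec L] and defect
    terms survive, as [chain_vec L.+1] is zero. *)
Lemma chain_mx_test m : (m <= L)%N -> chain_mx *m test m =
  - ((if m == 0%N then a else 1) * coef m.+1) *: chain_vec m + coef m *: chain_vec m.+1 +
  \sum_(i < m) coef i.+1 *: (defect *m chain_vec i).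
Proof.
elim: m => [_|m IH mL].
  by rewrite test0 chain_mx_chain_vec0 big_ord0 addr0 coef0 coef1 mulrN1 opprK scale1r.
rewrite testS mulmxDr IH; last exact: ltnW.
rewrite -scalemxAr chain_mx_chain_vecS// big_ord_recr/= mul1r coefSS.
rewrite !scalerDr !scalerA; move: (\sum_(i < m) _) => Z.
apply/colP => k; rewrite !mxE; ring.
Qed.

Lemma dot_test_chain_vec m i : (m < i)%N -> dot (test m) (chain_vec i) = 0.
Proof.
move=> mi; rewrite dot_suml big1// => j _; rewrite dotZl dot_chain_vec_neq ?mulr0//.
by rewrite neq_ltn (leq_ltn_trans _ mi)// -ltnS.
Qed.

Lemma dot_test_chain_vec0 m : dot (test m) (chain_vec 0) = 1.
Proof.
elim: m => [|m IH]; first by rewrite test0 dot_chain_vec0.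
by rewrite testS dotDl IH dotZl dot_chain_vec_neq// mulr0 addr0.
Qed.

(** By orthogonality the new term adds at most 2 a (1 + a)^(2 (m + 1)), and 1 + 2 a <= (1 + a)^2
    closes the induction. *)
Lemma dot_test m : (m <= L)%N -> dot (test m) (test m) <= (1 + a) ^+ (2 * m.+1).
Proof.
elim: m => [_|m IH mL].
  by rewrite test0 dot_chain_vec0 exprn_ege1// lerDl ltW.
have -> : dot (test m.+1) (test m.+1) =
    dot (test m) (test m) + coef m.+1 * coef m.+1 * dot (chain_vec m.+1) (chain_vec m.+1).
  have te : dot (test m) (chain_vec m.+1) = 0 by exact: dot_test_chain_vec.
  rewrite testS dotDl !dotDr !dotZl !dotZr (dotC (chain_vec m.+1)) te; ring.
have {}IH := IH (ltnW mL).
have e2 : dot (chain_vec m.+1) (chain_vec m.+1) <= 2 * a by exact: dot_chain_vecS.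
have c2 : coef m.+1 * coef m.+1 <= (1 + a) ^+ (2 * m.+1).
  rewrite -expr2 -real_normK ?num_real// mulnC exprM.
  by rewrite ler_pXn2r ?nnegrE ?coef_le// exprn_ge0// addr_ge0// ltW.
have e0 : 0 <= (1 + a) ^+ (2 * m.+1) by rewrite exprn_ge0// addr_ge0// ltW.
apply: le_trans (lerD IH (ler_pM _ _ c2 e2)) _; last 1 first.
- rewrite [(2 * m.+2)%N]mulnS exprD expr2.
  move: ((1 + a) ^+ (2 * m.+1)) e0 => y y0.
  have : 0 <= y * (a * a) by apply: mulr_ge0 => //; rewrite -expr2 sqr_ge0.
  lra.
- by rewrite -expr2 sqr_ge0.
- exact: dotxx_ge0.
Qed.

Context (eps_tiny : 32 * L.+1%:R * 2 ^+ L * eps <= a).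

Lemma chain_lower_bound (delta : R) x : 0 <= delta -> delta <= 1 -> (0 < L)%N ->
  dot (chain_mx *m x - chain_vec 0) (chain_mx *m x - chain_vec 0) <= delta ->
  dot x (chain_vec L) ^+ 2 <= eps ^+ 2 * dot x x ->
  9 / 16 <= delta * (1 + a) ^+ (2 * L.+1).
Proof.
move=> d0 d1 L0 xd xL.
set r := chain_mx *m x - chain_vec 0 in xd.
(* The residual and [chain_vec 0] have length at most 1, so |A x| <= 2; hence |x| <= X with X = 2 /
   a. *)
have x4 : a ^+ 2 * dot x x <= 4.
  apply: le_trans (dot_chain_mx_ge _) _.
  have -> : chain_mx *m x = r + chain_vec 0 by rewrite /r subrK.
  clearbody r; have := dotxx_ge0 (r - chain_vec 0).
  rewrite !dotDl !dotDr !dotNl !dotNr dot_chain_vec0 (dotC (chain_vec 0) r); lra.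
pose X := 2 / a.
have X0 : 0 < X by rewrite divr_gt0.
have xX : dot x x <= X ^+ 2.
  rewrite /X expr_div_n ler_pdivlMr ?exprn_gt0// mulrC.
  by apply: le_trans x4 _; rewrite expr2 -natrM.
have a2 : 1 + a <= 2 by have := a_le1; lra.
have c2 i : (i <= L.+1)%N -> `|coef i| <= 2 ^+ L.+1.
  move=> iL; apply: le_trans (coef_le _) _.
  have a1 : 1 <= 1 + a by rewrite lerDl ltW.
  apply: (@le_trans _ _ ((1 + a) ^+ L.+1)); first by rewrite ler_weXn2l.
  by rewrite lerXn2r ?nnegrE// addr_ge0// ltW.
have eL : `|dot x (chain_vec L)| <= eps * X.
  apply: ler_sqr_norm; first by rewrite mulr_ge0// ltW.
  by apply: le_trans xL _; rewrite exprMn ler_wpM2l ?sqr_ge0.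
have eD i : (i < L)%N -> `|dot x (defect *m chain_vec i)| <= 2 * (eps * X).
  move=> iL; apply: ler_sqr_norm; first by rewrite mulr_ge0// mulr_ge0// ltW.
  apply: le_trans (dot_cauchy _ _) _.
  have h1 := dot_defect (chain_vec i).
  have h2 : eps ^+ 2 * dot (chain_vec i) (chain_vec i) <= eps ^+ 2 * 2.
    by rewrite ler_wpM2l ?sqr_ge0 ?dot_chain_vec_le2// ltnW.
  apply: le_trans (ler_pM (dotxx_ge0 _) (dotxx_ge0 _) xX (le_trans h1 h2)) _.
  have := mulr_ge0 (sqr_ge0 eps) (sqr_ge0 X); lra.
(* The errors add up to at most 2^(L + 1) (2 L + 1) eps X, and [eps_tiny] reads 32 (L + 1) 2^L eps X
   <= 2, so the total is at most 1/4. *)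
have small : `|dot x (chain_mx *m test L)| <= 2^-1 ^+ 2.
  rewrite chain_mx_test// (@chain_vec_gt L.+1)// scaler0 addr0 gtn_eqF// mul1r dotDr dotZr.
  rewrite dot_sumr; apply: le_trans (ler_normD _ _) _.
  rewrite normrM normrN.
  have h1 : `|coef L.+1| * `|dot x (chain_vec L)| <= 2 ^+ L.+1 * (eps * X).
    by apply: ler_pM => //; exact: c2.
  have h2 : `|\sum_(i < L) dot x (coef i.+1 *: (defect *m chain_vec i))| <=
      L%:R * (2 ^+ L.+1 * (2 * (eps * X))).
    apply: le_trans (ler_norm_sum _ _ _) _.
    rewrite mulr_natl -[X in _ *+ X]card_ord -sumr_const; apply: ler_sum => i _.
    by rewrite dotZr normrM; apply: ler_pM => //; [exact: c2 (leqW (ltn_ord i))|exact: eD (ltn_ord i)].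
  apply: le_trans (lerD h1 h2) _.
  have eX : 32 * L.+1%:R * 2 ^+ L * (eps * X) <= 2.
    have aX : a * X = 2 by rewrite /X mulrCA divff ?mulr1// gt_eqF.
    by rewrite mulrA -[leRHS]aX; apply: ler_wpM2r => //; exact: ltW.
  have p0 : 0 <= 2 ^+ L * (eps * X) by rewrite mulr_ge0 ?exprn_ge0// mulr_ge0// ltW.
  move: eX p0; rewrite exprS -[L.+1%:R]natr1; move: (2 ^+ L) (eps * X) (L%:R : R) => P Y l.
  rewrite expr2; lra.
(* By symmetry of the matrix, <q, A x - b> = <x, A q> - 1 with q = [test L]; the error 1/4 leaves
   3/4, whose square is the constant 9/16. *)
have tr : 3 / 4 <= `|dot (test L) r|.
  have -> : dot (test L) r = dot x (chain_mx *m test L) - 1.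
    by rewrite /r dotBr dot_test_chain_vec0 dot_mulr chain_mx_tr dotC.
  rewrite distrC; apply: le_trans (lerB_dist _ _); rewrite normr1.
  by move: small; rewrite expr2; lra.
have : dot (test L) r ^+ 2 <= (1 + a) ^+ (2 * L.+1) * delta.
  apply: le_trans (dot_cauchy _ _) _.
  by apply: ler_pM => //; [exact: dotxx_ge0|exact: dotxx_ge0|exact: dot_test].
rewrite mulrC; apply: le_trans.
rewrite -real_normK ?num_real//.
have -> : 9 / 16 = (3 / 4) ^+ 2 :> R by field.
by rewrite ler_pXn2r ?nnegrE.
Qed.

End chain_matrix.

(** * Markov's inequality *)

Section markov.
Context d (T : measurableType d) (R : realType) (mu : {measure set T -> \bar R}).

Lemma markov_EFin (A : set T) (f : T -> R) (c : R) :
  measurable A -> measurable_fun setT f -> (forall x, 0 <= f x) -> 0 <= c ->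
  (forall x, A x -> c <= f x) -> (c%:E * mu A <= \int[mu]_x (f x)%:E)%E.
Proof.
move=> mA mf f0 c0 cf; rewrite -integral_cst//.
apply: (@le_trans _ _ (\int[mu]_(x in A) (f x)%:E)%E).
  by apply: ge0_le_integral => //; apply/measurable_EFinP; exact: measurable_funTS.
apply: ge0_subset_integral => //; first exact/measurable_EFinP.
by move=> x _; rewrite lee_fin.
Qed.

End markov.

(** * Layer sizes, weights and the near isometry of [U] *)

Section layered_weights.
Context {R : realType} (n : nat) (lay : 'I_n -> nat) (L K : nat) (a eps : R).
Local Notation gauss_var := (@gauss_var R).
Context (lay_le : forall k, (lay k <= L)%N) (a_gt0 : 0 < a) (a_le1 : a <= 1).

Definition layer_size i := #|[pred k | lay k == i]|.

Context (size_gt0 : forall i, (i <= L)%N -> (0 < layer_size i)%N)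
  (K_gt0 : (0 < K)%N)
  (size_growth : forall i, (i < L)%N ->
    (K * layer_size i ^ 2 <= layer_size i.+1)%N).

(** The standard scaling that gives the columns of U their ideal mean squared length. The index is
    the target layer, so the factor a of layer 0 appears at [i = 1]. *)
Definition layer_weight i : R :=
  Num.sqrt ((if i == 1%N then a else 1) / (gauss_var * (layer_size i)%:R)).

Definition weight : 'M[R]_n :=
  \matrix_(k, l) if lay k == (lay l).+1 then layer_weight (lay k) else 0.

Lemma layer_weight_sqr i :
  layer_weight i ^+ 2 = (if i == 1%N then a else 1) / (gauss_var * (layer_size i)%:R).
Proof.
rewrite sqr_sqrtr// divr_ge0//; first by case: ifP; rewrite // ltW.
by rewrite mulr_ge0// ltW// gauss_var_gt0.
Qed.

Lemma layer_weight_le i : layer_weight i ^+ 2 <= (gauss_var * (layer_size i)%:R)^-1.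
Proof.
rewrite layer_weight_sqr ler_piMl//; last by case: ifP.
by rewrite invr_ge0 mulr_ge0// ltW// gauss_var_gt0.
Qed.

Lemma sum_layer (F : nat -> R) :
  \sum_k F (lay k) = \sum_(i < L.+1) (layer_size i)%:R * F i.
Proof.
rewrite (partition_big (fun k => Ordinal (lay_le k : (lay k < L.+1)%N)) xpredT)//=.
apply: eq_bigr => i _.
rewrite (eq_bigr (fun _ => F i)) => [|k /eqP <-//].
by rewrite sumr_const mulr_natl; congr (_ *+ _); rewrite /layer_size -!sum1_card.
Qed.

Lemma sum_layer_eq i (x : R) :
  \sum_k (if lay k == i then x else 0) = (layer_size i)%:R * x.
Proof.
by rewrite -big_mkcond/= sumr_const mulr_natl.
Qed.

Lemma sum_weight_col l : gauss_var * \sum_k weight k l ^+ 2 = coupling lay L a l.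
Proof.
transitivity (gauss_var * \sum_k (if lay k == (lay l).+1 then layer_weight (lay l).+1 ^+ 2 else 0)).
  congr (_ * _); apply: eq_bigr => k _; rewrite mxE.
  by case: eqP => [->//|_]; rewrite expr0n.
rewrite sum_layer_eq layer_weight_sqr /coupling eqSS.
have [lL|lL] := ltnP (lay l) L; last first.
  rewrite (_ : layer_size _ = 0%N) ?mul0r ?mulr0//; apply: eq_card0 => k; rewrite !inE; apply/negbTE.
  by rewrite neq_ltn ltnS (leq_trans (lay_le k) lL).
have s0 : (layer_size (lay l).+1)%:R != 0 :> R by rewrite pnatr_eq0 -lt0n size_gt0.
have g0 : gauss_var != 0 :> R by rewrite gt_eqF// gauss_var_gt0.
by case: ifP => _; field; rewrite s0 g0.
Qed.

Lemma sum_weight_rowE k : \sum_l weight k l ^+ 2 =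
  if lay k is i.+1 then (layer_size i)%:R * layer_weight i.+1 ^+ 2 else 0.
Proof.
under eq_bigr do rewrite mxE.
case: (lay k) => [|i]; first by rewrite big1// => l _; rewrite expr0n.
rewrite -sum_layer_eq; apply: eq_bigr => l _.
by rewrite eqSS eq_sym; case: ifP => //; rewrite expr0n.
Qed.

(** With N_i the layer sizes, the rows in layer i + 1 contribute at most N_(i+1) (N_i / N_(i+1))^2 =
    N_i^2 / N_(i+1) <= 1 / K; the quadratic growth of the sizes is tailored to this. *)
Lemma sum_weight_sqr :
  gauss_var ^+ 2 * \sum_k (\sum_l weight k l ^+ 2) ^+ 2 <= L%:R / K%:R.
Proof.
have g0 := @gauss_var_gt0 R.
under eq_bigr do rewrite sum_weight_rowE.
rewrite (sum_layer (fun j => (if j is i.+1 then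
   (layer_size i)%:R * layer_weight i.+1 ^+ 2 else 0) ^+ 2)).
rewrite big_ord_recl/= expr0n mulr0 add0r mulr_sumr.
rewrite [leRHS](_ : _ = \sum_(i < L) (K%:R : R)^-1); last first.
  by rewrite sumr_const card_ord mulr_natl.
apply: ler_sum => i _; rewrite /bump leq0n add1n.
have iL := ltn_ord i.
have s0 : 0 < (layer_size i)%:R :> R by rewrite ltr0n size_gt0// ltnW.
have s1 : 0 < (layer_size i.+1)%:R :> R by rewrite ltr0n size_gt0.
have k0 : 0 < K%:R :> R by rewrite ltr0n.
have gr : K%:R * (layer_size i)%:R ^+ 2 <= (layer_size i.+1)%:R :> R.
  by rewrite -natrX -natrM ler_nat size_growth.
have := layer_weight_le i.+1.
move: (layer_weight i.+1 ^+ 2) (sqr_ge0 (layer_weight i.+1)) => W W0 hW.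
move: (layer_size i)%:R (layer_size i.+1)%:R s0 s1 gr hW => x y x0 y0 gr hW.
have W2 : W ^+ 2 <= (gauss_var * y)^-1 ^+ 2.
  by rewrite ler_pXn2r// nnegrE invr_ge0 mulr_ge0// ltW.
apply: (@le_trans _ _ (gauss_var ^+ 2 * (y * (x ^+ 2 * (gauss_var * y)^-1 ^+ 2)))).
  rewrite ler_wpM2l ?sqr_ge0// ler_wpM2l ?(ltW y0)// exprMn.
  by rewrite ler_wpM2l ?sqr_ge0.
have -> : gauss_var ^+ 2 * (y * (x ^+ 2 * (gauss_var * y)^-1 ^+ 2)) = x ^+ 2 / y.
  by field; rewrite !gt_eqF.
by rewrite ler_pdivrMr// ler_pdivlMl.
Qed.

Definition raise g := weighted weight g.

Lemma raise_lay g k l : lay k != (lay l).+1 -> raise g k l = 0.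
Proof. by move=> kl; rewrite !mxE (negbTE kl) mul0r. Qed.

Lemma defectE g l j : defect lay L a (raise g) l j = gram_error weight g l j.
Proof.
rewrite /gram_error /defect /raise; rewrite [LHS]mxE; congr (_ + _).
rewrite [LHS]mxE; congr (- _); rewrite [RHS](_ : _ = (l == j)%:R * coupling lay L a l); last by rewrite sum_weight_col.
by rewrite !mxE; case: eqP => _; rewrite ?mulr1n ?mul1r ?mulr0n ?mul0r.
Qed.

Definition frob_err g := frob (defect lay L a (raise g)).

Lemma frob_errE g : frob_err g = \sum_l \sum_j gram_error weight g l j ^+ 2.
Proof. by do 2 apply: eq_bigr => ? _; rewrite defectE. Qed.

Lemma measurable_frob_err : measurable_fun setT frob_err.
Proof.
rewrite (_ : frob_err = fun g => \sum_l \sum_j gram_error weight g l j ^+ 2); last first.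
  by apply/funext => g; exact: frob_errE.
apply: measurable_sum => l; apply: measurable_sum => j.
by apply: measurable_funX; exact: measurable_gram_error.
Qed.

Definition good : set 'cV[R]_(n * n) := [set g | frob_err g <= eps ^+ 2].

Lemma measurable_good : measurable good.
Proof.
rewrite -[good]setTI; apply: measurable_fun_le => //.
  exact: measurable_frob_err.
Qed.

(** The mean error is at most 5 L / K, with 5 from the Gram concentration; the condition on K makes
    this at most half the threshold eps^2. *)
Lemma prob_good : (1 < n)%N -> 0 < eps -> 10 * L%:R <= eps ^+ 2 * K%:R ->
  (2^-1%:E <= gauss (n * n) good)%E.
Proof.
move=> n1 e0 LK.
have e2 : 0 < eps ^+ 2 by rewrite exprn_gt0.
have I : (\int[gauss (n * n)]_g (frob_err g)%:E <= (eps ^+ 2 / 2)%:E)%E.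
  under eq_integral do rewrite frob_errE.
  apply: le_trans (gram_concentration _ n1) _; rewrite lee_fin -mulrA.
  apply: le_trans (ler_wpM2l _ sum_weight_sqr) _ => //.
  rewrite mulrA ler_pdivrMr ?ltr0n//; lra.
have mC : measurable (~` good) by apply: measurableC; exact: measurable_good.
have bad : (gauss (n * n) (~` good) <= 2^-1%:E)%E.
  rewrite -(@lee_pmul2l _ (eps ^+ 2)%:E)// ?lte_fin// -EFinM.
  apply: le_trans I; apply: markov_EFin => //.
  - exact: measurable_frob_err.
  - by move=> g; do 2 apply: sumr_ge0 => ? _; exact: sqr_ge0.
  - exact: ltW.
  - by move=> g /negP; rewrite -ltNge => /ltW.
rewrite -[good]setCK probability_setC//.
rewrite leeBrDr ?fin_num_measure//; apply: le_trans (leeD2l _ bad) _.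
by rewrite -EFinD lee_fin; lra.
Qed.

End layered_weights.

(** * Rank-one directions in matrix space and projections on layers *)

Section outer_products.
Context {R : realType} (n : nat).
Implicit Types x y u z : 'cV[R]_n.

Definition outer x y : 'M[R]_n := x *m y^T.

Lemma outerE_entry x y k l : outer x y k l = x k 0 * y l 0.
Proof. by rewrite mxE big_ord1 [X in _ * X]mxE. Qed.

Lemma dot_vecm_outer x y g : dot (vecm (outer x y)) g = dot x (mat g *m y).
Proof.
rewrite dot_vecm; apply: eq_bigr => k _; rewrite [in RHS]mxE mulr_sumr.
by apply: eq_bigr => l _; rewrite outerE_entry; ring.
Qed.

Lemma dot_outer x y u z :
  dot (vecm (outer x y)) (vecm (outer u z)) = dot x u * dot y z.
Proof.
rewrite dot_vecm2 /dot mulr_suml; apply: eq_bigr => k _.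
by rewrite mulr_sumr; apply: eq_bigr => l _; rewrite !outerE_entry; ring.
Qed.

Lemma dot_outer_delta k l g :
  dot (vecm (outer (delta_mx k 0) (delta_mx l 0))) g = mat g k l.
Proof.
by rewrite dot_vecm_outer dot_delta -colE mxE.
Qed.

End outer_products.

Section layer_projection.
Context {R : realType} (n : nat) (lay : 'I_n -> nat).

Definition lproj i (x : 'cV[R]_n) : 'cV[R]_n :=
  \col_k (if lay k == i then x k 0 else 0).

Lemma lproj_out i x k : lay k != i -> lproj i x k 0 = 0.
Proof. by move=> ki; rewrite mxE (negbTE ki). Qed.

Lemma dot_lproj_le i x : dot (lproj i x) (lproj i x) <= dot x x.
Proof.
apply: ler_sum => k _; rewrite !mxE; case: ifP => // _.
by rewrite mulr0 -expr2 sqr_ge0.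
Qed.

Lemma dot_lproj i (x z : 'cV[R]_n) : (forall k, lay k != i -> z k 0 = 0) ->
  dot (lproj i x) z = dot x z.
Proof.
move=> zi; apply: eq_bigr => k _; rewrite mxE.
by case: eqP => // /eqP ki; rewrite zi// !mulr0.
Qed.

Lemma measurable_lproj d (T : measurableType d) i (f : T -> 'cV[R]_n) :
  measurable_fun setT f -> measurable_fun setT (fun x => lproj i (f x)).
Proof.
move=> mf; apply/measurable_fun_cVP => k; under eq_fun do rewrite mxE.
by case: eqP => _; [exact: measurable_coord|exact: measurable_cst].
Qed.

End layer_projection.

(** * What adaptive products reveal about the hidden vectors *)

Section hidden_chain.
Context {R : realType} (n : nat) (lay : 'I_n -> nat) (L K : nat) (a eps : R)
  (k0 : 'I_n).
Local Notation gauss_var := (@gauss_var R).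
Context (lay_le : forall k, (lay k <= L)%N) (a_gt0 : 0 < a) (a_le1 : a <= 1)
  (size_gt0 : forall i, (i <= L)%N -> (0 < layer_size lay i)%N)
  (K_gt0 : (0 < K)%N)
  (size_growth : forall i, (i < L)%N ->
    (K * layer_size lay i ^ 2 <= layer_size lay i.+1)%N)
  (lay_k0 : lay k0 = 0%N)
  (eps_ge0 : 0 <= eps) (eps_le1 : eps <= 1) (eps_small : 2 * L%:R * eps <= a).
Local Notation U g := (raise lay a g).
Local Notation A g := (chain_mx lay a (U g)).
Local Notation eta_ g i := (chain_vec (U g) k0 i).
Local Notation lw := (layer_weight lay a).
Local Notation good := (good lay L a eps).

Context (v : 'cV[R]_(n * n) -> nat -> 'cV[R]_n)
  (v_det : forall r g g',
    (forall j, (j < r)%N -> v g j = v g' j /\ A g *m v g j = A g' *m v g' j) ->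
    v g r = v g' r)
  (mv : forall r, measurable_fun setT (v ^~ r)).

Let Ulay g k l : lay k != (lay l).+1 -> U g k l = 0.
Proof. exact: raise_lay. Qed.

Let UE g k l : U g k l = weight lay a k l * mat g k l.
Proof. by rewrite mxE. Qed.

Let supp_chain_vec g i k : lay k != i -> eta_ g i k 0 = 0.
Proof. exact: (chain_vec_supp lay_k0 (Ulay g)). Qed.

Definition frame g i s := gs (fun r => lproj lay i (v g r)) s.

(** Being orthogonal to the layer-[i] parts of the first [s] vectors, this component is one on which
    their products with the next block are silent. *)
Definition hidden g i s := resid (fun r => lproj lay i (v g r)) s *m eta_ g i.

(* The squared length of the projection of the hidden vector of layer [i] onto
   the span of the layer-[i] parts of the first [i] vectors. *)
Definition leak g i := \sum_(s < i) dot (frame g i s) (eta_ g i) ^+ 2.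

Lemma frame_supp g i s k : lay k != i -> frame g i s k 0 = 0.
Proof. by move=> ki; apply: gs_support => r; exact: lproj_out. Qed.

Lemma hidden_supp g i s k : lay k != i -> hidden g i s k 0 = 0.
Proof.
move=> ki; apply: resid_support; last exact: supp_chain_vec.
by move=> r; exact: lproj_out.
Qed.

Lemma dot_block g i (u z : 'cV[R]_n) : (forall k, lay k != i.+1 -> u k 0 = 0) ->
  (forall l, lay l != i -> z l 0 = 0) ->
  dot u (U g *m z) = lw i.+1 * dot u (mat g *m z).
Proof.
move=> ui zi; rewrite /dot mulr_sumr; apply: eq_bigr => k _.
have [ki|ki] := eqVneq (lay k) i.+1; last by rewrite ui// !mul0r mulr0.
rewrite mulrCA; congr (_ * _); rewrite !mxE mulr_sumr; apply: eq_bigr => l _.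
have [li|li] := eqVneq (lay l) i; last by rewrite zi// !mulr0.
by rewrite !mxE ki li eqxx mulrA.
Qed.

Let measurable_U k l : measurable_fun setT (fun g => U g k l).
Proof. exact: measurable_weighted. Qed.

Lemma measurable_chain_vec i : measurable_fun setT (fun g => eta_ g i).
Proof.
elim: i => [|i IH]; first exact: measurable_cst.
exact: measurable_mulmx.
Qed.

Lemma measurable_frame i s : measurable_fun setT (fun g => frame g i s).
Proof.
apply: (measurable_gs (v := fun g r => lproj lay i (v g r))) => r.
exact: measurable_lproj.
Qed.

Lemma measurable_hidden i s : measurable_fun setT (fun g => hidden g i s).
Proof.
apply: measurable_mulmx; last exact: measurable_chain_vec.
apply: (measurable_resid (v := fun g r => lproj lay i (v g r))) => r.
exact: measurable_lproj.
Qed.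

Lemma measurable_leak i : measurable_fun setT (fun g => leak g i).
Proof.
apply: measurable_sum => s; apply: measurable_funX.
by apply: measurable_dot; [exact: measurable_frame|exact: measurable_chain_vec].
Qed.

Lemma leak_ge0 g i : 0 <= leak g i.
Proof. by apply: sumr_ge0 => s _; exact: sqr_ge0. Qed.

(** A stand-in for [good] that is determined by the measurements, whereas [good] depends on the
    unrevealed block. For [i] at most [L], it follows from [good]. *)
Let short : nat -> set 'cV[R]_(n * n) :=
  fun i => [set g | dot (eta_ g i) (eta_ g i) <= 2].

(** The projection of [g] on it is, when the hidden vector is short, the component along
    [frame g i.+1 s] of the image of [hidden g i s]. The indicator caps its length. *)
Let direction i s g : 'cV[R]_(n * n) :=
  (lw i.+1 * \1_(short i) g) *: vecm (outer (frame g i.+1 s) (hidden g i s)).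

(** The shift by one leaves round 0 with the entries outside the block alone; the rounds before [j]
    then determine the vectors of index less than [j]. *)
Let prev g j := if j is j'.+1 then v g j' else 0.

(* The measurements granted to the algorithm before round [j]: all entries of
   [mat g] outside the block joining layers [i] and [i.+1], and the products of
   that block and of its transpose with the previous matrix-vector queries. *)
Let probe i j (t : ('I_n * 'I_n) + ('I_n + 'I_n)) g : 'cV[R]_(n * n) :=
  match t with
  | inl (k, l) =>
      if (lay k == i.+1) && (lay l == i) then 0
      else vecm (outer (delta_mx k 0) (delta_mx l 0))
  | inr (inl k) => vecm (outer (delta_mx k 0) (lproj lay i (prev g j)))
  | inr (inr l) => vecm (outer (lproj lay i.+1 (prev g j)) (delta_mx l 0))
  end.

Let agree i j g g' := forall r t, (r < j)%N ->
  dot (probe i r t g) g = dot (probe i r t g') g'.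

Let agree_entry i j g g' k l : (0 < j)%N -> agree i j g g' ->
  ~~ ((lay k == i.+1) && (lay l == i)) -> mat g k l = mat g' k l.
Proof.
move=> j0 /(_ 0%N (inl (k, l)) j0) /=; case: ifP => // _ + _.
by rewrite !dot_outer_delta.
Qed.

Let agree_right i j g g' r : (r.+1 < j)%N -> agree i j g g' ->
  mat g *m lproj lay i (v g r) = mat g' *m lproj lay i (v g' r).
Proof.
move=> rj ag; apply/colP => k; have := ag r.+1 (inr (inl k)) rj.
by rewrite /= !dot_vecm_outer !dot_delta.
Qed.

Let agree_left i j g g' r : (r.+1 < j)%N -> agree i j g g' ->
  (mat g)^T *m lproj lay i.+1 (v g r) = (mat g')^T *m lproj lay i.+1 (v g' r).
Proof.
move=> rj ag; apply/colP => l; have := ag r.+1 (inr (inr l)) rj.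
rewrite /= !dot_vecm_outer !dot_mulr ![dot (_ *m _) _]dotC.
by rewrite !dot_delta.
Qed.

(** The unknown block enters the rows of layer [i.+1] through its product with the layer-[i] part,
    and the rows of layer [i] through the product of its transpose with the layer-[i.+1] part. Both
    are measured, and all other rows involve known entries. *)
Let agree_chain i j g g' r : (r.+1 < j)%N -> agree i j g g' ->
  v g r = v g' r -> A g *m v g r = A g' *m v g' r.
Proof.
move=> rj ag vE; have j0 : (0 < j)%N by exact: leq_trans rj.
rewrite /chain_mx !mulmxDl vE; congr (_ + (_ + _)).
- apply/colP => k; rewrite [LHS]mxE [RHS]mxE.
  have [ki|ki] := eqVneq (lay k) i.+1; last first.
    by apply: eq_bigr => l _; rewrite !UE (agree_entry (l := l) j0 ag)// (negbTE ki).
  have := congr1 (fun x : 'cV_n => x k 0) (agree_right rj ag).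
  rewrite vE [X in X = _]mxE [X in _ = X]mxE => /(congr1 (fun x => lw i.+1 * x)); rewrite !mulr_sumr.
  have E h : \sum_l lw i.+1 * (mat h k l * lproj lay i (v g' r) l 0) =
             \sum_l U h k l * v g' r l 0.
    apply: eq_bigr => l _; rewrite [lproj _ _ _ _ _]mxE UE [weight _ _ _ _]mxE ki eqSS eq_sym.
    by case: eqP => _; rewrite ?mulrA// !(mulr0, mul0r).
  by rewrite !E.
- apply/colP => l; rewrite [LHS]mxE [RHS]mxE.
  have [li|li] := eqVneq (lay l) i; last first.
    by apply: eq_bigr => k _; rewrite [(U g)^T l k]mxE [(U g')^T l k]mxE !UE (agree_entry (k := k) j0 ag)// (negbTE li) andbF.
  have := congr1 (fun x : 'cV_n => x l 0) (agree_left rj ag).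
  rewrite vE [X in X = _]mxE [X in _ = X]mxE => /(congr1 (fun x => lw i.+1 * x)); rewrite !mulr_sumr.
  have E h : \sum_k lw i.+1 * ((mat h)^T l k * lproj lay i.+1 (v g' r) k 0) =
             \sum_k (U h)^T l k * v g' r k 0.
    apply: eq_bigr => k _; rewrite [lproj _ _ _ _ _]mxE [(mat h)^T l k]mxE.
    rewrite [(U h)^T l k]mxE UE [weight _ _ _ _]mxE li.
    by case: eqP => [->|_]; rewrite ?mulrA// !(mulr0, mul0r).
  by rewrite !E.
Qed.

Let agree_v i j g g' : agree i j g g' -> forall r, (r < j)%N -> v g r = v g' r.
Proof.
move=> ag; elim/ltn_ind => r IH rj; apply: v_det => q qr.
have qj : (q.+1 < j)%N by exact: leq_ltn_trans rj.
have vE : v g q = v g' q by apply: IH => //; exact: ltnW.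
by split=> //; apply: (agree_chain qj ag).
Qed.

(** The hidden vector of layer [i] is built from the blocks below the unknown one, whose entries
    round 0 already reveals. *)
Let agree_chain_vec i j g g' : (0 < j)%N -> agree i j g g' -> eta_ g i = eta_ g' i.
Proof.
move=> j0 ag; suff H : forall m, (m <= i)%N -> eta_ g m = eta_ g' m by exact: H.
elim=> [//|m IH] mi; rewrite !chain_vecS IH; last exact: ltnW.
apply/colP => k.
rewrite [LHS]mxE [RHS]mxE; apply: eq_bigr => l _; rewrite !UE [weight _ _ _ _]mxE.
have [km|km] := eqVneq (lay k) (lay l).+1; last by rewrite !mul0r.
have [lm|lm] := eqVneq (lay l) m; last by rewrite supp_chain_vec// !mulr0.
rewrite (agree_entry (k := k) (l := l) j0 ag)// km lm negb_and eqSS.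
by rewrite neq_ltn mi.
Qed.

Let agree_direction i s g g' : agree i s.+1 g g' -> direction i s g = direction i s g'.
Proof.
move=> ag; have eE := agree_chain_vec (ltn0Sn s) ag; have vE := agree_v ag.
have E m r : (r <= s)%N -> lproj lay m (v g r) = lproj lay m (v g' r).
  by move=> rs; rewrite vE.
congr (_ *: vecm (outer _ _)).
- congr (_ * _); rewrite !indicE; congr (nat_of_bool _)%:R.
  by apply/idP/idP; rewrite !in_setE /short/= eE.
- by apply: gs_prefix => r; exact: E.
- rewrite /hidden eE; congr (_ *m _); apply: resid_prefix => r rs.
  by apply: E; exact: ltnW.
Qed.

Let agree_probe i s j g g' t : (j < s.+1)%N -> agree i j g g' ->
  probe i j t g = probe i j t g'.
Proof.
move=> _; case: j => [|j] ag; first by case: t => [[k l]|[]].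
have vE : v g j = v g' j by exact: (agree_v ag).
by case: t => [[k l]|[k|l]] //=; rewrite vE.
Qed.

(** Entry probes live outside the block carrying the direction. A product with a vector of index
    less than [s] is orthogonal to it through the factor [hidden], and a product of the transpose
    through the factor [frame]. *)
Let probe_direction i s j t g : (j < s.+1)%N -> dot (probe i j t g) (direction i s g) = 0.
Proof.
move=> js; rewrite /direction dotZr.
case: t => [[k l]|[k|l]] /=.
- case: ifPn => [_|]; first by rewrite dot0l mulr0.
  rewrite negb_and => kl; rewrite dot_outer !dot_delta.
  case/orP: kl => h; first by rewrite frame_supp// mul0r mulr0.
  by rewrite hidden_supp// !mulr0.
- rewrite dot_outer; case: j js => [|j] js /=.
    by rewrite (_ : lproj lay i 0 = 0) ?dot0l ?mulr0//; apply/colP => l; rewrite !mxE if_same.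
  by rewrite (@dot_resid_vec _ _ (fun r => lproj lay i (v g r)))// !mulr0.
- rewrite dot_outer; case: j js => [|j] js /=.
    by rewrite (_ : lproj lay i.+1 0 = 0) ?dot0l ?mul0r ?mulr0//; apply/colP => k; rewrite !mxE if_same.
  by rewrite (@dot_gs_vec _ _ (fun r => lproj lay i.+1 (v g r)))// mul0r mulr0.
Qed.

Let measurable_short i : measurable (short i).
Proof.
rewrite -[short i]setTI; apply: measurable_fun_le => //.
by apply: measurable_dot; exact: measurable_chain_vec.
Qed.

Let measurable_direction i s : measurable_fun setT (direction i s).
Proof.
apply: measurable_scalev.
  by apply: measurable_funM; [exact: measurable_cst|exact: measurable_indic].
apply: measurable_vecm => k l; under eq_fun do rewrite outerE_entry.
by apply: measurable_funM; apply: measurable_coord;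
  [exact: measurable_frame|exact: measurable_hidden].
Qed.

Lemma direction_dot i s g : dot (direction i s g) g =
  \1_(short i) g * dot (frame g i.+1 s) (U g *m hidden g i s).
Proof.
rewrite dotZl dot_vecm_outer (@dot_block g i); first by ring.
  by move=> k; exact: frame_supp.
by move=> l; exact: hidden_supp.
Qed.

Lemma dot_hidden_le g i s :
  dot (hidden g i s) (hidden g i s) <= dot (eta_ g i) (eta_ g i).
Proof.
set w := fun r => lproj lay i (v g r).
have := sum_gs w s (eta_ g i).
rewrite dotBr => E.
have -> : dot (hidden g i s) (hidden g i s) = dot (eta_ g i) (resid w s *m eta_ g i).
  by rewrite /hidden dot_mull resid_tr mulmxA (proj1 (resid_idem w s)).
have : 0 <= \sum_(r < s) dot (gs w r) (eta_ g i) ^+ 2.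
  by apply: sumr_ge0 => r _; exact: sqr_ge0.
by rewrite E; lra.
Qed.

(** The predictable variance reduces this to the mean squared length of the direction: [frame] has
    length at most 1, the capped hidden part squared length at most 2, and the squared weight
    contributes the inverse of a layer size that is at least K. *)
Lemma direction_norm i s : (i < L)%N ->
  (\int[gauss (n * n)]_g (dot (direction i s g) g ^+ 2)%:E <= (2 / K%:R)%:E)%E.
Proof.
move=> iL.
rewrite (@gauss_predictable_variance_block _ _ s.+1 _ (fun j t g => probe i j t g))//.
- apply: (@le_trans _ _ (gauss_var%:E * (2 * (gauss_var * (layer_size lay i.+1)%:R)^-1)%:E)%E).
    apply: lee_wpmul2l; first by rewrite lee_fin ltW// gauss_var_gt0.
    apply: (@le_trans _ _ (\int[gauss (n * n)]_g
      (2 * (gauss_var * (layer_size lay i.+1)%:R)^-1)%:E)%E); last first.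
      rewrite integral_cst//= -[leRHS]mule1; apply: lee_wpmul2l => //.
        by rewrite lee_fin mulr_ge0// invr_ge0 mulr_ge0// ltW// gauss_var_gt0.
      by rewrite (probability_setT (gauss (n * n))).
    apply: ge0_le_integral_EFin => //.
    - by apply: measurable_dot.
    - by move=> g; exact: dotxx_ge0.
    move=> g; rewrite dotZl dotZr dot_outer mulrA -expr2 exprMn.
    have f1 : dot (frame g i.+1 s) (frame g i.+1 s) <= 1 by exact: dot_normalize_le1.
    have h1 : \1_(short i) g ^+ 2 * dot (hidden g i s) (hidden g i s) <= 2.
      rewrite indicE; case: (boolP (g \in short i)) => [|_]; last by rewrite expr0n mul0r.
      by rewrite inE expr1n mul1r => /=; apply: le_trans; exact: dot_hidden_le.
    have w1 := layer_weight_le lay a_gt0 a_le1 i.+1.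
    have w0 := sqr_ge0 (lw i.+1).
    have f0 := dotxx_ge0 (frame g i.+1 s).
    have h0 : 0 <= \1_(short i) g ^+ 2 * dot (hidden g i s) (hidden g i s).
      by rewrite mulr_ge0 ?sqr_ge0 ?dotxx_ge0.
    rewrite [leLHS](_ : _ = lw i.+1 ^+ 2 * dot (frame g i.+1 s) (frame g i.+1 s) *
      (\1_(short i) g ^+ 2 * dot (hidden g i s) (hidden g i s))); last by ring.
    rewrite [leRHS]mulrC; apply: ler_pM => //; first exact: mulr_ge0.
    by rewrite -[leRHS]mulr1; apply: ler_pM.
  rewrite -EFinM lee_fin.
  have s1 : 0 < (layer_size lay i.+1)%:R :> R by rewrite ltr0n size_gt0.
  have E (y : R) : 0 < y -> gauss_var * (2 * (gauss_var * y)^-1) = 2 / y.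
    by move=> y0; field; rewrite !gt_eqF// gauss_var_gt0.
  rewrite E//.
  rewrite ler_wpM2l// lef_pV2 ?posrE ?ltr0n ?size_gt0//.
  rewrite ler_nat; apply: leq_trans (size_growth iL).
  by rewrite -{1}[K]muln1 leq_mul2l expn_gt0 size_gt0 ?orbT// ltnW.
- move=> j g g' js ag t; exact: (@agree_probe i s j g g' t js (fun r t' rj => ag r t' rj)).
- by move=> g g' ag; apply: agree_direction => r t rj; exact: ag.
- by move=> j t g js; exact: probe_direction.
Qed.

(** Split the hidden vector of layer [i] into [hidden g i s] and its projection on the first [s]
    vectors. The image of the former is seen through [direction]; the latter has squared length at
    most [leak g i] because [s <= i], and U at most doubles it. *)
Lemma leak_step_pointwise i g : (i < L)%N -> \1_good g * leak g i.+1 <=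
  \sum_(s < i.+1) (2 * dot (direction i s g) g ^+ 2 + 4 * (\1_good g * leak g i)).
Proof.
move=> iL; rewrite indicE; case: (boolP (g \in good)) => [|_]; last first.
  rewrite mul0r; apply: sumr_ge0 => s _.
  by rewrite mul0r mulr0 addr0 mulr_ge0 ?sqr_ge0.
rewrite inE => gg; rewrite mul1r; apply: ler_sum => s _; rewrite mul1r.
have e2 : dot (eta_ g i) (eta_ g i) <= 2.
  exact: (dot_chain_vec_le2 lay_k0 (Ulay g) a_le1 eps_ge0 gg eps_small (ltnW iL)).
rewrite direction_dot indicE mem_set// mul1r.
set u := frame g i.+1 s; set h := hidden g i s.
have -> : eta_ g i.+1 = U g *m h + U g *m (eta_ g i - h).
  by rewrite -mulmxDr addrC subrK.
have : dot u (U g *m (eta_ g i - h)) ^+ 2 <= 2 * leak g i.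
  apply: le_trans (dot_cauchy _ _) _.
  have u1 : dot u u <= 1 by exact: dot_normalize_le1.
  apply: (@le_trans _ _ (dot (U g *m (eta_ g i - h)) (U g *m (eta_ g i - h)))).
    by rewrite ler_piMl ?dotxx_ge0.
  apply: (@le_trans _ _ ((1 + eps) * dot (eta_ g i - h) (eta_ g i - h))).
    exact: (dot_mulU a_le1 eps_ge0 gg).
  apply: ler_pM; rewrite ?dotxx_ge0 ?addr_ge0//; first by have := eps_le1; lra.
  rewrite /h /hidden -sum_gs_proj /leak.
  rewrite -(big_mkord xpredT (fun r => dot (gs _ r) _ ^+ 2)) -(big_mkord xpredT (fun r => dot (frame g i r) _ ^+ 2)).
  rewrite [leRHS](big_cat_nat _ (n := s))//=; last by rewrite -ltnS.
  by rewrite lerDl; apply: sumr_ge0 => r _; exact: sqr_ge0.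
rewrite dotDr.
have := sqr_ge0 (dot u (U g *m h) - dot u (U g *m (eta_ g i - h))).
rewrite sqrrB sqrrD; lra.
Qed.

Lemma leak_step i : (i < L)%N ->
  (\int[gauss (n * n)]_g (\1_good g * leak g i.+1)%:E <=
   (4 * i.+1%:R)%:E * (K%:R^-1%:E +
     \int[gauss (n * n)]_g (\1_good g * leak g i)%:E))%E.
Proof.
move=> iL.
have mgood : measurable good by exact: measurable_good.
have mgl m : measurable_fun setT (fun g => \1_good g * leak g m).
  by apply: measurable_funM; [exact: measurable_indic|exact: measurable_leak].
have gl0 m g : 0 <= \1_good g * leak g m.
  by rewrite mulr_ge0 ?leak_ge0// indicE; case: (_ \in _).
have md s : measurable_fun setT (fun g => dot (direction i s g) g ^+ 2).
  by apply: measurable_funX; apply: measurable_dot => //; exact: measurable_id.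
apply: (@le_trans _ _ (\int[gauss (n * n)]_g (\sum_(s < i.+1)
    (2 * dot (direction i s g) g ^+ 2 + 4 * (\1_good g * leak g i)))%:E)%E).
  apply: ge0_le_integral_EFin => //; last by move=> g; exact: leak_step_pointwise.
  apply: measurable_sum => s; apply: measurable_funD; apply: measurable_funM => //;
    exact: measurable_cst.
rewrite ge0_integral_sum_EFin; last 2 first.
- move=> s; apply: measurable_funD; apply: measurable_funM => //; exact: measurable_cst.
- by move=> s g; rewrite addr_ge0// mulr_ge0 ?sqr_ge0.
set I := (\int[gauss (n * n)]_g (\1_good g * leak g i)%:E)%E.
apply: (@le_trans _ _ (\sum_(s < i.+1) ((4 / K%:R)%:E + 4%:E * I))%E).
  apply: lee_sum => s _.
  rewrite (@ge0_integralD_EFin _ _ _ _ (fun g => 2 * dot (direction i s g) g ^+ 2)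
    (fun g => 4 * (\1_good g * leak g i)))//.
  - rewrite !ge0_integralZ_EFin//; last by move=> g; exact: sqr_ge0.
    apply: leeD => //.
    apply: le_trans (lee_wpmul2l _ (direction_norm s iL)) _ => //.
    by rewrite -EFinM lee_fin; lra.
  - by apply: measurable_funM => //; exact: measurable_cst.
  - by apply: measurable_funM => //; exact: measurable_cst.
  - by move=> g; rewrite mulr_ge0 ?sqr_ge0.
  - by move=> g; rewrite mulr_ge0.
have I0 : (0 <= I)%E by apply: integral_ge0 => g _; rewrite lee_fin.
clearbody I.
have -> : ((4 / K%:R)%:E + 4%:E * I = 4%:E * (K%:R^-1%:E + I))%E.
  by rewrite ge0_muleDr ?lee_fin ?invr_ge0// EFinM.
set c := (4%:E * _)%E.
have c0 : (0 <= c)%E by rewrite mule_ge0 ?adde_ge0 ?lee_fin ?invr_ge0.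
have -> : ((4 * i.+1%:R)%:E * (K%:R^-1%:E + I) = i.+1%:R%:E * c)%E.
  by rewrite mulrC EFinM -muleA.
elim: (i.+1) => [|m IH]; first by rewrite big_ord0 mul0e.
rewrite big_ord_recr/= -natr1 EFinD ge0_muleDl ?lee_fin// mul1e.
exact: leeD2r.
Qed.

End hidden_chain.

(** * Existence of the layers *)

Lemma layers_exist (L K : nat) : (0 < K)%N ->
  exists n (lay : 'I_n -> nat) (k0 : 'I_n),
    [/\ forall k, (lay k <= L)%N,
        forall i, (i <= L)%N -> (0 < layer_size lay i)%N,
        forall i, (i < L)%N -> (K * layer_size lay i ^ 2 <= layer_size lay i.+1)%N
        & lay k0 = 0%N].
Proof.
move=> K0; pose N := fix N i := if i is j.+1 then (K * N j ^ 2)%N else 1%N.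
have N0 i : (0 < N i)%N by elim: i => //= i IH; rewrite muln_gt0 K0 expn_gt0 IH.
pose T := {i : 'I_L.+1 & 'I_(N i)}.
pose lay (k : 'I_#|{: T}|) : nat := tag (enum_val k).
have sizeE i : (i <= L)%N -> layer_size lay i = N i.
  move=> iL; pose i' : 'I_L.+1 := Ordinal (iL : (i < L.+1)%N).
  rewrite /layer_size -[RHS]card_ord.
  pose h (x : 'I_(N i)) : 'I_#|{: T}| := enum_rank (Tagged (fun i : 'I_L.+1 => 'I_(N i)) (x : 'I_(N i'))).
  have hI : injective h by move=> x y /enum_rank_inj/eqP; rewrite eq_Tagged => /eqP.
  rewrite -(fintype.card_image hI); apply: eq_card => k; rewrite inE /lay.
  apply/eqP/fintype.imageP => [kE|[x _ ->]]; last by rewrite enum_rankK.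
  case E : (enum_val k) kE => [j x] /= jE.
  have ji : j = i' by apply: val_inj.
  subst j; exists x => //; apply: (can_inj enum_valK).
  by rewrite enum_rankK E.
have [k0 k0E] : exists k0 : 'I_#|{: T}|, lay k0 = 0%N.
  exists (enum_rank (Tagged (fun i : 'I_L.+1 => 'I_(N i)) (ord0 : 'I_(N ord0)))).
  by rewrite /lay enum_rankK.
exists #|{: T}|, lay, k0; split => //.
- by move=> k; rewrite -ltnS /lay.
- by move=> i iL; rewrite sizeE.
- by move=> i iL; rewrite !sizeE// ltnW.
Qed.

(** * The expected leak *)

Section leak_expectation.
Context {R : realType} (n : nat) (lay : 'I_n -> nat) (L K : nat) (a eps : R)
  (k0 : 'I_n).
Context (lay_le : forall k, (lay k <= L)%N) (a_gt0 : 0 < a) (a_le1 : a <= 1)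
  (size_gt0 : forall i, (i <= L)%N -> (0 < layer_size lay i)%N)
  (K_gt0 : (0 < K)%N)
  (size_growth : forall i, (i < L)%N ->
    (K * layer_size lay i ^ 2 <= layer_size lay i.+1)%N)
  (lay_k0 : lay k0 = 0%N)
  (eps_ge0 : 0 <= eps) (eps_le1 : eps <= 1) (eps_small : 2 * L%:R * eps <= a).
Local Notation U g := (raise lay a g).
Local Notation A g := (chain_mx lay a (U g)).
Local Notation good := (good lay L a eps).
Context (v : 'cV[R]_(n * n) -> nat -> 'cV[R]_n)
  (v_det : forall r g g',
    (forall j, (j < r)%N -> v g j = v g' j /\ A g *m v g j = A g' *m v g' j) ->
    v g r = v g' r)
  (mv : forall r, measurable_fun setT (v ^~ r)).

(** The recursion of [leak_step] with 1 / K factored out, starting from an empty sum at layer 0. It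
    is independent of K, so K can be chosen after it. *)
Fixpoint leak_bound i : nat := if i is j.+1 then (4 * i * (1 + leak_bound j))%N else 0%N.

Lemma leak_expect i : (i <= L)%N ->
  (\int[gauss (n * n)]_g (\1_good g * leak lay a k0 v g i)%:E <=
   ((leak_bound i)%:R / K%:R)%:E)%E.
Proof.
elim: i => [_|i IH iL].
  rewrite mul0r; under eq_integral do rewrite /leak big_ord0 mulr0.
  by rewrite integral0.
have k1 : 0 < K%:R :> R by rewrite ltr0n.
apply: le_trans (leak_step lay_le a_gt0 a_le1 size_gt0 K_gt0 size_growth lay_k0
  eps_ge0 eps_le1 eps_small v_det mv iL) _.
apply: le_trans (lee_wpmul2l _ (leeD2l _ (IH (ltnW iL)))) _.
  by rewrite lee_fin mulr_ge0.
rewrite -EFinD -EFinM lee_fin le_eqVlt; apply/orP; left; apply/eqP.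
by rewrite /= !natrM natrD; field; rewrite gt_eqF.
Qed.

Lemma prob_leak (S : set 'cV[R]_(n * n)) (p : R) :
  0 < eps -> (leak_bound L)%:R <= p * eps ^+ 2 * K%:R ->
  measurable S -> S `<=` good ->
  (forall g, S g -> eps ^+ 2 <= leak lay a k0 v g L) ->
  (gauss (n * n) S <= p%:E)%E.
Proof.
move=> e0 pK mS Sgood Sleak.
have e2 : 0 < eps ^+ 2 by rewrite exprn_gt0.
have k1 : 0 < K%:R :> R by rewrite ltr0n.
rewrite -(@lee_pmul2l _ (eps ^+ 2)%:E)// ?lte_fin// -EFinM.
have mgood : measurable good := measurable_good eps lay_le a_gt0 size_gt0.
have ml : measurable_fun setT (fun g => leak lay a k0 v g L).
  exact: measurable_leak.
apply: le_trans (le_trans (leak_expect (leqnn L)) _); last first.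
  by rewrite lee_fin ler_pdivrMr// [eps ^+ 2 * p]mulrC.
apply: markov_EFin => //.
- by apply: measurable_funM => //; exact: measurable_indic.
- by move=> g; rewrite mulr_ge0 ?leak_ge0// indicE; case: (_ \in _).
- exact: ltW.
- by move=> g Sg; rewrite indicE mem_set ?mul1r; [exact: Sleak|exact: Sgood].
Qed.

End leak_expectation.

(** * Transcripts of an algorithm *)

Section transcripts.
Context {R : realType} (n : nat) (al : algorithm R n).

Lemma transcriptS (F : 'cV[R]_n -> R) (w : alg_seed al) s (h := transcript F w s)
    (x := alg_next (w, h)) :
  transcript F w s.+1 = [tuple of (x, (F x, gradient F x)) :: h].
Proof. by []. Qed.

Lemma eq_transcript (F F' : 'cV[R]_n -> R) (w : alg_seed al) s :
  (forall q (x := alg_next (w, transcript F w q)), (q < s)%N ->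
     F x = F' x /\ gradient F x = gradient F' x) ->
  transcript F w s = transcript F' w s.
Proof.
elim: s => [//|s IH] FF'; rewrite !transcriptS.
have [vE gE] := FF' s (ltnSn s).
have tE : transcript F w s = transcript F' w s.
  by apply: IH => q x qs; apply: FF'; exact: ltnW.
by rewrite vE gE tE.
Qed.

Lemma measurable_transcript d (T : measurableType d) (F : T -> 'cV[R]_n -> R)
    (w : T -> alg_seed al) s :
  measurable_fun setT w ->
  (forall x : T -> 'cV[R]_n, measurable_fun setT x ->
     measurable_fun setT (fun z => F z (x z)) /\
     measurable_fun setT (fun z => gradient (F z) (x z))) ->
  measurable_fun setT (fun z => transcript (F z) (w z) s).
Proof.
move=> mw mF; elim: s => [|s IH]; first exact: measurable_cst.
have mx : measurable_fun setT (fun z => alg_next (w z, transcript (F z) (w z) s)).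
  apply: (measurableT_comp (@alg_next_measurable _ _ al s)).
  exact: measurable_fun_pair.
have [mv mg] := mF _ mx.
under eq_fun do rewrite transcriptS.
apply: measurable_cons IH; apply: measurable_fun_pair mx _.
exact: measurable_fun_pair.
Qed.

End transcripts.

(** * From oracle queries to matrix-vector products *)

Section oracle_interaction.
Context {R : realType} (n : nat) (lay : 'I_n -> nat) (a : R) (k0 : 'I_n).
Context (al : algorithm R n).
Local Notation A g := (chain_mx lay a (raise lay a g)).
Local Notation b := (delta_mx k0 0 : 'cV[R]_n).
Local Notation f g := (least_squares (A g) b).

Definition oracle_query w (g : 'cV[R]_(n * n)) s : 'cV[R]_n :=
  @alg_next _ _ al s (w, transcript (f g) w s).

(* The right-hand side, each query [x] and its image [A x], interleaved so that
   each term depends only on the previous terms and on their images by [A]. *)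
Definition krylov_seq w (g : 'cV[R]_(n * n)) j : 'cV[R]_n :=
  if j is j'.+1 then
    if odd j' then A g *m oracle_query w g j'./2 else oracle_query w g j'./2
  else b.

Lemma krylov_seq_odd w g s : krylov_seq w g s.*2.+1 = oracle_query w g s.
Proof. by rewrite /krylov_seq odd_double doubleK. Qed.

Lemma krylov_seq_even w g s :
  krylov_seq w g s.*2.+2 = A g *m oracle_query w g s.
Proof. by rewrite /krylov_seq /= odd_double /= uphalf_double. Qed.

Lemma gradient_chain g x :
  gradient (f g) x = A g *m (A g *m x) - A g *m b.
Proof. by rewrite gradient_least_squares chain_mx_tr mulmxBr. Qed.

(** A term [A x] is the image of its predecessor. A query depends on the earlier answers, which the
    images of the earlier terms determine; term 0 is there to supply [A b]. *)
Lemma krylov_seq_determined w r g g' :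
  (forall j, (j < r)%N -> krylov_seq w g j = krylov_seq w g' j /\
     A g *m krylov_seq w g j = A g' *m krylov_seq w g' j) ->
  krylov_seq w g r = krylov_seq w g' r.
Proof.
case: r => [//|r] ag; have rE := odd_double_half r.
case: (odd r) rE => rE.
  have [_] := ag r (ltnSn r); rewrite -rE add1n.
  rewrite (krylov_seq_odd w g) (krylov_seq_odd w g').
  by rewrite (krylov_seq_even w g) (krylov_seq_even w g').
rewrite -rE add0n (krylov_seq_odd w g) (krylov_seq_odd w g') /oracle_query.
suff -> : transcript (f g) w r./2 = transcript (f g') w r./2 by [].
apply: eq_transcript => q; rewrite -/(oracle_query w g q) => x qr.
have q1 : (q.*2.+2 < r.+1)%N by rewrite ltnS -rE add0n -doubleS leq_double.
have [xE] := ag q.*2.+1 (ltnW q1).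
rewrite (krylov_seq_odd w g) (krylov_seq_odd w g') -/x in xE *.
rewrite -xE => AE.
have [_] := ag q.*2.+2 q1.
rewrite (krylov_seq_even w g) (krylov_seq_even w g') -/x -xE => AAE.
have [_ bE] := ag 0%N (ltn0Sn _); rewrite /krylov_seq in bE.
clearbody x; split; first by rewrite 2!least_squaresE AE.
by rewrite 2!gradient_chain AAE bE.
Qed.

Let W := alg_seed al.

Lemma measurable_chain_mulmx (F : W * 'cV[R]_(n * n) -> 'cV[R]_n) :
  measurable_fun setT F -> measurable_fun setT (fun z => A z.2 *m F z).
Proof.
move=> mF; apply: measurable_mulmx => // k l.
have mU i j : measurable_fun [set: W * 'cV[R]_(n * n)]
    (fun z => raise lay a z.2 i j).
  apply: (measurableT_comp (f := fun g => raise lay a g i j)) measurable_snd.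
  exact: measurable_weighted.
under eq_fun do rewrite [chain_mx _ _ _ _ _]mxE [(raise lay a _ + _) _ _]mxE
  [(raise lay a _)^T _ _]mxE.
by do 2 apply: measurable_funD => //; exact: measurable_cst.
Qed.

(** Joint measurability in the seed and the instance is what exchanging the two averages requires;
    fixing the seed is a section of it. *)
Lemma measurable_oracle_query s : measurable_fun setT
  (fun z : W * 'cV[R]_(n * n) => oracle_query z.1 z.2 s).
Proof.
apply: (measurableT_comp (@alg_next_measurable _ _ al s)).
apply: measurable_fun_pair measurable_fst _.
apply: (@measurable_transcript _ _ al _ _ (fun z => f z.2) fst) => [|x mx].
  exact: measurable_fst.
have mA := measurable_chain_mulmx mx.
have mb : measurable_fun [set: W * 'cV[R]_(n * n)] (fun=> b).
  exact: measurable_cst.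
split.
  under eq_fun do rewrite least_squaresE.
  apply: measurable_funM; first exact: measurable_cst.
  by apply: measurable_dot; exact: measurable_subv.
under eq_fun do rewrite gradient_chain.
by apply: measurable_subv; exact: measurable_chain_mulmx.
Qed.

Lemma measurable_krylov_seq w r :
  measurable_fun setT (fun g => krylov_seq w g r).
Proof.
have mj : measurable_fun setT (fun z : W * 'cV[R]_(n * n) => krylov_seq z.1 z.2 r).
  case: r => [|r]; first exact: measurable_cst.
  rewrite /krylov_seq; case: (odd r); last exact: measurable_oracle_query.
  by apply: measurable_chain_mulmx; exact: measurable_oracle_query.
exact: (measurableT_comp mj (pair1_measurable w)).
Qed.

End oracle_interaction.

(** * Averaging over seeds and instances *)

Section averaging.
Context {R : realType} d1 d2 (T1 : measurableType d1) (T2 : measurableType d2).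
Context (P1 : probability T1 R) (P2 : probability T2 R).

(* The easy half of Yao's principle. *)
Lemma yao_averaging (A : set (T1 * T2)) (D : set T2) (p q : R) :
  measurable A -> measurable D -> 0 <= q ->
  (forall y, D y -> (q%:E <= P1 (ysection A y))%E) ->
  (forall x, (P2 (xsection A x) <= p%:E)%E) ->
  (q%:E * P2 D <= p%:E)%E.
Proof.
move=> mA mD q0 Dq Ap.
have mG : measurable_fun setT (P1 \o ysection A) by exact: measurable_fun_ysection.
have mF : measurable_fun setT (P2 \o xsection A) by exact: measurable_fun_xsection.
have FG : (\int[P1]_x (P2 \o xsection A) x = \int[P2]_y (P1 \o ysection A) y)%E.
  have := indic_fubini_tonelli P1 P2 mA.
  by rewrite indic_fubini_tonelli_FE// indic_fubini_tonelli_GE.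
apply: (@le_trans _ _ (\int[P2]_(y in D) (P1 \o ysection A) y)%E).
  rewrite -integral_cst//; apply: ge0_le_integral => //.
  exact: measurable_funS mG.
apply: (@le_trans _ _ (\int[P2]_y (P1 \o ysection A) y)%E).
  exact: ge0_subset_integral.
rewrite -FG; apply: (@le_trans _ _ (\int[P1]_x p%:E)%E).
  by apply: ge0_le_integral => // x _; exact: Ap.
by rewrite (integral_cst P1 measurableT) -[leRHS]mule1 lee_wpmul2l ?(le_trans _ (Ap point)) ?probability_le1.
Qed.

End averaging.

(** * Numerical estimates *)

Section growth.
Context {R : realType}.

(** Here a times the exponent is at most 6 a T = 24 T / sqrt kappa, and 48 makes this at most half
    of ln (1 / delta). So the power is at most [y], which is delta^(-1/2), and the product is at
    most sqrt delta < 1/2. *)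
Lemma growth_bound (kappa delta : R) T (a := 4 / Num.sqrt kappa) :
  16 <= kappa -> 0 < delta -> delta <= 48^-1 -> (0 < T)%N ->
  T%:R < 48^-1 * Num.sqrt kappa * ln delta^-1 ->
  delta * (1 + a) ^+ (2 * (2 * T).+1) < 9 / 16.
Proof.
move=> k16 d0 d48 T0 Tlt.
have s0 : 0 < Num.sqrt kappa by rewrite sqrtr_gt0; lra.
have a0 : 0 < a by rewrite divr_gt0.
pose y := expR (2^-1 * ln delta^-1).
have y0 : 0 < y := expR_gt0 _.
have y2 : delta * y ^+ 2 = 1.
  rewrite -expRM_natl mulrA mulfV// mul1r lnK ?posrE ?invr_gt0// mulfV//.
  by rewrite gt_eqF.
have T1 : 1 <= T%:R :> R by rewrite ler1n.
have aT : a * (2 * (2 * T).+1)%N%:R <= 2^-1 * ln delta^-1.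
  rewrite natrM -(natr1 (2 * T)%N) natrM.
  apply: (@le_trans _ _ (a * (6 * T%:R))); first by rewrite ler_pM2l//; lra.
  apply: (@le_trans _ _ (a * (6 * (48^-1 * Num.sqrt kappa * ln delta^-1)))).
    by rewrite ler_pM2l// ler_pM2l// ltW.
  rewrite le_eqVlt; apply/orP; left; apply/eqP; rewrite /a; field.
  by rewrite !gt_eqF.
have le_y : (1 + a) ^+ (2 * (2 * T).+1) <= y.
  apply: (@le_trans _ _ (expR a ^+ (2 * (2 * T).+1))).
    apply: lerXn2r; rewrite ?nnegrE ?expR_ge0 ?expR_ge1Dx// addr_ge0//.
    exact: ltW.
  by rewrite -expRM_natl ler_expR mulrC.
apply: (@le_lt_trans _ _ (delta * y)); first by rewrite ler_pM2l.
have : 48 <= y ^+ 2.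
  rewrite -[leRHS]mul1r -[X in X * _](@mulVf _ delta) ?gt_eqF//.
  rewrite -mulrA y2 mulr1 -[leLHS]invrK lef_pV2// posrE.
  by rewrite invr_gt0.
move=> y48; have y2' : 2 < y.
  rewrite ltNge; apply/negP => y2'.
  have : y * y <= 2 * 2 by apply: ler_pM => //; exact: ltW.
  by move: y48; rewrite expr2; lra.
rewrite -(ltr_pM2r y0) -mulrA -expr2 y2; lra.
Qed.

Lemma nat_scale (eps : R) (x : nat) : 0 < eps ->
  exists2 K, (0 < K)%N & x%:R <= eps ^+ 2 * K%:R.
Proof.
move=> e0; have e2 : 0 < eps ^+ 2 by rewrite exprn_gt0.
have h0 : 0 <= x%:R / eps ^+ 2 by rewrite divr_ge0// ltW.
have := archi_boundP h0; set K := Num.bound _ => hK.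
exists K; first by rewrite -(ltr0n R); exact: le_lt_trans hK.
by rewrite mulrC -ler_pdivrMr// ltW.
Qed.

End growth.

(** * Success on the hard instance and the conclusion *)

Section hard_instance.
Context {R : realType} (n : nat) (lay : 'I_n -> nat) (T : nat) (a eps delta : R)
  (k0 : 'I_n) (al : algorithm R n).
Local Notation L := (2 * T)%N.
Local Notation A g := (chain_mx lay a (raise lay a g)).
Local Notation b := (delta_mx k0 0 : 'cV[R]_n).
Local Notation f g := (least_squares (A g) b).
Local Notation good := (good lay L a eps).
Context (lay_le : forall k, (lay k <= L)%N) (a_gt0 : 0 < a) (a_le1 : a <= 1)
  (lay_k0 : lay k0 = 0%N) (eps_gt0 : 0 < eps) (T_gt0 : (0 < T)%N)
  (eps_small : 2 * L%:R * eps <= a) (eps_tiny : 32 * L.+1%:R * 2 ^+ L * eps <= a)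
  (delta_gt0 : 0 < delta) (delta_le1 : delta <= 1)
  (few_queries : delta * (1 + a) ^+ (2 * L.+1) < 9 / 16).

(** The optimal value is 0 and the value at 0 is 1/2, as b is a unit vector. *)
Lemma excessE g x :
  (f g x - inf (range (f g)) <= delta * (f g 0 - inf (range (f g)))) =
  (dot (A g *m x - b) (A g *m x - b) <= delta).
Proof.
rewrite (inf_range_least_squares _ (chain_mx_unit (@raise_lay _ _ lay a g) a_gt0)).
rewrite !least_squaresE !subr0 mulmx0 sub0r dotNl dotNr opprK dot_delta mxE !eqxx.
by rewrite mulr1 [leRHS]mulrC ler_pM2l// invr_gt0.
Qed.

Lemma success_leak (w : alg_seed al) g (x := oracle_query lay a k0 w g T.-1) : good g ->
  dot (A g *m x - b) (A g *m x - b) <= delta ->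
  eps ^+ 2 <= leak lay a k0 (krylov_seq lay a k0 w) g L.
Proof.
move=> gg xd; rewrite leNgt; apply/negP => small.
have U_lay := @raise_lay _ _ lay a g.
have supp k : lay k != L -> chain_vec (raise lay a g) k0 L k 0 = 0.
  exact: chain_vec_supp.
have xE : x = krylov_seq lay a k0 w g T.-1.*2.+1 by rewrite krylov_seq_odd.
suff : 9 / 16 <= delta * (1 + a) ^+ (2 * L.+1).
  by have := few_queries; lra.
apply: (chain_lower_bound (x := x) lay_le lay_k0 U_lay a_gt0 a_le1 (ltW eps_gt0) gg
  eps_small eps_tiny) => //; [exact: ltW|by rewrite muln_gt0|].
rewrite -(dot_lproj _ supp) xE.
(* The last query has index 2 T - 1 in [krylov_seq], hence is among the first L vectors that [leak]
   counts at layer L; this dictates L = 2 T. *)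
have TL : (T.-1.*2.+1 < L)%N.
  by rewrite -[X in (_ < 2 * X)%N](prednK T_gt0) mul2n doubleS.
apply: le_trans (dot_vec_gs (fun r => lproj lay L (krylov_seq lay a k0 w g r)) _ TL) _.
rewrite mulrC; apply: ler_pM; rewrite ?dotxx_ge0 ?dot_lproj_le//.
  by apply: sumr_ge0 => s _; exact: sqr_ge0.
exact: ltW.
Qed.

(** Intersecting with [good] makes [prob_leak] applicable at each fixed seed and costs nothing at a
    good instance. *)
Definition hits : set (alg_seed al * 'cV[R]_(n * n)) :=
  [set z | dot (A z.2 *m oracle_query lay a k0 z.1 z.2 T.-1 - b)
    (A z.2 *m oracle_query lay a k0 z.1 z.2 T.-1 - b) <= delta] `&`
  (snd @^-1` good).

Lemma measurable_hits : measurable good -> measurable hits.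
Proof.
move=> mgood; apply: measurableI; last first.
  by rewrite -[_ @^-1` _]setTI; apply: measurable_snd.
rewrite -[X in measurable X]setTI; apply: measurable_fun_le => //.
have m1 : measurable_fun setT (fun z : alg_seed al * 'cV[R]_(n * n) =>
    A z.2 *m oracle_query lay a k0 z.1 z.2 T.-1 - b).
  apply: measurable_subv; last exact: measurable_cst.
  by apply: measurable_chain_mulmx; exact: measurable_oracle_query.
exact: measurable_dot.
Qed.

End hard_instance.

Theorem mainTheorem2 (R : realType) :
  exists c C : R, [/\ 0 < c, 0 < C &
    forall (kappa delta : R), C <= kappa -> 0 < delta -> delta <= c ->
    forall (T : nat) (alg : forall n : nat, algorithm R n), (1 <= T)%N ->
    (forall (n : nat) (A : 'M[R]_n) (b : 'cV[R]_n),
       (0 < n)%N -> A^T = A -> A \in unitmx ->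
       let f := least_squares A b in
       let fstar := inf (range f) in
       (forall x, cond_number (hessian f x) <= kappa) ->
       ((2 / 3)%:E <= alg_prob (alg n)
          [set w | (f (query f T w) - fstar <= delta * (f 0 - fstar))%R])%E) ->
    c * Num.sqrt kappa * ln (delta^-1) <= T%:R].
Proof.
(* The value 48 comes from [growth_bound]; [16 <= kappa] is equivalent to 4 / sqrt kappa <= 1. *)
exists 48^-1, 16; split => //.
move=> kappa delta k16 d0 d48 T alg T0 success.
rewrite leNgt; apply/negP => Tlt.
have few := growth_bound k16 d0 d48 T0 Tlt.
set a := 4 / Num.sqrt kappa in few.
have k0' : 0 <= kappa by lra.
have s0 : 0 < Num.sqrt kappa by rewrite sqrtr_gt0; lra.
have a0 : 0 < a by rewrite divr_gt0.
have a2 : kappa * a ^+ 2 = 16.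
  rewrite /a expr_div_n sqr_sqrtr// -natrX mulrCA divff ?mulr1//.
  by rewrite gt_eqF//; lra.
have a1 : a <= 1.
  rewrite ler_pdivrMr// mul1r -(@ler_pXn2r _ 2)// ?nnegrE ?sqrtr_ge0//.
  by rewrite sqr_sqrtr// -natrX; lra.
clearbody a.
(* The left side is at most 9 and the right side is 16. *)
have cond : a ^+ 2 + 8 <= kappa * a ^+ 2.
  have : a ^+ 2 <= 1 by rewrite expr_le1// ltW.
  by rewrite a2; lra.
pose L := (2 * T)%N.
have L0 : (0 < L)%N by rewrite muln_gt0.
pose N : R := 32 * L.+1%:R * 2 ^+ L.
have N0 : 0 < N by rewrite !mulr_gt0 ?exprn_gt0 ?ltr0n.
pose eps := a / N.
have e0 : 0 < eps by rewrite divr_gt0.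
have tiny : 32 * L.+1%:R * 2 ^+ L * eps <= a.
  by rewrite -/N mulrCA divff ?mulr1// gt_eqF.
have L1 : 1 <= L%:R :> R by rewrite ler1n.
have N_ge : 2 * L%:R <= N.
  rewrite /N -(natr1 L); apply: (@le_trans _ _ (32 * (L%:R + 1))); first by lra.
  by rewrite ler_peMr ?exprn_ege1//; lra.
have small : 2 * L%:R * eps <= a.
  by apply: le_trans tiny; rewrite -/N ler_pM2r.
have e1 : eps <= 1.
  have : 1 * eps <= 2 * L%:R * eps by rewrite ler_pM2r//; lra.
  by lra.
clearbody eps.
(* The first summand serves [prob_good], the second bounds by 1/6 the probability of a large leak. K
   is fixed after eps, and the dimension after K. *)
have [K K0 Kbig] := nat_scale (10 * L + 6 * leak_bound L) e0.
have KL : 10 * L%:R <= eps ^+ 2 * K%:R.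
  by apply: le_trans Kbig; rewrite natrD natrM lerDl ler0n.
have Kleak : (leak_bound L)%:R <= 6^-1 * eps ^+ 2 * K%:R.
  by move: Kbig KL; rewrite -mulrA natrD (natrM _ 10) (natrM _ 6); lra.
have [n [lay [k0 [lay_le size_gt0 growth lay_k0]]]] := layers_exist L K0.
have n1 : (1 < n)%N.
  have /card_gt0P[k1] := size_gt0 1%N L0; rewrite inE => /eqP k1E.
  have := ltn_ord k0; have := ltn_ord k1; rewrite ltnNge.
  case: n lay k0 k1 lay_le size_gt0 growth lay_k0 k1E => [|[|//]] lay k0 k1.
    by case: k0.
  by rewrite (ord1 k0) (ord1 k1) => _ _ _ ->.
have d1 : delta <= 1 by lra.
have mgood := measurable_good eps lay_le a0 size_gt0.
pose H := @hits R n lay T a eps delta k0 (alg n).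
have mH : measurable H := @measurable_hits R n lay T a eps delta k0 (alg n) mgood.
have pgood := prob_good lay_le a0 a1 size_gt0 K0 growth n1 e0 KL.
suff H1 g : good lay L a eps g -> ((2 / 3)%:E <= alg_prob (alg n) (ysection H g))%E.
  suff H2 w : (gauss (n * n) (xsection H w) <= 6^-1%:E)%E.
    have q0 : 0 <= 2 / 3 :> R by lra.
    (* Success on good instances, of probability at least 1/2, would give at least 2/3 times 1/2,
       that is 1/3, against the upper bound 1/6. *)
    have := yao_averaging mH mgood q0 H1 H2; apply/negP; rewrite -ltNge.
    apply: (@lt_le_trans _ _ ((2 / 3)%:E * 2^-1%:E)%E).
      by rewrite -EFinM lte_fin; lra.
    exact: lee_wpmul2l.
  apply: (prob_leak lay_le a0 a1 size_gt0 K0 growth lay_k0 (ltW e0) e1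
    small (krylov_seq_determined (w := w)) (measurable_krylov_seq lay a k0 w) e0 Kleak).
  - exact: measurable_xsection.
  - by move=> g; rewrite /xsection/= inE => -[].
  - move=> g; rewrite /xsection/= inE => -[/= hit gg].
    exact: (success_leak lay_le a0 a1 lay_k0 e0 T0 small tiny d0 d1 few).
move=> gg; have U_lay := @raise_lay _ _ lay a g.
have := success n (chain_mx lay a (raise lay a g)) (delta_mx k0 0) (ltnW n1)
  (chain_mx_tr _ _ _) (chain_mx_unit U_lay a0).
move=> /(_ _)/le_trans; apply => [x|].
  rewrite hessian_least_squares.
  exact: (cond_number_chain U_lay a0 a1 (ltW e0) gg e1 cond k0').
rewrite le_eqVlt; apply/orP; left; apply/eqP; congr (alg_prob _ _).
apply/seteqP; split => w; rewrite /ysection/= inE /hits/= excessE//; by case.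
Qed.
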